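(* In the case $\theta=0$, the noncommutative residue on classical pseudodifferential operators on the noncommutative two torus $A_\theta$ coincides with the noncommutative residue on classical Euclidean pseudodifferential operators on $\mathbb{T}^2$. That is, identifying $A_0^\infty$ with $C^\infty(\mathbb{T}^2)$, for every classical pseudodifferential operator $P$ of integral order on $A_0^\infty=C^\infty(\mathbb{T}^2)$ one has $$\mathrm{Res}_{A_0}(P)=\mathrm{Res}_{\mathbb{T}^2}(P),$$ where $\mathrm{Res}_{A_0}$ is the noncommutative residue for $A_\theta$ at $\theta=0$ and $\mathrm{Res}_{\mathbb{T}^2}$ is the noncommutative residue for classical Euclidean pseudodifferential operators on $\mathbb{T}^2$.
   Context: **Euclidean side.** Let $\mathbb{T}^2=\mathbb{R}^2/2\pi\mathbb{Z}^2$ and $\langle\xi\rangle=(1+|\xi|^2)^{1/2}$. For $m\in\mathbb{Z}$, $S^m(\mathbb{T}^2\times\mathbb{R}^2)$ is the set of $C^\infty$ functions $\sigma:\mathbb{T}^2\times\mathbb{R}^2\to\mathbb{C}$ such that for all multi-indices $\alpha,\beta$ there is $C_{\alpha,\beta}>0$ with $|(\partial_x^\alpha\partial_\xi^\beta\sigma)(x,\xi)|\le C_{\alpha,\beta}\langle\xi\rangle^{m-|\beta|}$ for all $(x,\xi)$. The associated operator on $C^\infty(\mathbb{T}^2)$ is $$(T_\sigma f)(x)=\int_{\mathbb{R}^2}\int_{\mathbb{R}^2}e^{i(x-y)\cdot\xi}\sigma(x,\xi)f(y)\,dy\,d\xi,$$ understood as an oscillatory integral with $f$ regarded as a $2\pi\mathbb{Z}^2$-periodic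 function on $\mathbb{R}^2$ (no factor $(2\pi)^{-2}$ is included). The symbol is classical if $\sigma(x,\xi)\sim\sum_{j\ge0}\sigma_{m-j}(x,\xi)$ as $|\xi|\to\infty$, with each $\sigma_{m-j}:\mathbb{T}^2\times(\mathbb{R}^2\setminus\{0\})\to\mathbb{C}$ smooth and positively homogeneous of order $m-j$ in $\xi$ (i.e. $\sigma-\chi\sum_{j<N}\sigma_{m-j}$ is a symbol of order $m-N$ for every $N\ge 0$, where $\chi(\xi)$ is a smooth cutoff vanishing near $0$ and equal to $1$ for large $|\xi|$); operators with classical symbols are called classical. The residue is $$\mathrm{Res}_{\mathbb{T}^2}(T_\sigma)=\int_{\mathbb{S}^1}\int_{\mathbb{T}^2}\sigma_{-2}(x,\xi)\,dx\,d\Omega,$$ where $\sigma_{-2}$ is the term homogeneous of order $-2$ (zero if there is none), $dx$ is Lebesgue measure on $\mathbb{T}^2$ (total mass $4\pi^2$) and $d\Omega$ is Lebesgue measure on the unit circle $\mathbb{S}^1$. **Noncommutative torus side.** For $\theta\in\mathbb{R}$, $A_\theta$ is the universal unital $C^*$-algebra generated by two unitaries $U,V$ with $VU=e^{2\pi i\theta}UV$. The action $\alpha_s$ ($s\in\mathbb{R}^2$) by automorphisms is given by $\alpha_s(U^mV^n)=e^{is\cdot(m,n)}U^mV^n$; $A_\theta^\infty$ is the subalgebra of elements $a$ for which $s\mapsto\alpha_s(a)$ is $C^\infty$, equivalently of series $\sum a_{m,n}U^mV^n$ with rapidly decreasing coefficients. The derivations $\delta_1,\delta_2$ of $A_\theta^\infty$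 are determined by $\delta_1(U)=U$, $\delta_1(V)=0$, $\delta_2(U)=0$, $\delta_2(V)=V$, and the normalized trace is $\mathfrak{t}(\sum a_{j,k}U^jV^k)=a_{0,0}$. A smooth map $\sigma:\mathbb{R}^2\to A_\theta^\infty$ is a symbol of order $n\in\mathbb{Z}$ if for all nonnegative integers $i_1,i_2,j_1,j_2$ there is $C>0$ with $\|\delta_1^{i_1}\delta_2^{i_2}(\partial_1^{j_1}\partial_2^{j_2}\sigma)(\xi)\|\le C(1+|\xi|)^{n-j_1-j_2}$ for all $\xi$, and there is a smooth map $k:\mathbb{R}^2\setminus\{0\}\to A_\theta^\infty$ with $\lim_{\lambda\to\infty}\lambda^{-n}\sigma(\lambda\xi_1,\lambda\xi_2)=k(\xi_1,\xi_2)$ for all $(\xi_1,\xi_2)\ne0$. The associated operator on $A_\theta^\infty$ is $$T_{\sigma,\theta}(a)=(2\pi)^{-2}\int_{\mathbb{R}^2}\int_{\mathbb{R}^2}e^{-is\cdot\xi}\sigma(\xi)\alpha_s(a)\,ds\,d\xi$$ (oscillatory integral). The symbol is classical if $\sigma(\xi)\sim\sum_{j\ge0}\sigma_{n-j}(\xi)$ as $|\xi|\to\infty$ (i.e. $\sigma-\chi\sum_{j<N}\sigma_{n-j}$ is a symbol $\mathbb{R}^2\to A_\theta^\infty$ of order $n-N$ for every $N\ge0$, where $\chi(\xi)$ is a smooth cutoff vanishing near $0$ and equal to $1$ for large $|\xi|$) with $\sigma_{n-j}:\mathbb{R}^2\setminus\{0\}\to A_\theta^\infty$ smooth and positively homogeneous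 of order $n-j$; operators with classical symbols are called classical. The residue is $$\mathrm{Res}_{A_\theta}(T_{\sigma,\theta})=\int_{\mathbb{S}^1}\mathfrak{t}(\sigma_{-2}(\xi))\,d\Omega,$$ with $\sigma_{-2}$ the term homogeneous of order $-2$ (zero if there is none). **Identification at $\theta=0$.** $A_0$ is identified with the algebra $C(\mathbb{T}^2)$ of continuous functions (with the supremum norm) via $U(x,y)=e^{ix}$, $V(x,y)=e^{iy}$, so that $A_0^\infty=C^\infty(\mathbb{T}^2)$, $\alpha_s(f)(x)=f(x+s)$, and smooth functions $\sigma:\mathbb{T}^2\times\mathbb{R}^2\to\mathbb{C}$ are identified with smooth maps $\mathbb{R}^2\to A_0^\infty$, $\xi\mapsto\sigma(\cdot,\xi)$. Under this identification the classical symbols of the two kinds, and the corresponding classes of classical operators on $C^\infty(\mathbb{T}^2)$, are the same. Both residues are functionals on these operators, each computed from the operator's symbol with respect to the respective quantization formula. *)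

(* Defs.v *)
From Stdlib Require Import Reals ZArith List Lra Lia.
From Coquelicot Require Export Coquelicot.
Import ListNotations.
Open Scope R_scope.

(** * Calculus on R^2 and R^2 x R^2

    Functions on the torus R^2 / 2 pi Z^2 are 2 pi Z^2-periodic functions
    on R^2. *)

Notation R2 := (R * R)%type.
Notation R4 := (R2 * R2)%type.

Definition dot (x y : R2) : R := fst x * fst y + snd x * snd y.
Definition enorm (x : R2) : R := sqrt (dot x x).
Definition japanese (xi : R2) : R := sqrt (1 + dot xi xi).
Definition dilate (l : R) (xi : R2) : R2 := (l * fst xi, l * snd xi).

(** e^{it} *)
Definition cis (t : R) : C := (cos t, sin t).

Fixpoint csum (N : nat) (a : nat -> C) : C :=
  match N with O => 0%C | S k => (csum k a + a k)%C end.

Definition nonzero (xi : R2) : Prop := xi <> (0, 0).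

Definition periodic (f : R2 -> C) : Prop :=
  forall x y, f (x + 2 * PI, y) = f (x, y) /\ f (x, y + 2 * PI) = f (x, y).

Section Derivatives.
Context {V : NormedModule R_AbsRing}.

Definition line (f : V -> C) (v p : V) : R -> C := fun t => f (plus p (scal t v)).

(** Derivative of [f] in the direction [v]; meaningful when [derivable_along]. *)
Definition dir (v : V) (f : V -> C) (p : V) : C :=
  (Derive (fun t => fst (line f v p t)) 0, Derive (fun t => snd (line f v p t)) 0).

Definition derivable_along (v : V) (f : V -> C) (p : V) : Prop :=
  ex_derive (fun t => fst (line f v p t)) 0 /\ ex_derive (fun t => snd (line f v p t)) 0.

(** [dirs [v1; ...; vk] f] is the iterated derivative d_{v1} ... d_{vk} f. *)
Definition dirs (l : list V) (f : V -> C) : V -> C := fold_right dir f l.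

(** C^infinity on the open set [Om]: all iterated partial derivatives, in every
    order and along the vectors of the basis [b], exist and are continuous. *)
Definition smooth_on (b : list V) (Om : V -> Prop) (f : V -> C) : Prop :=
  forall l, incl l b -> forall p, Om p ->
    continuous (dirs l f) p /\ forall v, In v b -> derivable_along v (dirs l f) p.
End Derivatives.

Definition e1 : R2 := (1, 0).
Definition e2 : R2 := (0, 1).
Definition basis2 : list R2 := [e1; e2].

Definition f1 : R4 := (e1, (0, 0)).
Definition f2 : R4 := (e2, (0, 0)).
Definition f3 : R4 := ((0, 0), e1).
Definition f4 : R4 := ((0, 0), e2).
Definition basis4 : list R4 := [f1; f2; f3; f4].

(** The multi-index (i, j) as a list of directions. *)
Definition multi2 (i j : nat) : list R2 := repeat e1 i ++ repeat e2 j.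
Definition multi4 (a1 a2 b1 b2 : nat) : list R4 :=
  repeat f1 a1 ++ repeat f2 a2 ++ repeat f3 b1 ++ repeat f4 b2.

Definition everywhere {T : Type} (_ : T) : Prop := True.

(** C^infinity(T^2), as a predicate and as a type. *)
Definition smooth_T2 (f : R2 -> C) : Prop :=
  periodic f /\ smooth_on basis2 everywhere f.

Record Cinf : Type := mkCinf { Cinf_fun :> R2 -> C; Cinf_smooth : smooth_T2 Cinf_fun }.

(** A smooth cutoff, vanishing near 0 and equal to 1 for large |xi|. *)
Definition cutoff (chi : R2 -> R) : Prop :=
  smooth_on basis2 everywhere (fun xi => RtoC (chi xi)) /\
  (exists r, 0 < r /\ forall xi, enorm xi < r -> chi xi = 0) /\
  (exists r, forall xi, r < enorm xi -> chi xi = 1).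

(** The term homogeneous of order [k] in an expansion h 0, h 1, ... of orders
    m, m - 1, ..., and [zero] if there is none. *)
Definition hom_term {X : Type} (zero : X) (m : Z) (h : nat -> X) (k : Z) : X :=
  if (k <=? m)%Z then h (Z.to_nat (m - k)) else zero.

Definition int_0_2PI (f : R -> C) : C := @RInt C_R_CompleteNormedModule f 0 (2 * PI).
Definition int_T2 (f : R2 -> C) : C := int_0_2PI (fun x => int_0_2PI (fun y => f (x, y))).
Definition int_S1 (f : R2 -> C) : C := int_0_2PI (fun t => f (cos t, sin t)).

(** * Oscillatory integrals *)

Definition int_R (f : R -> C) : C :=
  @RInt_gen C_R_CompleteNormedModule f (Rbar_locally m_infty) (Rbar_locally p_infty).
Definition int_R2 (f : R2 -> C) : C := int_R (fun u => int_R (fun w => f (u, w))).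

Definition schwartz (phi : R4 -> C) : Prop :=
  smooth_on basis4 everywhere phi /\
  forall a1 a2 b1 b2 N : nat, exists K, forall p : R4,
    (1 + enorm (fst p) + enorm (snd p)) ^ N
      * Cmod (dirs (multi4 a1 a2 b1 b2) phi p) <= K.

(** The absolutely convergent integral of F(y, xi) phi(eps ((y, xi) - (y0, xi0)))
    over R^2 x R^2, d xi being the outer integral. *)
Definition regularized (phi : R4 -> C) (p0 : R4) (eps : R) (F : R2 -> R2 -> C) : C :=
  int_R2 (fun xi => int_R2 (fun y =>
    (phi (scal eps (minus ((y, xi) : R4) p0)) * F y xi)%C)).

(** [is_osc F v]: v is the oscillatory integral of [F], i.e. the limit as eps -> 0+
    of the regularized integrals, for every Schwartz regularization with value 1 at
    the origin.  For phases y.xi and symbol amplitudes the limit depends neither on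
    [phi] nor on the base point [p0] of the dilation; quantifying over [p0] makes
    the notion manifestly translation invariant. *)
Definition is_osc (F : R2 -> R2 -> C) (v : C) : Prop :=
  forall (phi : R4 -> C) (p0 : R4), schwartz phi -> phi ((0, 0), (0, 0)) = 1%C ->
    filterlim (fun eps => regularized phi p0 eps F) (at_right 0) (locally v).

(** * Classical Euclidean pseudodifferential operators on T^2 *)

Definition uncurry4 (sigma : R2 -> R2 -> C) : R4 -> C := fun p => sigma (fst p) (snd p).

Definition eucl_symbol (m : Z) (sigma : R2 -> R2 -> C) : Prop :=
  (forall xi, periodic (fun x => sigma x xi)) /\
  smooth_on basis4 everywhere (uncurry4 sigma) /\
  forall a1 a2 b1 b2 : nat, exists K, 0 < K /\ forall x xi,
    Cmod (dirs (multi4 a1 a2 b1 b2) (uncurry4 sigma) (x, xi))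
      <= K * powerRZ (japanese xi) (m - Z.of_nat (b1 + b2)).

(** [h j] is the term of order m - j; its values at xi = 0 are irrelevant. *)
Definition eucl_classical (m : Z) (sigma : R2 -> R2 -> C) (h : nat -> R2 -> R2 -> C) : Prop :=
  eucl_symbol m sigma /\
  (forall j : nat,
     (forall xi, nonzero xi -> periodic (fun x => h j x xi)) /\
     smooth_on basis4 (fun p => nonzero (snd p)) (uncurry4 (h j)) /\
     (forall l x xi, 0 < l -> nonzero xi ->
        h j x (dilate l xi) = (powerRZ l (m - Z.of_nat j) * h j x xi)%C)) /\
  exists chi, cutoff chi /\
    forall N : nat, eucl_symbol (m - Z.of_nat N)
      (fun x xi => (sigma x xi -
         chi xi * csum N (fun j => h j x xi))%C).

Definition is_eucl_op (sigma : R2 -> R2 -> C) (P : Cinf -> Cinf) : Prop :=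
  forall (f : Cinf) (x : R2),
    is_osc (fun y xi => (cis (dot (minus x y) xi) * sigma x xi * f y)%C) (P f x).

(** [iota Q] is the unique element satisfying [Q]. *)
Definition Res_T2 (P : Cinf -> Cinf) : C :=
  @iota C_R_CompleteNormedModule (fun r =>
    exists (m : Z) sigma h, eucl_classical m sigma h /\ is_eucl_op sigma P /\
      r = int_S1 (fun xi => int_T2 (fun x => hom_term (fun _ _ => RtoC 0) m h (-2)%Z x xi))).

(** * The noncommutative torus at theta = 0

    A_0 = C(T^2) with the supremum norm and A_0^infinity = C^infinity(T^2);
    the generators are U(x, y) = e^{ix} and V(x, y) = e^{iy}. *)

Definition U : R2 -> C := fun x => cis (fst x).
Definition V : R2 -> C := fun x => cis (snd x).

Definition Cpowz (z : C) (m : Z) : C :=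
  match m with
  | Z0 => 1
  | Zpos p => z ^ Pos.to_nat p
  | Zneg p => / z ^ Pos.to_nat p
  end%C.

(** U^m V^n *)
Definition UV (m n : Z) : R2 -> C := fun x => (Cpowz (U x) m * Cpowz (V x) n)%C.

Definition A0_norm (a : R2 -> C) : Rbar := Lub_Rbar (fun r => exists x, r = Cmod (a x)).

Definition alpha (s : R2) (a : R2 -> C) : R2 -> C := fun x => a (plus x s).

(** The derivations with delta_1 U = U, delta_1 V = 0, delta_2 U = 0, delta_2 V = V
    (see [delta1_UV], [delta2_UV]). *)
Definition delta1 (a : R2 -> C) : R2 -> C := fun x => (- Ci * dir e1 a x)%C.
Definition delta2 (a : R2 -> C) : R2 -> C := fun x => (- Ci * dir e2 a x)%C.
Definition delta (i j : nat) (a : R2 -> C) : R2 -> C :=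
  Nat.iter i delta1 (Nat.iter j delta2 a).

(** Convergence in the norm of A_0, and in the Frechet topology of A_0^infinity
    given by the seminorms || delta_1^i delta_2^j a ||. *)
Definition A0_lim {T : Type} (F : (T -> Prop) -> Prop) (a : T -> R2 -> C) (b : R2 -> C) : Prop :=
  forall eps : posreal, F (fun t => Rbar_lt (A0_norm (fun x => (a t x - b x)%C)) eps).

Definition A0inf_lim {T : Type} (F : (T -> Prop) -> Prop) (a : T -> R2 -> C) (b : R2 -> C) : Prop :=
  forall i j : nat, A0_lim F (fun t => delta i j (a t)) (delta i j b).

(** The normalized trace: the coefficient a_{0,0} of the expansion of [f] as a series
    sum a_{m,n} U^m V^n with rapidly decreasing coefficients. *)
Definition rapidly_decreasing (a : Z -> Z -> C) : Prop :=
  forall N : nat, exists K, forall m n,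
    (1 + Rabs (IZR m) + Rabs (IZR n)) ^ N * Cmod (a m n) <= K.

Definition square_sum (a : Z -> Z -> C) (N : nat) : R2 -> C := fun x =>
  csum (2 * N + 1) (fun k => csum (2 * N + 1) (fun l =>
    let m := (Z.of_nat k - Z.of_nat N)%Z in
    let n := (Z.of_nat l - Z.of_nat N)%Z in
    (a m n * UV m n x)%C)).

Definition trace (f : R2 -> C) : C :=
  @iota C_R_CompleteNormedModule (fun c =>
    exists a : Z -> Z -> C, rapidly_decreasing a /\
      A0_lim eventually (square_sum a) f /\ c = a 0%Z 0%Z).

(** Iterated partial derivatives of a map R^2 -> A_0^infinity.  Evaluations at points
    of T^2 are continuous, so a derivative in A_0^infinity, when it exists, can only be
    the pointwise one; [smooth_A0_on] requires the difference quotients to converge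
    to it in A_0^infinity. *)
Definition nc_dirs (l : list R2) (sigma : R2 -> R2 -> C) : R2 -> R2 -> C :=
  fun xi x => dirs l (fun eta => sigma eta x) xi.

(** Smooth maps from the open set [Om] of R^2 to A_0^infinity. *)
Definition smooth_A0_on (Om : R2 -> Prop) (sigma : R2 -> R2 -> C) : Prop :=
  forall l, incl l basis2 -> forall xi, Om xi ->
    smooth_T2 (nc_dirs l sigma xi) /\
    A0inf_lim (locally xi) (nc_dirs l sigma) (nc_dirs l sigma xi) /\
    forall v, In v basis2 ->
      A0inf_lim (locally' 0)
        (fun h x => ((nc_dirs l sigma (plus xi (scal h v)) x - nc_dirs l sigma xi x) / h)%C)
        (nc_dirs (v :: l) sigma xi).

Definition nc_symbol (n : Z) (sigma : R2 -> R2 -> C) : Prop :=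
  smooth_A0_on everywhere sigma /\
  (forall i1 i2 j1 j2 : nat, exists K : R, 0 < K /\ forall xi,
     Rbar_le (A0_norm (delta i1 i2 (nc_dirs (multi2 j1 j2) sigma xi)))
       (K * powerRZ (1 + enorm xi) (n - Z.of_nat j1 - Z.of_nat j2))) /\
  exists k : R2 -> R2 -> C, smooth_A0_on nonzero k /\
    forall xi, nonzero xi ->
      A0inf_lim (Rbar_locally p_infty)
        (fun l x => (powerRZ l (- n) * sigma (dilate l xi) x)%C) (k xi).

(** [h j] is the term of order n - j; its value at xi = 0 is irrelevant. *)
Definition nc_classical (n : Z) (sigma : R2 -> R2 -> C) (h : nat -> R2 -> R2 -> C) : Prop :=
  nc_symbol n sigma /\
  (forall j : nat,
     smooth_A0_on nonzero (h j) /\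
     (forall l xi x, 0 < l -> nonzero xi ->
        h j (dilate l xi) x = (powerRZ l (n - Z.of_nat j) * h j xi x)%C)) /\
  exists chi, cutoff chi /\
    forall N : nat, nc_symbol (n - Z.of_nat N)
      (fun xi x => (sigma xi x - chi xi * csum N (fun j => h j xi x))%C).

(** A_0-valued oscillatory integrals: a (regularized) integral of an A_0-valued
    function is computed pointwise on T^2, and the limit is taken in norm. *)
Definition is_osc_A0 (F : R2 -> R2 -> R2 -> C) (v : R2 -> C) : Prop :=
  forall (phi : R4 -> C) (p0 : R4), schwartz phi -> phi ((0, 0), (0, 0)) = 1%C ->
    A0_lim (at_right 0)
      (fun eps x => regularized phi p0 eps (fun s xi => F s xi x)) v.

Definition is_nc_op (sigma : R2 -> R2 -> C) (P : Cinf -> Cinf) : Prop :=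
  forall a : Cinf, exists v : R2 -> C,
    is_osc_A0 (fun s xi x => (cis (- dot s xi) * (sigma xi x * alpha s a x))%C) v /\
    forall x, P a x = (/ (2 * PI) ^ 2 * v x)%C.

Definition nc_classical_op (P : Cinf -> Cinf) : Prop :=
  exists (n : Z) sigma h, nc_classical n sigma h /\ is_nc_op sigma P.

Definition Res_A0 (P : Cinf -> Cinf) : C :=
  @iota C_R_CompleteNormedModule (fun r =>
    exists (n : Z) sigma h, nc_classical n sigma h /\ is_nc_op sigma P /\
      r = int_S1 (fun xi => trace (hom_term (fun _ _ => RtoC 0) n h (-2)%Z xi))).

(** Checks that [alpha], [delta1], [delta2] are the structure maps of A_0. *)

Lemma cis_plus s t : cis (s + t) = (cis s * cis t)%C.
Proof. unfold cis, Cmult; simpl. rewrite cos_plus, sin_plus. f_equal; ring. Qed.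

Lemma cis_pow t k : (cis t ^ k)%C = cis (INR k * t).
Proof.
  induction k as [|k IH].
  - simpl. unfold cis. rewrite Rmult_0_l, cos_0, sin_0. reflexivity.
  - rewrite Cpow_S, IH, <- cis_plus, S_INR. f_equal; ring.
Qed.

Lemma Cpowz_cis t m : Cpowz (cis t) m = cis (IZR m * t).
Proof.
  destruct m as [|p|p]; unfold Cpowz.
  - unfold cis. rewrite Rmult_0_l, cos_0, sin_0. reflexivity.
  - rewrite cis_pow, INR_IZR_INZ, positive_nat_Z. reflexivity.
  - rewrite cis_pow, INR_IZR_INZ, positive_nat_Z.
    change (IZR (Zneg p)) with (- IZR (Zpos p)).
    set (u := IZR (Zpos p) * t). replace (- IZR (Zpos p) * t) with (- u) by (unfold u; ring).
    assert (H : (cis u * cis (- u))%C = 1%C).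
    { rewrite <- cis_plus, Rplus_opp_r. unfold cis. rewrite cos_0, sin_0. reflexivity. }
    assert (H0 : cis u <> 0%C).
    { intro E. rewrite E, Cmult_0_l in H. apply (f_equal fst) in H. simpl in H. lra. }
    rewrite <- (Cmult_1_r (/ cis u)), <- H, Cmult_assoc, Cinv_l, Cmult_1_l by exact H0.
    reflexivity.
Qed.

Lemma UV_cis m n x : UV m n x = cis (IZR m * fst x + IZR n * snd x).
Proof. unfold UV, U, V. rewrite !Cpowz_cis, cis_plus. reflexivity. Qed.

Lemma alpha_UV s m n x : alpha s (UV m n) x = (cis (dot s (IZR m, IZR n)) * UV m n x)%C.
Proof.
  unfold alpha. rewrite !UV_cis, <- cis_plus. f_equal.
  unfold dot; simpl. unfold plus; simpl. ring.
Qed.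

Lemma dir_UV v m n x :
  dir v (UV m n) x = (Ci * RtoC (dot v (IZR m, IZR n)) * UV m n x)%C.
Proof.
  unfold dir, line.
  set (d := dot v (IZR m, IZR n)).
  set (c := IZR m * fst x + IZR n * snd x).
  assert (E : forall t, UV m n (plus x (scal t v)) = cis (c + t * d)).
  { intro t. rewrite UV_cis. f_equal. unfold c, d, dot; simpl.
    unfold plus, scal; simpl. unfold mult; simpl. ring. }
  rewrite UV_cis. fold c.
  assert (A1 : Derive (fun t : R => fst (UV m n (plus x (scal t v)))) 0 = - d * sin c).
  { apply is_derive_unique, (is_derive_ext (fun t : R => cos (c + t * d))).
    - intro t. rewrite E. reflexivity.
    - auto_derive; auto. rewrite Rmult_0_l, Rplus_0_r. ring. }
  assert (A2 : Derive (fun t : R => snd (UV m n (plus x (scal t v)))) 0 = d * cos c).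
  { apply is_derive_unique, (is_derive_ext (fun t : R => sin (c + t * d))).
    - intro t. rewrite E. reflexivity.
    - auto_derive; auto. rewrite Rmult_0_l, Rplus_0_r. ring. }
  apply injective_projections; cbn [fst snd].
  - etransitivity; [exact A1|]. unfold c, cis, Ci, RtoC, Cmult; simpl. ring.
  - etransitivity; [exact A2|]. unfold c, cis, Ci, RtoC, Cmult; simpl. ring.
Qed.

Lemma delta1_UV m n x : delta1 (UV m n) x = (RtoC (IZR m) * UV m n x)%C.
Proof.
  unfold delta1. rewrite dir_UV. unfold dot, e1, Ci, RtoC, Copp, Cmult; simpl.
  f_equal; ring.
Qed.

Lemma delta2_UV m n x : delta2 (UV m n) x = (RtoC (IZR n) * UV m n x)%C.
Proof.
  unfold delta2. rewrite dir_UV. unfold dot, e2, Ci, RtoC, Copp, Cmult; simpl.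
  f_equal; ring.
Qed.

(* Main.v *)
(** Substituting y = x + s turns the quantization formula of A_0 into the Euclidean one,
    up to the factor (2 pi)^2; this factor is also the ratio between the integral over T^2
    and the normalized trace, by Fourier inversion.  So the triples (order, symbol,
    expansion) representing an operator on the two sides correspond to each other, with
    equal residue integrals, and the two residues are defined by equivalent predicates.

    Two points need an argument.  Smoothness of a map R^2 -> A_0^infinity is joint
    smoothness on T^2 x R^2: derivatives commute, and periodicity makes continuity in xi
    uniform in x.  And the Euclidean oscillatory integral converges pointwise in x, while
    the A_0-valued one must converge in the supremum norm: expanding the function in its
    Fourier series, the integral at frequency k concentrates at xi = k, which bounds the
    regularized integrals, and their Lipschitz constants in x, uniformly in the
    regularization parameter. *)

From Stdlib Require Import Reals List Lra Lia ZArith Permutation.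
From Stdlib Require Import FunctionalExtensionality PropExtensionality ClassicalEpsilon.
Require Import Defs.
Import ListNotations.
Open Scope R_scope.

(** The two definitions of a symbol are not symmetric: an [A_0^infinity]-valued symbol must have a
    radial limit, a Euclidean one need not. Coming from the Euclidean side, the limit has to be read
    off from the homogeneous expansion, for the symbol and for every remainder. The uniform
    convergence is shaped by the fact that the Fourier series cannot simply be exchanged with the
    limit eps -> 0. For fixed eps the regularized integral is bounded by the size of the amplitude,
    with a constant that may blow up as eps -> 0; this bound only serves to replace the function by
    a partial sum of its Fourier series. On partial sums the bound at frequency k is independent of
    eps and polynomial in k, and the decay of the coefficients absorbs it. The resulting Lipschitz
    constant is independent of eps, and equicontinuity on a compact torus turns pointwise into
    uniform convergence. All integrals are iterated integrals in one variable. Integration over a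
    period and over the line are two instances of one abstract functional, so that a single
    integration by parts argument gives the decay of Fourier coefficients and of Fourier
    transforms. *)

(** * Complex-valued functions: modulus, limits, continuity, and the tube lemma *)

Lemma Cmod_le_sum (z : C) : Cmod z <= Rabs (fst z) + Rabs (snd z).
Proof.
  destruct z as [x y]. unfold Cmod. cbn [fst snd].
  rewrite <- (sqrt_Rsqr (Rabs x + Rabs y)).
  - apply sqrt_le_1_alt. unfold Rsqr. rewrite <- (pow2_abs x), <- (pow2_abs y).
    pose proof (Rabs_pos x). pose proof (Rabs_pos y). nra.
  - pose proof (Rabs_pos x). pose proof (Rabs_pos y). lra.
Qed.

Lemma Rabs_fst_Cmod (z : C) : Rabs (fst z) <= Cmod z.
Proof. eapply Rle_trans; [apply Rmax_l|apply Rmax_Cmod]. Qed.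

Lemma Rabs_snd_Cmod (z : C) : Rabs (snd z) <= Cmod z.
Proof. eapply Rle_trans; [apply Rmax_r|apply Rmax_Cmod]. Qed.

Lemma Cmod_minus_le (z w : C) : Cmod z <= Cmod w + Cmod (z - w)%C.
Proof. replace z with (w + (z - w))%C at 1 by ring. apply Cmod_triangle. Qed.

Lemma Cmod_minus_sym (z w : C) : Cmod (z - w)%C = Cmod (w - z)%C.
Proof. rewrite <- Cmod_opp. f_equal. ring. Qed.

Lemma Cmod_small (z : C) : (forall e, 0 < e -> Cmod z <= e) -> z = 0%C.
Proof.
  intros H. apply Cmod_eq_0. apply Rle_antisym; [|apply Cmod_ge_0].
  apply le_epsilon. intros e He. rewrite Rplus_0_l. auto.
Qed.

Lemma Cmod_cis t : Cmod (cis t) = 1.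
Proof.
  unfold Cmod, cis; cbn [fst snd]. rewrite <- sqrt_1. f_equal.
  pose proof (sin2_cos2 t). unfold Rsqr in *. lra.
Qed.

Lemma cis_0 : cis 0 = 1%C.
Proof. unfold cis. now rewrite cos_0, sin_0. Qed.

Lemma C_filterlim {T} (F : (T -> Prop) -> Prop) {FF : Filter F} (f : T -> C) (l : C) :
  filterlim f F (locally l) <-> forall e, 0 < e -> F (fun t => Cmod (f t - l)%C < e).
Proof.
  split.
  - intros H e He.
    assert (He2 : 0 < e / 2) by lra.
    specialize (H (fun y => Cmod (y - l)%C < e)). apply H.
    exists (mkposreal _ He2). intros y [H1 H2].
    eapply Rle_lt_trans; [apply Cmod_le_sum|].
    change (Rabs (fst y - fst l) < e / 2) in H1. change (Rabs (snd y - snd l) < e / 2) in H2.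
    change (Rabs (fst y - fst l) + Rabs (snd y - snd l) < e). lra.
  - intros H P [d Hd]. unfold filtermap. generalize (H d (cond_pos d)). apply filter_imp.
    intros t Ht. apply Hd. split.
    + change (Rabs (fst (f t - l)%C) < d). eapply Rle_lt_trans; [apply Rabs_fst_Cmod|exact Ht].
    + change (Rabs (snd (f t - l)%C) < d). eapply Rle_lt_trans; [apply Rabs_snd_Cmod|exact Ht].
Qed.

Lemma C_continuous {T : UniformSpace} (f : T -> C) (t : T) :
  continuous f t <-> forall e, 0 < e -> locally t (fun s => Cmod (f s - f t)%C < e).
Proof. apply C_filterlim. apply _. Qed.

Section Continuity.
Context {T : UniformSpace}.
Implicit Types (f g : T -> C) (t : T).

Lemma continuous_fst_C f t : continuous f t -> continuous (fun s => fst (f s)) t.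
Proof. intros H. apply (continuous_comp f fst); [exact H|]. destruct (f t). apply continuous_fst. Qed.

Lemma continuous_snd_C f t : continuous f t -> continuous (fun s => snd (f s)) t.
Proof. intros H. apply (continuous_comp f snd); [exact H|]. destruct (f t). apply continuous_snd. Qed.

Lemma continuous_pair {U V : UniformSpace} (f : T -> U) (g : T -> V) t :
  continuous f t -> continuous g t -> continuous (fun s => (f s, g s)) t.
Proof.
  intros Hf Hg P [d Hd].
  pose proof (Hf _ (locally_ball (f t) d)) as H1. pose proof (Hg _ (locally_ball (g t) d)) as H2.
  unfold filtermap in *. generalize (filter_and _ _ H1 H2). clear H1 H2.
  apply filter_imp. intros s [H1 H2]. apply Hd. now split.
Qed.

Lemma continuous_C f t :
  continuous (fun s => fst (f s)) t -> continuous (fun s => snd (f s)) t -> continuous f t.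
Proof.
  intros H1 H2. apply (continuous_ext (fun s => (fst (f s), snd (f s)) : C)).
  - intros s. now destruct (f s).
  - now apply (continuous_pair (fun s => fst (f s)) (fun s => snd (f s))).
Qed.

Lemma continuous_Cplus f g t :
  continuous f t -> continuous g t -> continuous (fun s => (f s + g s)%C) t.
Proof. intros Hf Hg. now apply (continuous_plus (V := C_R_NormedModule) f g). Qed.

Lemma continuous_Cminus f g t :
  continuous f t -> continuous g t -> continuous (fun s => (f s - g s)%C) t.
Proof. intros Hf Hg. now apply (continuous_minus (V := C_R_NormedModule) f g). Qed.

Lemma continuous_Cmult f g t :
  continuous f t -> continuous g t -> continuous (fun s => (f s * g s)%C) t.
Proof.
  intros Hf Hg. apply continuous_C; cbn [fst snd Cmult].
  - apply (continuous_minus (V := R_NormedModule)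
      (fun s => fst (f s) * fst (g s)) (fun s => snd (f s) * snd (g s)));
    apply (continuous_mult (K := R_AbsRing));
    auto using continuous_fst_C, continuous_snd_C.
  - apply (continuous_plus (V := R_NormedModule)
      (fun s => fst (f s) * snd (g s)) (fun s => snd (f s) * fst (g s)));
    apply (continuous_mult (K := R_AbsRing));
    auto using continuous_fst_C, continuous_snd_C.
Qed.

Lemma continuous_RtoC (f : T -> R) t : continuous f t -> continuous (fun s => RtoC (f s)) t.
Proof.
  intros H. apply continuous_C; cbn [fst snd RtoC]; [exact H|apply continuous_const].
Qed.

Lemma continuous_cis (f : T -> R) t : continuous f t -> continuous (fun s => cis (f s)) t.
Proof.
  intros H. apply continuous_C; cbn [fst snd cis].
  - apply (continuous_comp f cos); [exact H|apply continuous_cos].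
  - apply (continuous_comp f sin); [exact H|apply continuous_sin].
Qed.

Lemma continuous_Rplus (f g : T -> R) t :
  continuous f t -> continuous g t -> continuous (fun s => f s + g s) t.
Proof. intros Hf Hg. now apply (continuous_plus (V := R_NormedModule) f g). Qed.

Lemma continuous_Rminus (f g : T -> R) t :
  continuous f t -> continuous g t -> continuous (fun s => f s - g s) t.
Proof. intros Hf Hg. now apply (continuous_minus (V := R_NormedModule) f g). Qed.

Lemma continuous_Ropp (f : T -> R) t :
  continuous f t -> continuous (fun s => - f s) t.
Proof. intros Hf. now apply (continuous_opp (V := R_NormedModule) f). Qed.

Lemma continuous_Rmult (f g : T -> R) t :
  continuous f t -> continuous g t -> continuous (fun s => f s * g s) t.
Proof. intros Hf Hg. now apply (continuous_mult (K := R_AbsRing) f g). Qed.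

Lemma continuous_fst_comp {U V : UniformSpace} (f : T -> U * V) t :
  continuous f t -> continuous (fun s => fst (f s)) t.
Proof. intros H. apply (continuous_comp f fst); [exact H|]. destruct (f t). apply continuous_fst. Qed.

Lemma continuous_snd_comp {U V : UniformSpace} (f : T -> U * V) t :
  continuous f t -> continuous (fun s => snd (f s)) t.
Proof. intros H. apply (continuous_comp f snd); [exact H|]. destruct (f t). apply continuous_snd. Qed.
End Continuity.

Ltac cts1 := first
  [ assumption
  | lazymatch goal with
    | |- continuous (fun _ => ?c) _ => apply continuous_const
    | |- continuous (fun x => x) _ => apply continuous_id
    | |- continuous (fun _ => Cplus _ _) _ => apply continuous_Cplus
    | |- continuous (fun _ => Cminus _ _) _ => apply continuous_Cminus
    | |- continuous (fun _ => Cmult _ _) _ => apply continuous_Cmult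
    | |- continuous (fun _ => cis _) _ => apply continuous_cis
    | |- continuous (fun _ => RtoC _) _ => apply continuous_RtoC
    | |- continuous (fun _ => Rplus _ _) _ => apply continuous_Rplus
    | |- continuous (fun _ => Rminus _ _) _ => apply continuous_Rminus
    | |- continuous (fun _ => Rmult _ _) _ => apply continuous_Rmult
    | |- continuous (fun _ => Ropp _) _ => apply continuous_Ropp
    | |- continuous (fun _ => pair _ _) _ => apply continuous_pair
    | |- continuous (Rmult ?a) _ => apply (continuous_Rmult (fun _ => a) (fun x => x))
    | |- continuous (Rplus ?a) _ => apply (continuous_Rplus (fun _ => a) (fun x => x))
    | |- continuous Ropp _ => apply (continuous_Ropp (fun x => x))
    | |- continuous cis _ => apply (continuous_cis (fun x => x))
    | |- continuous RtoC _ => apply (continuous_RtoC (fun x => x))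
    | |- continuous fst _ => apply (continuous_fst_comp (fun x => x)), continuous_id
    | |- continuous snd _ => apply (continuous_snd_comp (fun x => x)), continuous_id
    | |- continuous (fun _ => fst _) _ => apply continuous_fst_comp
    | |- continuous (fun _ => snd _) _ => apply continuous_snd_comp
    end ].
Ltac cts := repeat cts1.

(** Compactness of [a, b] yields one radius d that fits inside a good neighbourhood around every
    point of the fibre over [t0]. All uniformity in this development, in a variable of integration
    or in a point of the torus, comes from this lemma. *)
Lemma tube {T : UniformSpace} (a b : R) (Q : T -> R -> Prop) (t0 : T) :
  (forall w, a <= w <= b -> locally (t0, w) (fun p => Q (fst p) (snd p))) ->
  locally t0 (fun t => forall w, a <= w <= b -> Q t w).
Proof.
  intros H.
  (* A radius is needed at every real number; outside [a, b] the value 1 is a dummy. *)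
  assert (H' : forall w, exists d : posreal, a <= w <= b ->
     forall p, ball (t0, w) d p -> Q (fst p) (snd p)).
  { intros w. destruct (excluded_middle_informative (a <= w <= b)) as [Hw|Hw].
    - destruct (H w Hw) as [d Hd]. exists d. auto.
    - exists (mkposreal 1 Rlt_0_1). tauto. }
  destruct (compactness_value_1d a b
    (fun w => proj1_sig (constructive_indefinite_description _ (H' w)))) as [d Hd].
  (* [compactness_value_1d] provides the centre of the covering interval only under a double
     negation. *)
  exists d. intros t Ht w Hw. apply NNPP. intros N. apply (Hd w Hw).
  intros [s [Hs [H1 H2]]]. apply N.
  destruct (constructive_indefinite_description _ (H' s)) as [e He]. cbn in H1, H2.
  apply (He Hs (t, w)). split.
  - now apply ball_le with d.
  - exact H1.
Qed.

(** * Derivatives of curves in the complex plane *)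

Definition cder (f : R -> C) (t : R) (l : C) : Prop :=
  is_derive (fun s => fst (f s)) t (fst l) /\ is_derive (fun s => snd (f s)) t (snd l).

Lemma cder_ext f g t l : (forall s, f s = g s) -> cder f t l -> cder g t l.
Proof. intros H. replace g with f; auto. now apply functional_extensionality. Qed.

Lemma cder_const c t : cder (fun _ => c) t 0%C.
Proof. split; apply (is_derive_const (V := R_NormedModule)). Qed.

Lemma cder_plus f g t l m : cder f t l -> cder g t m -> cder (fun s => (f s + g s)%C) t (l + m)%C.
Proof. intros [H1 H2] [H3 H4]. split; now apply (is_derive_plus (V := R_NormedModule)). Qed.

Lemma cder_minus f g t l m : cder f t l -> cder g t m -> cder (fun s => (f s - g s)%C) t (l - m)%C.
Proof. intros [H1 H2] [H3 H4]. split; now apply (is_derive_minus (V := R_NormedModule)). Qed.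

Lemma cder_mult f g t l m : cder f t l -> cder g t m ->
  cder (fun s => (f s * g s)%C) t (l * g t + f t * m)%C.
Proof.
  intros [H1 H2] [H3 H4]. split; cbn [fst snd Cmult Cplus].
  - replace (fst l * fst (g t) - snd l * snd (g t) + (fst (f t) * fst m - snd (f t) * snd m))
      with ((fst l * fst (g t) + fst (f t) * fst m) - (snd l * snd (g t) + snd (f t) * snd m)) by ring.
    apply (is_derive_minus (V := R_NormedModule));
    apply (is_derive_mult (K := R_AbsRing)); auto; intros; apply Rmult_comm.
  - replace (fst l * snd (g t) + snd l * fst (g t) + (fst (f t) * snd m + snd (f t) * fst m))
      with ((fst l * snd (g t) + fst (f t) * snd m) + (snd l * fst (g t) + snd (f t) * fst m)) by ring.
    apply (is_derive_plus (V := R_NormedModule));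
    apply (is_derive_mult (K := R_AbsRing)); auto; intros; apply Rmult_comm.
Qed.

Lemma cder_scal c f t l : cder f t l -> cder (fun s => (c * f s)%C) t (c * l)%C.
Proof.
  intros H. replace (c * l)%C with (0 * f t + c * l)%C by ring.
  apply (cder_mult (fun _ => c)); [apply cder_const|exact H].
Qed.

Lemma cder_cis a b t : cder (fun s => cis (a * s + b)) t (Ci * RtoC a * cis (a * t + b))%C.
Proof.
  split; unfold cis, Ci, RtoC, Cmult; cbn [fst snd]; auto_derive; auto; ring.
Qed.

Lemma cder_comp_affine f a b t l : cder f (a * t + b) l -> cder (fun s => f (a * s + b)) t (a * l)%C.
Proof.
  intros [H1 H2]. 
  assert (Ha : is_derive (fun s => a * s + b) t a) by (auto_derive; auto; ring).
  split; cbn [fst snd Cmult RtoC].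
  - rewrite Rmult_0_l, Rminus_0_r.
    exact (is_derive_comp (fun s => fst (f s)) (fun s => a * s + b) t _ _ H1 Ha).
  - rewrite Rmult_0_l, Rplus_0_r.
    exact (is_derive_comp (fun s => snd (f s)) (fun s => a * s + b) t _ _ H2 Ha).
Qed.

Lemma mvt_bound (f df : R -> R) (x y K : R) :
  (forall z, Rmin x y <= z <= Rmax x y -> is_derive f z (df z)) ->
  (forall z, Rmin x y <= z <= Rmax x y -> Rabs (df z) <= K) ->
  Rabs (f y - f x) <= K * Rabs (y - x).
Proof.
  intros Hd HK.
  destruct (MVT_gen f x y df) as [z [Hz E]].
  - intros z Hz. apply Hd. lra.
  - intros z Hz. apply continuity_pt_filterlim.
    apply (ex_derive_continuous (V := R_NormedModule) f). eexists; now apply Hd.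
  - rewrite E, Rabs_mult. apply Rmult_le_compat_r; [apply Rabs_pos|auto].
Qed.

(** The mean value theorem has no complex form with a single intermediate point; it is applied to
    the real and the imaginary part separately, which costs the factor 2. *)
Lemma cder_mvt (f df : R -> C) (x y K : R) :
  (forall z, Rmin x y <= z <= Rmax x y -> cder f z (df z)) ->
  (forall z, Rmin x y <= z <= Rmax x y -> Cmod (df z) <= K) ->
  Cmod (f y - f x)%C <= 2 * K * Rabs (y - x).
Proof.
  intros Hd HK. eapply Rle_trans; [apply Cmod_le_sum|].
  replace (2 * K * Rabs (y - x)) with (K * Rabs (y - x) + K * Rabs (y - x)) by ring.
  apply Rplus_le_compat.
  - apply (mvt_bound (fun s => fst (f s)) (fun s => fst (df s))).
    + intros z Hz. now apply Hd.
    + intros z Hz. eapply Rle_trans; [apply Rabs_fst_Cmod|auto].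
  - apply (mvt_bound (fun s => snd (f s)) (fun s => snd (df s))).
    + intros z Hz. now apply Hd.
    + intros z Hz. eapply Rle_trans; [apply Rabs_snd_Cmod|auto].
Qed.

Lemma derive_of_quadratic (F : R -> R) (u l K : R) :
  (forall h, Rabs (F (u + h) - F u - h * l) <= K * h ^ 2) -> is_derive F u l.
Proof.
  intros H. apply is_derive_Reals. intros e He.
  assert (HK : 0 <= K).
  { specialize (H 1). pose proof (Rabs_pos (F (u + 1) - F u - 1 * l)). lra. }
  assert (Hd : 0 < e / (K + 1)) by (apply Rdiv_lt_0_compat; lra).
  exists (mkposreal _ Hd). cbn [pos]. intros h Hh Hlt.
  replace ((F (u + h) - F u) / h - l) with ((F (u + h) - F u - h * l) / h) by (field; auto).
  unfold Rdiv. rewrite Rabs_mult, Rabs_inv.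
  assert (Hp : 0 < Rabs h) by now apply Rabs_pos_lt.
  apply (Rmult_lt_reg_r (Rabs h)); [exact Hp|].
  rewrite Rmult_assoc, Rinv_l, Rmult_1_r by lra.
  eapply Rle_lt_trans; [apply H|]. rewrite <- pow2_abs.
  apply Rle_lt_trans with (K * (e / (K + 1)) * Rabs h).
  - replace (K * Rabs h ^ 2) with (K * Rabs h * Rabs h) by ring.
    apply Rmult_le_compat_r; [lra|]. apply Rmult_le_compat_l; lra.
  - apply Rmult_lt_compat_r; [exact Hp|].
    apply (Rmult_lt_reg_r (K + 1)); [lra|]. 
    replace (K * (e / (K + 1)) * (K + 1)) with (K * e) by (field; lra). nra.
Qed.

Lemma cder_of_quadratic (F : R -> C) (u : R) (l : C) (K : R) :
  (forall h : R, Cmod (F (u + h)%R - F u - h * l)%C <= K * h ^ 2) -> cder F u l.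
Proof.
  intros H. split.
  - apply derive_of_quadratic with K. intros h. eapply Rle_trans; [|apply H].
    eapply Rle_trans; [|apply Rabs_fst_Cmod]. right. f_equal. simpl. ring.
  - apply derive_of_quadratic with K. intros h. eapply Rle_trans; [|apply H].
    eapply Rle_trans; [|apply Rabs_snd_Cmod]. right. f_equal. simpl. ring.
Qed.

(** The auxiliary curve [g] has derivative [f1 t - f1 u], of size at most 2 K |h| by [cder_mvt];
    applying [cder_mvt] once more to [g] gives the constant 4. An explicit quadratic remainder can
    be integrated in a parameter, which is how differentiation under the integral is obtained. *)
Lemma cder_taylor (f f1 f2 : R -> C) (u h K : R) :
  (forall t, cder f t (f1 t)) -> (forall t, cder f1 t (f2 t)) ->
  (forall t, Cmod (f2 t) <= K) ->
  Cmod (f (u + h)%R - f u - h * f1 u)%C <= 4 * K * h ^ 2.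
Proof.
  intros H1 H2 HK.
  assert (K0 : 0 <= K) by (eapply Rle_trans; [apply Cmod_ge_0|apply (HK 0)]).
  set (g := fun t => (f t - (t - u)%R * f1 u)%C).
  assert (Hg : forall t, cder g t (f1 t - f1 u)%C).
  { intros t. apply cder_minus; [apply H1|].
    pose proof (cder_mult (fun s => RtoC (s - u)) (fun _ => f1 u) t 1%C 0%C) as M.
    cbv beta in M. replace (1 * f1 u + (t - u)%R * 0)%C with (f1 u) in M by ring. apply M.
    - split; cbn [fst snd RtoC]; auto_derive; auto; ring.
    - apply cder_const. }
  assert (Hb : forall z, Rmin u (u + h) <= z <= Rmax u (u + h) ->
     Cmod (f1 z - f1 u)%C <= 2 * K * Rabs h).
  { intros z Hz. eapply Rle_trans.
    - apply (cder_mvt f1 f2 u z K); auto.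
    - apply Rmult_le_compat_l; [lra|].
      revert Hz. unfold Rmin, Rmax. destruct (Rle_dec u (u + h)); intros Hz;
      unfold Rabs; repeat destruct Rcase_abs; lra. }
  pose proof (cder_mvt g _ u (u + h) _ (fun z _ => Hg z) Hb) as M.
  replace (f (u + h)%R - f u - h * f1 u)%C with (g (u + h)%R - g u)%C.
  - eapply Rle_trans; [exact M|]. replace (u + h - u) with h by ring.
    rewrite <- (pow2_abs h). right. ring.
  - unfold g. replace (u + h - u) with h by ring. replace (u - u) with 0 by ring. ring.
Qed.

(** * An abstract integral: iterated integrals, integration by parts, decay of Fourier transforms *)

Definition dominated (wt : R -> R) (K : R) (f : R -> C) : Prop :=
  (forall t, continuous f t) /\ forall t, Cmod (f t) <= K * wt t.

Definition dominated2 (wt : R -> R) (K : R) (f : R -> R -> C) : Prop :=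
  (forall p : R2, continuous (fun p : R2 => f (fst p) (snd p)) p) /\
  forall u w, Cmod (f u w) <= K * wt u * wt w.

(** What the integrals over R and over a period have in common: a linear functional
    on the continuous functions dominated by a weight, bounded and continuous in
    parameters, that kills the derivatives of functions satisfying [bdry]. *)
Record integral : Type := {
  II :> (R -> C) -> C;
  wt : R -> R;
  mass : R;
  bdry : (R -> C) -> Prop;
  wt_pos : forall u, 0 < wt u;
  wt_le1 : forall u, wt u <= 1;
  mass_pos : 0 <= mass;
  II_plus : forall f g K L, dominated wt K f -> dominated wt L g ->
    II (fun t => (f t + g t)%C) = (II f + II g)%C;
  II_scal : forall f K c, dominated wt K f -> II (fun t => (c * f t)%C) = (c * II f)%C;
  II_bound : forall f K, dominated wt K f -> Cmod (II f) <= mass * K;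
  II_param : forall (T : UniformSpace) (f : T -> R -> C) K t0,
    (forall t, dominated wt K (f t)) ->
    (forall w, continuous (fun p : T * R => f (fst p) (snd p)) (t0, w)) ->
    continuous (fun t => II (f t)) t0;
  II_exact : forall H H' K L, dominated wt K H -> dominated wt L H' ->
    (forall t, cder H t (H' t)) -> bdry H -> II H' = 0%C
}.

Section Integral.
Variable J : integral.
Local Notation dom := (dominated (wt J)).
Local Notation dom2 := (dominated2 (wt J)).

Lemma dom_pos K f : dom K f -> 0 <= K.
Proof.
  intros [_ H]. specialize (H 0). pose proof (Cmod_ge_0 (f 0)). pose proof (wt_pos J 0).
  destruct (Rle_or_lt 0 K); auto. nra.
Qed.

Lemma dom_plus K L f g : dom K f -> dom L g -> dom (K + L) (fun t => (f t + g t)%C).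
Proof.
  intros [H1 H2] [H3 H4]. split.
  - intros t. now apply continuous_Cplus.
  - intros t. eapply Rle_trans; [apply Cmod_triangle|]. specialize (H2 t). specialize (H4 t). lra.
Qed.

Lemma dom_scal K c f : dom K f -> dom (Cmod c * K) (fun t => (c * f t)%C).
Proof.
  intros [H1 H2]. split.
  - intros t. apply continuous_Cmult; auto. apply continuous_const.
  - intros t. rewrite Cmod_mult. specialize (H2 t). rewrite Rmult_assoc.
    apply Rmult_le_compat_l; auto using Cmod_ge_0.
Qed.

Lemma dom_le K L f : K <= L -> dom K f -> dom L f.
Proof.
  intros H [H1 H2]. split; auto. intros t. specialize (H2 t). pose proof (wt_pos J t). nra.
Qed.

Lemma dom_mult K f g : dom K f -> (forall t, continuous g t) -> (forall t, Cmod (g t) <= 1) ->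
  dom K (fun t => (f t * g t)%C).
Proof.
  intros [H1 H2] H3 H4. split.
  - intros t. now apply continuous_Cmult.
  - intros t. rewrite Cmod_mult. specialize (H2 t). specialize (H4 t).
    pose proof (Cmod_ge_0 (f t)). pose proof (Cmod_ge_0 (g t)). nra.
Qed.

Lemma II_minus f g K L : dom K f -> dom L g ->
  J (fun t => (f t - g t)%C) = (J f - J g)%C.
Proof.
  intros Hf Hg.
  transitivity (J (fun t => (f t + (-1) * g t)%C)).
  { f_equal. extensionality t. ring. }
  rewrite (II_plus J f _ K (Cmod (-1)%C * L)); auto using dom_scal.
  rewrite (II_scal J g L); auto. ring.
Qed.

(** Differentiation under the integral: the Taylor remainder is dominated. *)
Lemma II_derive (f f1 f2 : R -> R -> C) K0 K1 K2 :
  (forall u, dom K0 (f u)) -> (forall u, dom K1 (f1 u)) ->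
  (forall u w, Cmod (f2 u w) <= K2 * wt J w) ->
  (forall u w, cder (fun u => f u w) u (f1 u w)) ->
  (forall u w, cder (fun u => f1 u w) u (f2 u w)) ->
  forall u, cder (fun u => J (f u)) u (J (f1 u)).
Proof.
  intros D0 D1 B2 H1 H2 u.
  apply cder_of_quadratic with (mass J * (4 * K2)). intros h.
  assert (E : (J (f (u + h)%R) - J (f u) - h * J (f1 u))%C =
     J (fun w => (f (u + h)%R w - f u w - h * f1 u w)%C)).
  { rewrite <- (II_scal J (f1 u) K1 h) by auto.
    rewrite <- (II_minus (f (u + h)) (f u) K0 K0) by auto.
    symmetry. apply II_minus with (K0 + Cmod (-1)%C * K0) (Cmod (RtoC h) * K1).
    - replace (fun w => (f (u + h)%R w - f u w)%C) with (fun w => (f (u + h)%R w + (-1) * f u w)%C)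
        by (apply functional_extensionality; intros; ring).
      apply dom_plus; auto using dom_scal.
    - auto using dom_scal. }
  rewrite E. eapply Rle_trans.
  - apply II_bound with (K := 4 * K2 * h ^ 2). split.
    + intros t. apply continuous_Cminus; [apply continuous_Cminus|apply continuous_Cmult].
      * apply D0. * apply D0. * apply continuous_const. * apply D1.
    + intros w. replace (4 * K2 * h ^ 2 * wt J w) with (4 * (K2 * wt J w) * h ^ 2) by ring.
      apply (cder_taylor (fun u => f u w) (fun u => f1 u w) (fun u => f2 u w)); auto.
  - right. ring.
Qed.

(** The derivative of [G t * cis (- (t * eta))] is the sum of the two integrands, with factor -i eta
    on the second, and [II_exact] kills it. *)
Lemma II_ibp (G G1 : R -> C) K K1 eta : dom K G -> dom K1 G1 ->
  (forall t, cder G t (G1 t)) -> bdry J (fun t => (G t * cis (- (t * eta)))%C) ->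
  J (fun t => (G1 t * cis (- (t * eta)))%C) =
  (Ci * RtoC eta * J (fun t => (G t * cis (- (t * eta)))%C))%C.
Proof.
  intros D D1 H Hb.
  assert (Hc : forall t, continuous (fun t => cis (- (t * eta))) t) by (intros t; cts).
  assert (Hm : forall t, Cmod (cis (- (t * eta))) <= 1) by (intros t; rewrite Cmod_cis; lra).
  pose proof (dom_mult _ _ _ D Hc Hm) as De. pose proof (dom_mult _ _ _ D1 Hc Hm) as De1.
  pose proof (dom_scal _ (- (Ci * RtoC eta))%C _ De) as Ds.
  assert (E : J (fun t => (G1 t * cis (- (t * eta)) + - (Ci * RtoC eta) * (G t * cis (- (t * eta))))%C) = 0%C).
  { apply (II_exact J (fun t => (G t * cis (- (t * eta)))%C)) with (1 := De) (2 := dom_plus _ _ _ _ De1 Ds); auto.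
    intros t. replace (- (Ci * RtoC eta) * (G t * cis (- (t * eta))))%C
      with (G t * (Ci * RtoC (- eta)%R * cis (- (t * eta))))%C by (rewrite RtoC_opp; ring).
    apply (cder_mult G (fun t => cis (- (t * eta)))); [apply H|].
    pose proof (cder_cis (- eta) 0 t) as M.
    replace (- eta * t + 0) with (- (t * eta)) in M by ring.
    eapply cder_ext; [|exact M]. intros s. cbv beta. f_equal. ring. }
  rewrite (II_plus J _ _ _ _ De1 Ds), (II_scal J _ _ _ De) in E.
  rewrite <- (Cplus_0_l (Ci * _ * _)%C), <- E. ring.
Qed.

(** Each integration by parts produces i eta, and 1 - (i eta)^2 = 1 + eta^2. Working with [G - G2]
    rather than with [G2] alone gives a factor that never vanishes, so no case distinction at eta =
    0 arises when dividing. *)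
Lemma II_ibp2 (G G1 G2 : R -> C) K K1 K2 eta : dom K G -> dom K1 G1 -> dom K2 G2 ->
  (forall t, cder G t (G1 t)) -> (forall t, cder G1 t (G2 t)) ->
  bdry J (fun t => (G t * cis (- (t * eta)))%C) ->
  bdry J (fun t => (G1 t * cis (- (t * eta)))%C) ->
  J (fun t => ((G t - G2 t) * cis (- (t * eta)))%C) =
  (RtoC (1 + eta ^ 2)%R * J (fun t => (G t * cis (- (t * eta)))%C))%C.
Proof.
  intros D D1 D2 H1 H2 B B1.
  assert (Hc : forall t, continuous (fun t => cis (- (t * eta))) t) by (intros t; cts).
  assert (Hm : forall t, Cmod (cis (- (t * eta))) <= 1) by (intros t; rewrite Cmod_cis; lra).
  pose proof (dom_mult _ _ _ D Hc Hm) as De. pose proof (dom_mult _ _ _ D2 Hc Hm) as De2.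
  transitivity (J (fun t => (G t * cis (- (t * eta)) - G2 t * cis (- (t * eta)))%C)).
  { f_equal. extensionality t. ring. }
  rewrite (II_minus _ _ _ _ De De2).
  rewrite (II_ibp G1 G2 K1 K2 eta), (II_ibp G G1 K K1 eta); auto.
  rewrite RtoC_plus, RtoC_pow. set (X := J _).
  assert (Ci2 : (Ci * Ci)%C = (-1)%C) by (unfold Ci, Cmult, RtoC; simpl; f_equal; ring).
  replace (Ci * eta * (Ci * eta * X))%C with ((Ci * Ci) * (eta * eta * X))%C by ring.
  rewrite Ci2. simpl. ring.
Qed.

Lemma dom2_inner K f u : dom2 K f -> dom (K * wt J u) (f u).
Proof.
  intros [H1 H2]. split; auto. intros t.
  apply (continuous_comp (fun t => (u, t)) (fun p : R2 => f (fst p) (snd p))); [|apply H1].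
  cts.
Qed.

Lemma dom2_pos K f : dom2 K f -> 0 <= K.
Proof.
  intros H. pose proof (dom_pos _ _ (dom2_inner K f 0 H)). pose proof (wt_pos J 0). nra.
Qed.

Lemma dom2_inner1 K f u : dom2 K f -> dom K (f u).
Proof.
  intros H. apply dom_le with (K * wt J u); [|now apply dom2_inner].
  pose proof (dom2_pos _ _ H). pose proof (wt_le1 J u). nra.
Qed.

(** The weight on the plane is a product: integrating in one variable leaves the weight in the
    other, so the inner integral is again an admissible integrand. Its continuity is [II_param]. *)
Lemma dom2_outer K f : dom2 K f -> dom (mass J * K) (fun u => J (f u)).
Proof.
  intros H. split.
  - intros t. apply (II_param J R_UniformSpace f K t).
    + intros s. now apply dom2_inner1.
    + intros w. apply H.
  - intros t. rewrite Rmult_assoc. apply II_bound. now apply dom2_inner.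
Qed.

Definition II2 (f : R -> R -> C) : C := J (fun u => J (f u)).

Lemma II2_bound K f : dom2 K f -> Cmod (II2 f) <= mass J * mass J * K.
Proof. intros H. rewrite Rmult_assoc. apply II_bound. now apply dom2_outer. Qed.

Lemma dom2_scal K c f : dom2 K f -> dom2 (Cmod c * K) (fun u w => (c * f u w)%C).
Proof.
  intros [H1 H2]. split.
  - intros t. apply (continuous_Cmult (fun _ => c) (fun p : R2 => f (fst p) (snd p))); auto.
    apply continuous_const.
  - intros u w. rewrite Cmod_mult. specialize (H2 u w).
    replace (Cmod c * K * wt J u * wt J w) with (Cmod c * (K * wt J u * wt J w)) by ring.
    apply Rmult_le_compat_l; auto using Cmod_ge_0.
Qed.

Lemma dom2_mult K f g : dom2 K f -> (forall p : R2, continuous (fun p : R2 => g (fst p) (snd p)) p) ->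
  (forall u w, Cmod (g u w) <= 1) -> dom2 K (fun u w => (f u w * g u w)%C).
Proof.
  intros [H1 H2] H3 H4. split.
  - intros t. now apply (continuous_Cmult (fun p : R2 => f (fst p) (snd p)) (fun p : R2 => g (fst p) (snd p))).
  - intros u w. rewrite Cmod_mult. specialize (H2 u w). specialize (H4 u w).
    pose proof (Cmod_ge_0 (f u w)). pose proof (Cmod_ge_0 (g u w)). nra.
Qed.

Lemma II2_plus K L f g : dom2 K f -> dom2 L g ->
  II2 (fun u w => (f u w + g u w)%C) = (II2 f + II2 g)%C.
Proof.
  intros Hf Hg. unfold II2. rewrite <- (II_plus J _ _ _ _ (dom2_outer _ _ Hf) (dom2_outer _ _ Hg)).
  f_equal. extensionality u.
  apply (II_plus J (f u) (g u) K L); now apply dom2_inner1.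
Qed.

Lemma II2_scal K c f : dom2 K f -> II2 (fun u w => (c * f u w)%C) = (c * II2 f)%C.
Proof.
  intros Hf. unfold II2. rewrite <- (II_scal J _ _ _ (dom2_outer _ _ Hf)).
  f_equal. extensionality u.
  apply (II_scal J (f u) K); now apply dom2_inner1.
Qed.

Lemma II2_param (T : UniformSpace) (f : T -> R -> R -> C) K t0 :
  (forall t, dom2 K (f t)) ->
  (forall p : T * R * R, continuous (fun p : T * R * R => f (fst (fst p)) (snd (fst p)) (snd p)) p) ->
  continuous (fun t => II2 (f t)) t0.
Proof.
  intros H Hc. apply (II_param J T (fun t u => J (f t u)) (mass J * K)).
  - intros t. now apply dom2_outer.
  - intros w.
    apply (II_param J (prod_UniformSpace T R_UniformSpace) (fun p w => f (fst p) (snd p) w) K).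
    + intros [t u]. now apply dom2_inner1.
    + intros w'. apply Hc.
Qed.

Definition FT (f : R -> R -> C) (a b : R) : C :=
  J (fun u => (J (fun w => (f u w * cis (- (w * b)))%C) * cis (- (u * a)))%C).

Lemma FT_II2 K f a b : dom2 K f -> FT f a b = II2 (fun u w => (f u w * cis (- (u * a + w * b)))%C).
Proof.
  intros H. unfold FT, II2. f_equal. extensionality u.
  rewrite Cmult_comm.
  rewrite <- (II_scal J (fun w => (f u w * cis (- (w * b)))%C) K (cis (- (u * a)))).
  - f_equal. extensionality w.
    replace (- (u * a + w * b)) with (- (u * a) + - (w * b)) by ring. rewrite cis_plus. ring.
  - apply dom_mult; [now apply dom2_inner1| |].
    + intros t. cts.
    + intros t. rewrite Cmod_cis. lra.
Qed.

(** [S] is a class of families of functions of two variables, indexed by [Z] and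
    closed under the partial derivatives [d1], [d2]; two integrations by parts gain a
    factor [1 + a ^ 2] in the Fourier transform, uniformly in the index. *)
Section Decay.
Context {Z : Type}.
Variable S : (Z -> R -> R -> C) -> Prop.
Variables d1 d2 : (Z -> R -> R -> C) -> (Z -> R -> R -> C).
Variable adm : R -> Prop.
Hypothesis S_dom : forall f, S f -> exists K, forall z, dom2 K (f z).
Hypothesis S_minus : forall f g, S f -> S g -> S (fun z u w => (f z u w - g z u w)%C).
Hypothesis S_d1 : forall f, S f -> S (d1 f).
Hypothesis S_d2 : forall f, S f -> S (d2 f).
Hypothesis d1_cder : forall f, S f -> forall z u w, cder (fun u => f z u w) u (d1 f z u w).
Hypothesis d2_cder : forall f, S f -> forall z u w, cder (fun w => f z u w) w (d2 f z u w).
Hypothesis S_bdry1 : forall f, S f -> forall z a b, adm a ->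
  bdry J (fun u => (J (fun w => (f z u w * cis (- (w * b)))%C) * cis (- (u * a)))%C).
Hypothesis S_bdry2 : forall f, S f -> forall z u b, adm b ->
  bdry J (fun w => (f z u w * cis (- (w * b)))%C).

(** Here the variable of the integration by parts is the outer one, so the inner integral must first
    be differentiated twice under the integral sign. *)
Lemma FT_d1 f z a b : S f -> adm a ->
  FT (fun u w => (f z u w - d1 (d1 f) z u w)%C) a b = (RtoC (1 + a ^ 2)%R * FT (f z) a b)%C.
Proof.
  intros Hf Ha. pose proof (S_d1 _ Hf) as Hf1. pose proof (S_d1 _ Hf1) as Hf2.
  (* A third derivative enters because differentiating the integral of [d1 f] relies on a Taylor
     remainder for [d1 f]. *)
  pose proof (S_d1 _ Hf2) as Hf3.
  destruct (S_dom _ Hf) as [K0 D0], (S_dom _ Hf1) as [K1 D1], (S_dom _ Hf2) as [K2 D2],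
    (S_dom _ Hf3) as [K3 D3].
  set (e := fun w => cis (- (w * b))).
  assert (He : forall t, continuous e t) by (intros t; unfold e; cts).
  assert (He2 : forall p : R2, continuous (fun p : R2 => e (snd p)) p)
    by (intros p; unfold e; cts).
  assert (Hm : forall t, Cmod (e t) <= 1) by (intros t; unfold e; rewrite Cmod_cis; lra).
  assert (M : forall K g, dom2 K g -> dom2 K (fun u w => (g u w * e w)%C)).
  { intros K g Hg. apply (dom2_mult K g (fun _ w => e w)); auto. }
  assert (Hd : forall g Ka Kb Kc, S g -> (forall z, dom2 Ka (g z)) -> (forall z, dom2 Kb (d1 g z)) ->
    (forall z, dom2 Kc (d1 (d1 g) z)) ->
    forall u, cder (fun u => J (fun w => (g z u w * e w)%C)) u (J (fun w => (d1 g z u w * e w)%C))).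
  { intros g Ka Kb Kc Hg Da Db Dc.
    apply (II_derive (fun u w => (g z u w * e w)%C) (fun u w => (d1 g z u w * e w)%C)
      (fun u w => (d1 (d1 g) z u w * e w)%C) Ka Kb Kc).
    - intros u. apply (dom2_inner1 _ _ u (M _ _ (Da z))).
    - intros u. apply (dom2_inner1 _ _ u (M _ _ (Db z))).
    - intros u. apply (dom2_inner1 _ _ u (M _ _ (Dc z))).
    - intros u w. rewrite <- (Cplus_0_r (_ * _)%C). rewrite <- (Cmult_0_r (g z u w)).
      apply (cder_mult (fun u => g z u w) (fun _ => e w)); [now apply d1_cder|apply cder_const].
    - intros u w. rewrite <- (Cplus_0_r (_ * _)%C). rewrite <- (Cmult_0_r (d1 g z u w)).
      apply (cder_mult (fun u => d1 g z u w) (fun _ => e w)); [apply d1_cder; auto|apply cder_const]. }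
  unfold FT.
  refine (eq_trans _ (II_ibp2 (fun u => J (fun w => (f z u w * e w)%C)) (fun u => J (fun w => (d1 f z u w * e w)%C))
    (fun u => J (fun w => (d1 (d1 f) z u w * e w)%C)) _ _ _ a
    (dom2_outer _ _ (M _ _ (D0 z))) (dom2_outer _ _ (M _ _ (D1 z))) (dom2_outer _ _ (M _ _ (D2 z))) _ _ _ _)); auto.
  - f_equal. extensionality u. f_equal.
    rewrite <- (II_minus _ _ _ _ (dom2_inner1 _ _ u (M _ _ (D0 z))) (dom2_inner1 _ _ u (M _ _ (D2 z)))).
    f_equal. extensionality w. unfold e. ring.
  - eauto.
  - eauto.
  - now apply (S_bdry1 f).
  - now apply (S_bdry1 (d1 f)).
Qed.

(** The integration by parts takes place inside, for each fixed u; the factor is then pulled out of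
    the outer integral. *)
Lemma FT_d2 f z a b : S f -> adm b ->
  FT (fun u w => (f z u w - d2 (d2 f) z u w)%C) a b = (RtoC (1 + b ^ 2)%R * FT (f z) a b)%C.
Proof.
  intros Hf Hb. pose proof (S_d2 _ Hf) as Hf1. pose proof (S_d2 _ Hf1) as Hf2.
  destruct (S_dom _ Hf) as [K0 D0], (S_dom _ Hf1) as [K1 D1], (S_dom _ Hf2) as [K2 D2].
  unfold FT.
  assert (D : dom (mass J * K0) (fun u => (J (fun w => (f z u w * cis (- (w * b)))%C) * cis (- (u * a)))%C)).
  { apply dom_mult.
    - apply (dom2_outer K0 (fun u w => (f z u w * cis (- (w * b)))%C)).
      apply (dom2_mult K0 (f z) (fun _ w => cis (- (w * b)))); auto.
      + intros p. cts.
      + intros u w. rewrite Cmod_cis. lra.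
    - intros t. cts.
    - intros t. rewrite Cmod_cis. lra. }
  rewrite <- (II_scal J _ _ _ D). f_equal. extensionality u.
  rewrite Cmult_assoc. f_equal.
  apply (II_ibp2 (f z u) (d2 f z u) (d2 (d2 f) z u) K0 K1 K2); auto using dom2_inner1.
Qed.

(** Induction on the exponents: each new factor is paid for by passing from [f] to [f - d1 (d1 f)]
    or [f - d2 (d2 f)], which is why [S] has to be closed under differences and derivatives. The
    predicate [adm] singles out the frequencies whose boundary terms cancel: the integers on a
    period, all reals on the line. *)
Lemma FT_decay p q : forall f, S f -> exists K, forall z a b, adm a -> adm b ->
  (1 + a ^ 2) ^ p * (1 + b ^ 2) ^ q * Cmod (FT (f z) a b) <= K.
Proof.
  assert (P1 : forall a, 0 <= 1 + a ^ 2) by (intros a; nra).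
  assert (E1 : forall a (c : C), Cmod (RtoC (1 + a ^ 2)%R * c)%C = (1 + a ^ 2) * Cmod c).
  { intros a c. rewrite Cmod_mult, Cmod_R, Rabs_pos_eq; auto. }
  induction p as [|p IH]; [induction q as [|q IH]|].
  - intros f Hf. destruct (S_dom _ Hf) as [K D]. exists (mass J * mass J * K).
    intros z a b _ _. simpl. rewrite !Rmult_1_l. rewrite (FT_II2 K) by auto.
    apply II2_bound. apply dom2_mult; auto.
    + intros t. cts.
    + intros u w. rewrite Cmod_cis. lra.
  - intros f Hf. destruct (IH (fun z u w => (f z u w - d2 (d2 f) z u w)%C)) as [K HK]; auto.
    exists K. intros z a b Ha Hb. specialize (HK z a b Ha Hb). revert HK.
    rewrite FT_d2, E1 by auto. intros HK. eapply Rle_trans; [|exact HK]. right. simpl. ring.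
  - intros f Hf. destruct (IH (fun z u w => (f z u w - d1 (d1 f) z u w)%C)) as [K HK]; auto.
    exists K. intros z a b Ha Hb. specialize (HK z a b Ha Hb). revert HK.
    rewrite FT_d1, E1 by auto. intros HK. eapply Rle_trans; [|exact HK]. right. simpl. ring.
Qed.
End Decay.
End Integral.

(** * Integrals over bounded intervals and over a period *)

Definition CInt (f : R -> C) (a b : R) : C := @RInt C_R_CompleteNormedModule f a b.

Lemma norm_Cmod (z : C) : @norm _ C_R_CompleteNormedModule z = Cmod z.
Proof. symmetry. apply Cmod_norm. Qed.

Lemma CInt_correct f a b : (forall t, continuous f t) ->
  @is_RInt C_R_CompleteNormedModule f a b (CInt f a b).
Proof.
  intros H. apply (RInt_correct (V := C_R_CompleteNormedModule)).
  apply (ex_RInt_continuous (V := C_R_CompleteNormedModule)). intros; apply H.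
Qed.

Lemma CInt_unique f a b l : @is_RInt C_R_CompleteNormedModule f a b l -> CInt f a b = l.
Proof. apply (is_RInt_unique (V := C_R_CompleteNormedModule)). Qed.

Lemma CInt_plus f g a b : (forall t, continuous f t) -> (forall t, continuous g t) ->
  CInt (fun t => (f t + g t)%C) a b = (CInt f a b + CInt g a b)%C.
Proof.
  intros Hf Hg. apply CInt_unique.
  apply (is_RInt_plus (V := C_R_CompleteNormedModule) f g); now apply CInt_correct.
Qed.

Lemma is_RInt_Cscal f a b (c l : C) : @is_RInt C_R_CompleteNormedModule f a b l ->
  @is_RInt C_R_CompleteNormedModule (fun t => (c * f t)%C) a b (c * l)%C.
Proof.
  intros H.
  pose proof (is_RInt_fct_extend_fst (U := R_NormedModule) (V := R_NormedModule) f a b l H) as H1.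
  pose proof (is_RInt_fct_extend_snd (U := R_NormedModule) (V := R_NormedModule) f a b l H) as H2.
  apply (is_RInt_fct_extend_pair (U := R_NormedModule) (V := R_NormedModule)
     (fun t => (c * f t)%C) a b (fst c * fst l - snd c * snd l) (fst c * snd l + snd c * fst l)).
  - apply (is_RInt_minus (V := R_NormedModule) (fun t => fst c * fst (f t)) (fun t => snd c * snd (f t)));
    now apply (is_RInt_scal (V := R_NormedModule)).
  - apply (is_RInt_plus (V := R_NormedModule) (fun t => fst c * snd (f t)) (fun t => snd c * fst (f t)));
    now apply (is_RInt_scal (V := R_NormedModule)).
Qed.

Lemma CInt_scal c f a b : (forall t, continuous f t) ->
  CInt (fun t => (c * f t)%C) a b = (c * CInt f a b)%C.
Proof. intros Hf. apply CInt_unique. apply is_RInt_Cscal. now apply CInt_correct. Qed.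

Lemma CInt_minus f g a b : (forall t, continuous f t) -> (forall t, continuous g t) ->
  CInt (fun t => (f t - g t)%C) a b = (CInt f a b - CInt g a b)%C.
Proof.
  intros Hf Hg. apply CInt_unique.
  apply (is_RInt_minus (V := C_R_CompleteNormedModule) f g); now apply CInt_correct.
Qed.

Lemma CInt_Chasles f a b c : (forall t, continuous f t) ->
  (CInt f a b + CInt f b c)%C = CInt f a c.
Proof.
  intros H. symmetry. apply CInt_unique.
  apply (is_RInt_Chasles (V := C_R_CompleteNormedModule) f a b c); now apply CInt_correct.
Qed.

Lemma CInt_bound f a b M : a <= b -> (forall t, continuous f t) ->
  (forall t, a <= t <= b -> Cmod (f t) <= M) -> Cmod (CInt f a b) <= (b - a) * M.
Proof.
  intros Hab Hf HM. rewrite <- norm_Cmod.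
  apply (norm_RInt_le_const (V := C_R_CompleteNormedModule) f); auto.
  - intros t Ht. rewrite norm_Cmod. auto.
  - now apply CInt_correct.
Qed.

Lemma cder_is_derive (H : R -> C) t l : cder H t l -> @is_derive _ C_R_NormedModule H t l.
Proof.
  intros [H1 H2].
  pose proof (filterdiff_comp'_2 (K := R_AbsRing) (T := R_NormedModule) (U := R_NormedModule)
    (V := R_NormedModule) (W := C_R_NormedModule) (fun s => fst (H s)) (fun s => snd (H s))
    (fun x y => (x, y) : C) t _ _ (fun x y => (x, y) : C) H1 H2) as D.
  assert (E : filterdiff (fun t : prod_NormedModule R_AbsRing R_NormedModule R_NormedModule =>
      (fst t, snd t) : C_R_NormedModule) (locally (fst (H t), snd (H t)))
      (fun t : prod_NormedModule R_AbsRing R_NormedModule R_NormedModule => (fst t, snd t) : C_R_NormedModule)).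
  { apply filterdiff_ext with (f := fun t => t); [now intros []|].
    apply filterdiff_ext_lin with (l1 := fun t => t); [apply filterdiff_id|now intros []]. }
  specialize (D E).
  apply filterdiff_ext with (f := fun y => (fst (H y), snd (H y)) : C).
  { intros y. now destruct (H y). }
  eapply filterdiff_ext_lin; [exact D|]. intros y. destruct l. reflexivity.
Qed.

Lemma CInt_derive (H H' : R -> C) a b : (forall t, cder H t (H' t)) ->
  (forall t, continuous H' t) -> CInt H' a b = (H b - H a)%C.
Proof.
  intros Hd Hc. apply CInt_unique.
  apply (is_RInt_derive (V := C_R_CompleteNormedModule) H H').
  - intros t _. apply cder_is_derive. apply Hd.
  - intros t _. apply Hc.
Qed.

(** By [tube], continuity at each point of the fibre over [t0] becomes closeness of [f t] to [f t0]
    uniformly on [a, b]. *)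
Lemma CInt_param (T : UniformSpace) (f : T -> R -> C) t0 a b : a <= b ->
  (forall t w, continuous (f t) w) ->
  (forall w, continuous (fun p : T * R => f (fst p) (snd p)) (t0, w)) ->
  continuous (fun t => CInt (f t) a b) t0.
Proof.
  intros Hab Hc H. apply C_continuous. intros e He.
  set (e' := e / (2 * (b - a + 1))).
  assert (He' : 0 < e') by (apply Rdiv_lt_0_compat; lra).
  assert (L : locally t0 (fun t => forall w, a <= w <= b -> Cmod (f t w - f t0 w)%C <= 2 * e')).
  { apply tube. intros w Hw.
    pose proof (proj1 (C_continuous _ _) (H w) e' He') as H1. cbn in H1.
    assert (H2 : locally (t0, w) (fun p : T * R => Cmod (f t0 (snd p) - f t0 w)%C < e')).
    { pose proof (proj1 (C_continuous _ _) (Hc t0 w) e' He') as [d Hd].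
      exists d. intros [t v] [_ Hv]. apply Hd. exact Hv. }
    generalize (filter_and _ _ H1 H2). apply filter_imp. intros [t v] [E1 E2]. cbn in *.
    replace (f t v - f t0 v)%C with ((f t v - f t0 w) - (f t0 v - f t0 w))%C by ring.
    eapply Rle_trans; [apply Cmod_triangle|]. rewrite Cmod_opp. lra. }
  generalize L. apply filter_imp. intros t Ht.
  rewrite <- CInt_minus by auto.
  eapply Rle_lt_trans; [apply CInt_bound with (M := 2 * e')|]; auto.
  - intros w. apply continuous_Cminus; auto.
  - unfold e'. apply Rlt_le_trans with ((b - a + 1) * (2 * (e / (2 * (b - a + 1))))).
    + apply Rmult_lt_compat_r; [|lra]. fold e'. lra.
    + right. field. lra.
Qed.

(** On a period the weight is constant, so domination means boundedness, and the boundary terms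
    cancel by periodicity. The record sits behind an opaque existence proof and is used only through
    the listed equations, so that conversion never unfolds the integral. *)
Lemma integral_T_exists : { I : integral | II I = (fun f => CInt f 0 (2 * PI)) /\
  wt I = (fun _ => 1) /\ mass I = 2 * PI /\ forall H, H 0 = H (2 * PI) -> bdry I H }.
Proof.
  unshelve eexists {| II := fun f => CInt f 0 (2 * PI); wt := fun _ => 1; mass := 2 * PI; bdry := fun H => H 0 = H (2 * PI) |};
    [..|repeat split; auto].
  - intros; lra.
  - intros; lra.
  - pose proof PI_RGT_0; lra.
  - intros f g K L [Hf _] [Hg _]. now apply CInt_plus.
  - intros f K c [Hf _]. now apply CInt_scal.
  - intros f K [Hf HK]. replace (2 * PI * K) with ((2 * PI - 0) * K) by ring.
    apply CInt_bound; auto.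
    + pose proof PI_RGT_0; lra.
    + intros t _. rewrite <- (Rmult_1_r K). auto.
  - intros T f K t0 Hf Hc. apply (CInt_param T f); auto.
    + pose proof PI_RGT_0; lra.
    + intros t w. apply Hf.
  - intros H H' K L _ [Hc _] Hd HB. change (CInt H' 0 (2 * PI) = 0%C).
    rewrite (CInt_derive H H'); auto. rewrite HB. ring.
Qed.

Definition integral_T : integral := proj1_sig integral_T_exists.

(** * Integrals over R *)

(** The Cauchy kernel. Its primitive is [atan], so tails and total mass [PI] are explicit, and its
    inverse is exactly the factor gained by two integrations by parts. *)
Definition bump (u : R) : R := / (1 + u ^ 2).

Lemma bump_pos u : 0 < bump u.
Proof. apply Rinv_0_lt_compat. nra. Qed.

Lemma bump_le1 u : bump u <= 1.
Proof. rewrite <- Rinv_1. apply Rinv_le_contravar; nra. Qed.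

Lemma atan_cauchy e : 0 < e -> exists M, 0 < M /\ forall x y, M < x -> M < y -> Rabs (atan x - atan y) < e.
Proof.
  (* Beyond [tan s] the values of [atan] lie within e of PI / 2; the bound PI / 4 keeps [tan s]
     positive when e is large. *)
  intros He. set (s := Rmax (PI / 4) (PI / 2 - e)).
  pose proof PI_RGT_0.
  assert (Hs : PI / 4 <= s < PI / 2).
  { split; [apply Rmax_l|]. apply Rmax_lub_lt; lra. }
  assert (Hs2 : PI / 2 - e <= s) by apply Rmax_r.
  exists (tan s). split; [apply tan_gt_0; lra|].
  assert (H1 : forall x, tan s < x -> s < atan x < PI / 2).
  { intros x Hx. split; [|apply atan_bound].
    rewrite <- (atan_tan s) by lra. now apply atan_increasing. }
  intros x y Hx Hy. apply H1 in Hx. apply H1 in Hy. apply Rabs_def1; lra.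
Qed.

(** Comparison with [K * bump], whose primitive is [K * atan]; a reversed interval only changes the
    sign. *)
Lemma CInt_bump_bound f K a b : dominated bump K f -> Cmod (CInt f a b) <= K * Rabs (atan b - atan a).
Proof.
  intros [Hf HK].
  assert (W : forall a b, a <= b -> Cmod (CInt f a b) <= K * Rabs (atan b - atan a)).
  { clear a b. intros a b Hab. rewrite <- norm_Cmod.
    assert (I : is_RInt (fun u => K * bump u) a b (K * (atan b - atan a))).
    { apply (is_RInt_scal (V := R_NormedModule) bump).
      apply (is_RInt_derive (V := R_CompleteNormedModule) atan bump).
      - intros t _. unfold bump. auto_derive; auto. simpl. field. nra.
      - intros t _. apply (ex_derive_continuous (V := R_NormedModule) bump). unfold bump. auto_derive. nra. }
    rewrite Rabs_pos_eq.
    - apply (norm_RInt_le (V := C_R_CompleteNormedModule) f (fun u => K * bump u) a b); auto.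
      + intros t _. rewrite norm_Cmod. auto.
      + now apply CInt_correct.
    - destruct Hab as [Hab| ->]; [|lra]. apply atan_increasing in Hab. lra. }
  destruct (Rle_or_lt a b) as [H|H]; auto.
  replace (CInt f a b) with (- CInt f b a)%C.
  - rewrite Cmod_opp, Rabs_minus_sym. apply W; lra.
  - assert (E : (CInt f a b + CInt f b a)%C = 0%C).
    { rewrite CInt_Chasles by auto. apply CInt_unique.
      apply (is_RInt_point (V := C_R_CompleteNormedModule)). }
    rewrite <- (Cplus_0_l (- _)%C), <- E. ring.
Qed.

(** [M] is chosen before [f]: the tails are small uniformly over all functions with the same
    domination constant. This uniformity is what later gives continuity of the integral in
    parameters. *)
Lemma CInt_cauchy K e : 0 < e -> exists M, 0 < M /\ forall f, dominated bump K f ->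
  forall a b a' b', a < - M -> M < b -> a' < - M -> M < b' ->
  Cmod (CInt f a b - CInt f a' b')%C < e.
Proof.
  intros He.
  assert (Hk : 0 < Rabs K + 1) by (pose proof (Rabs_pos K); lra).
  destruct (atan_cauchy (e / (2 * (Rabs K + 1)))) as [M [HM H]].
  { apply Rdiv_lt_0_compat; lra. }
  exists M. split; auto. intros f Hf a b a' b' Ha Hb Ha' Hb'.
  assert (E : (CInt f a b - CInt f a' b')%C = (CInt f a a' + CInt f b' b)%C).
  { destruct Hf as [Hf _]. rewrite <- (CInt_Chasles f a a' b), <- (CInt_Chasles f a' b' b) by auto. ring. }
  rewrite E. eapply Rle_lt_trans; [apply Cmod_triangle|].
  pose proof (CInt_bump_bound f K a a' Hf) as B1. pose proof (CInt_bump_bound f K b' b Hf) as B2.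
  assert (A1 : Rabs (atan a' - atan a) < e / (2 * (Rabs K + 1))).
  { replace (atan a' - atan a) with (atan (- a) - atan (- a')) by (rewrite !atan_opp; ring).
    apply H; lra. }
  assert (A2 : Rabs (atan b - atan b') < e / (2 * (Rabs K + 1))) by (apply H; lra).
  assert (HK : 0 <= K).
  { destruct Hf as [_ Hf]. specialize (Hf 0). pose proof (Cmod_ge_0 (f 0)). unfold bump in Hf.
    replace (/ (1 + 0 ^ 2)) with 1 in Hf by field. lra. }
  rewrite (Rabs_pos_eq K) in * by auto.
  apply Rle_lt_trans with (K * (e / (2 * (K + 1))) + K * (e / (2 * (K + 1)))); [nra|].
  replace (K * (e / (2 * (K + 1))) + K * (e / (2 * (K + 1)))) with (e * (K / (K + 1))) by (field; lra).
  rewrite <- (Rmult_1_r e) at 2. apply Rmult_lt_compat_l; auto.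
  apply Rlt_div_l; lra.
Qed.

Lemma int_R_unique f l : (forall t, continuous f t) ->
  (forall e, 0 < e -> exists M, forall a b, a < - M -> M < b -> Cmod (CInt f a b - l)%C < e) ->
  int_R f = l.
Proof.
  intros Hf H. unfold int_R.
  apply (@is_RInt_gen_unique C_R_CompleteNormedModule (Rbar_locally m_infty) (Rbar_locally p_infty) _ _ f l).
  intros P [d Hd]. destruct (H d (cond_pos d)) as [M HM].
  apply (Filter_prod _ _ _ (fun a => a < - M) (fun b => M < b)).
  - now exists (- M).
  - now exists M.
  - intros a b Ha Hb. exists (CInt f a b). split; [now apply CInt_correct|].
    apply Hd. specialize (HM a b Ha Hb). split.
    + change (Rabs (fst (CInt f a b - l)%C) < d). eapply Rle_lt_trans; [apply Rabs_fst_Cmod|exact HM].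
    + change (Rabs (snd (CInt f a b - l)%C) < d). eapply Rle_lt_trans; [apply Rabs_snd_Cmod|exact HM].
Qed.

Lemma CInt_lim f K : dominated bump K f -> exists l,
  forall e, 0 < e -> exists M, forall a b, a < - M -> M < b -> Cmod (CInt f a b - l)%C < e.
Proof.
  intros Hf.
  set (F := filter_prod (Rbar_locally m_infty) (Rbar_locally p_infty)).
  destruct (proj1 (filterlim_locally_cauchy (U := C_R_CompleteNormedModule) (F := F)
    (fun ab => CInt f (fst ab) (snd ab)))) as [l Hl].
  - intros e. destruct (CInt_cauchy K e (cond_pos e)) as [M [HM H]].
    exists (fun ab => fst ab < - M /\ M < snd ab). split.
    + apply (Filter_prod _ _ _ (fun a => a < - M) (fun b => M < b)); [now exists (- M)|now exists M|auto].
    + intros [a b] [a' b'] [Ha Hb] [Ha' Hb']. cbn in *.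
      pose proof (H f Hf a' b' a b Ha' Hb' Ha Hb) as B. split.
      * change (Rabs (fst (CInt f a' b' - CInt f a b)%C) < e). eapply Rle_lt_trans; [apply Rabs_fst_Cmod|exact B].
      * change (Rabs (snd (CInt f a' b' - CInt f a b)%C) < e). eapply Rle_lt_trans; [apply Rabs_snd_Cmod|exact B].
  - exists l. intros e He.
    destruct (proj1 (C_filterlim F _ l) Hl e He) as [P Q [M1 H1] [M2 H2] H3].
    exists (Rmax (- M1) M2). intros a b Ha Hb.
    pose proof (Rmax_l (- M1) M2). pose proof (Rmax_r (- M1) M2).
    apply (H3 a b); [apply H1|apply H2]; lra.
Qed.

Lemma int_R_lim f K : dominated bump K f ->
  forall e, 0 < e -> exists M, forall a b, a < - M -> M < b -> Cmod (CInt f a b - int_R f)%C < e.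
Proof.
  intros Hf. destruct (CInt_lim f K Hf) as [l Hl].
  rewrite (int_R_unique f l); [exact Hl|apply Hf|exact Hl].
Qed.

Lemma int_R_tail K e : 0 < e -> exists M, 0 < M /\ forall f, dominated bump K f ->
  forall a b, a < - M -> M < b -> Cmod (CInt f a b - int_R f)%C < e.
Proof.
  intros He. destruct (CInt_cauchy K (e / 2)) as [M [HM H]]; [lra|].
  exists M. split; auto. intros f Hf a b Ha Hb.
  destruct (int_R_lim f K Hf (e / 2)) as [M' HM']; [lra|].
  set (N := Rmax M M' + 1). pose proof (Rmax_l M M'). pose proof (Rmax_r M M').
  specialize (HM' (- N) N). specialize (H f Hf a b (- N) N).
  replace (CInt f a b - int_R f)%C with ((CInt f a b - CInt f (- N) N) + (CInt f (- N) N - int_R f))%C by ring.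
  eapply Rle_lt_trans; [apply Cmod_triangle|]. unfold N in *.
  assert (Cmod (CInt f a b - CInt f (- (Rmax M M' + 1)) (Rmax M M' + 1))%C < e / 2) by (apply H; lra).
  assert (Cmod (CInt f (- (Rmax M M' + 1)) (Rmax M M' + 1) - int_R f)%C < e / 2) by (apply HM'; lra).
  lra.
Qed.

Lemma bump_small e : 0 < e -> exists M, 0 < M /\ forall x, M < Rabs x -> bump x < e.
Proof.
  intros He. exists (1 + / e). assert (0 < / e) by now apply Rinv_0_lt_compat.
  split; [lra|]. intros x Hx. unfold bump.
  rewrite <- (Rinv_inv e). apply Rinv_lt_contravar.
  - apply Rmult_lt_0_compat; auto. nra.
  - rewrite <- (pow2_abs x). nra.
Qed.

(** Every function is admissible for [bdry], since a function dominated by [bump] tends to 0 at both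
    ends. The mass is the total variation of [atan]. *)
Lemma integral_R_exists : { I : integral | II I = int_R /\ wt I = bump /\ mass I = PI /\
  forall H, bdry I H }.
Proof.
  unshelve eexists {| II := int_R; wt := bump; mass := PI; bdry := fun _ => True |};
    [..|repeat split; auto].
  - apply bump_pos.
  - apply bump_le1.
  - pose proof PI_RGT_0; lra.
  - intros f g K L Hf Hg. apply int_R_unique.
    + intros t. apply continuous_Cplus; [apply Hf|apply Hg].
    + intros e He. destruct (int_R_lim f K Hf (e / 2)) as [M1 H1]; [lra|].
      destruct (int_R_lim g L Hg (e / 2)) as [M2 H2]; [lra|].
      exists (Rmax M1 M2). intros a b Ha Hb. pose proof (Rmax_l M1 M2). pose proof (Rmax_r M1 M2).
      rewrite CInt_plus by (apply Hf || apply Hg).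
      replace (CInt f a b + CInt g a b - (int_R f + int_R g))%C
        with ((CInt f a b - int_R f) + (CInt g a b - int_R g))%C by ring.
      eapply Rle_lt_trans; [apply Cmod_triangle|].
      specialize (H1 a b). specialize (H2 a b). 
      assert (Cmod (CInt f a b - int_R f)%C < e / 2) by (apply H1; lra).
      assert (Cmod (CInt g a b - int_R g)%C < e / 2) by (apply H2; lra). lra.
  - intros f K c Hf. apply int_R_unique.
    + intros t. apply continuous_Cmult; [apply continuous_const|apply Hf].
    + intros e He. pose proof (Cmod_ge_0 c).
      destruct (int_R_lim f K Hf (e / (Cmod c + 1))) as [M H1]; [apply Rdiv_lt_0_compat; lra|].
      exists M. intros a b Ha Hb. rewrite CInt_scal by apply Hf.
      replace (c * CInt f a b - c * int_R f)%C with (c * (CInt f a b - int_R f))%C by ring.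
      rewrite Cmod_mult. specialize (H1 a b Ha Hb). pose proof (Cmod_ge_0 (CInt f a b - int_R f)%C).
      apply Rlt_div_r in H1; [|lra]. nra.
  - intros f K Hf. apply le_epsilon. intros e He.
    destruct (int_R_tail K e He) as [M [HM H]].
    specialize (H f Hf (- M - 1) (M + 1)).
    assert (H1 : Cmod (CInt f (- M - 1) (M + 1) - int_R f)%C < e) by (apply H; lra).
    eapply Rle_trans; [apply (Cmod_minus_le _ (CInt f (- M - 1) (M + 1)))|].
    rewrite (Cmod_minus_sym (int_R f)).
    pose proof (CInt_bump_bound f K (- M - 1) (M + 1) Hf) as B.
    assert (A : Rabs (atan (M + 1) - atan (- M - 1)) <= PI).
    { pose proof (atan_bound (M + 1)). pose proof (atan_bound (- M - 1)). apply Rabs_le. lra. }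
    assert (HK : 0 <= K).
    { destruct Hf as [_ Hf]. specialize (Hf 0). pose proof (Cmod_ge_0 (f 0)). unfold bump in Hf.
      replace (/ (1 + 0 ^ 2)) with 1 in Hf by field. lra. }
    nra.
  (* Three errors of e / 3: two tails, uniform in the parameter by [int_R_tail], and the integral
     over a fixed bounded interval, continuous by [CInt_param]. *)
  - intros T f K t0 Hf Hc. apply C_continuous. intros e He.
    destruct (int_R_tail K (e / 3)) as [M [HM H]]; [lra|].
    assert (C1 : continuous (fun t => CInt (f t) (- M - 1) (M + 1)) t0).
    { apply (CInt_param T f); auto; [lra|]. intros t w. apply Hf. }
    generalize (proj1 (C_continuous _ _) C1 (e / 3) ltac:(lra)). apply filter_imp.
    intros t Ht. pose proof (H (f t) (Hf t) (- M - 1) (M + 1) ltac:(lra) ltac:(lra)) as H1.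
    pose proof (H (f t0) (Hf t0) (- M - 1) (M + 1) ltac:(lra) ltac:(lra)) as H2.
    rewrite Cmod_minus_sym in H1.
    set (A := CInt (f t) (- M - 1) (M + 1)) in *. set (B := CInt (f t0) (- M - 1) (M + 1)) in *.
    replace (int_R (f t) - int_R (f t0))%C
      with ((int_R (f t) - A) + ((A - B) + (B - int_R (f t0))))%C by ring.
    eapply Rle_lt_trans; [apply Cmod_triangle|].
    pose proof (Cmod_triangle (A - B) (B - int_R (f t0)))%C. lra.
  (* Over a bounded interval the integral of [H'] is a difference of two values of [H], each small
     once the end point lies beyond the [M] of [bump_small]. *)
  - intros H H' K L HH HH' Hd _. apply int_R_unique; [apply HH'|].
    assert (HK : 0 <= K).
    { destruct HH as [_ HH]. specialize (HH 0). pose proof (Cmod_ge_0 (H 0)). unfold bump in HH.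
      replace (/ (1 + 0 ^ 2)) with 1 in HH by field. lra. }
    intros e He. destruct (bump_small (e / (2 * (K + 1)))) as [M [HM HB]].
    { apply Rdiv_lt_0_compat; lra. }
    exists M. intros a b Ha Hb. rewrite (CInt_derive H H') by (apply Hd || apply HH').
    replace (H b - H a - 0)%C with (H b + - H a)%C by ring.
    eapply Rle_lt_trans; [apply Cmod_triangle|]. rewrite Cmod_opp.
    destruct HH as [_ HH]. pose proof (HH a) as Ba. pose proof (HH b) as Bb.
    assert (W : forall x, M < Rabs x -> Cmod (H x) < e / 2).
    { intros x Hx. eapply Rle_lt_trans; [apply HH|]. specialize (HB x Hx).
      apply Rlt_div_r in HB; [|lra]. pose proof (bump_pos x). nra. }
    assert (Cmod (H a) < e / 2) by (apply W; rewrite Rabs_left; lra).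
    assert (Cmod (H b) < e / 2) by (apply W; rewrite Rabs_pos_eq; lra). lra.
Qed.

Definition integral_R : integral := proj1_sig integral_R_exists.

Lemma CInt_affine f a b x y : a <> 0 -> (forall t, continuous f t) ->
  CInt f (a * x + b) (a * y + b) = (a * CInt (fun t => f (a * t + b)%R) x y)%C.
Proof.
  intros Ha Hf.
  pose proof (is_RInt_comp_lin (V := C_R_CompleteNormedModule) f a b x y _ (CInt_correct f _ _ Hf)) as H.
  apply CInt_unique in H. rewrite <- H.
  rewrite <- CInt_scal.
  - f_equal. extensionality t.
    apply injective_projections; cbn; unfold mult; cbn; ring.
  - intros t. apply (continuous_comp (fun t => a * t + b) f); [cts|apply Hf].
Qed.

Lemma int_R_affine f a b K : 0 < a -> dominated bump K (fun t => f (a * t + b)) ->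
  int_R f = (a * int_R (fun t => f (a * t + b)%R))%C.
Proof.
  intros Ha H.
  assert (Hf : forall t, continuous f t).
  { intros t. apply (continuous_ext (fun t => f (a * (/ a * t + - b / a) + b))).
    - intros s. f_equal. field. lra.
    - apply (continuous_comp (fun t => / a * t + - b / a) (fun t => f (a * t + b))); [cts|apply H]. }
  apply int_R_unique; auto. intros e He.
  destruct (int_R_lim _ K H (e / a)) as [M HM]; [apply Rdiv_lt_0_compat; lra|].
  exists (a * Rabs M + Rabs b). intros x y Hx Hy.
  pose proof (Rle_abs b). pose proof (Rle_abs (- b)) as Hb. rewrite Rabs_Ropp in Hb.
  pose proof (Rle_abs M).
  replace x with (a * ((x - b) / a) + b) by (field; lra).
  replace y with (a * ((y - b) / a) + b) by (field; lra).
  rewrite CInt_affine by (auto; lra).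
  assert (X : (x - b) / a < - M) by (apply Rlt_div_l; nra).
  assert (Y : M < (y - b) / a) by (apply Rlt_div_r; nra).
  specialize (HM _ _ X Y).
  match goal with |- Cmod (?u * ?v - ?u * ?w)%C < _ =>
    replace (u * v - u * w)%C with (u * (v - w))%C by ring end.
  rewrite Cmod_mult, Cmod_R, Rabs_pos_eq by lra. apply Rlt_div_r in HM; lra.
Qed.

(** Improper convergence of [f] and of its translate to a given value are equivalent predicates, and
    [RInt_gen] selects its value from this predicate. So the equality holds for every [f],
    convergent or not. *)
Lemma int_R_translate f b : int_R (fun t => f (t + b)) = int_R f.
Proof.
  assert (W : forall f b l, @is_RInt_gen C_R_CompleteNormedModule f (Rbar_locally m_infty) (Rbar_locally p_infty) l ->
     @is_RInt_gen C_R_CompleteNormedModule (fun t => f (t + b)) (Rbar_locally m_infty) (Rbar_locally p_infty) l).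
  { clear f b. intros f b l H P HP. specialize (H P HP).
    destruct H as [A B [M1 H1] [M2 H2] H3].
    apply (Filter_prod _ _ _ (fun x => x < M1 - b) (fun y => M2 - b < y)); [now exists (M1 - b)|now exists (M2 - b)|].
    intros x y Hx Hy.
    destruct (H3 (x + b) (y + b)) as [z [Hz HPz]]; [apply H1; lra|apply H2; lra|].
    exists z. split; auto. cbn in *.
    pose proof (is_RInt_comp_lin (V := C_R_CompleteNormedModule) f 1 b x y z) as L.
    rewrite !Rmult_1_l in L. specialize (L Hz).
    eapply (is_RInt_ext (V := C_R_CompleteNormedModule)); [|exact L]. intros t _. cbv beta.
    rewrite Rmult_1_l. apply (scal_one (V := C_R_CompleteNormedModule)). }
  unfold int_R, RInt_gen. f_equal. extensionality l.
  apply propositional_extensionality. split; intros H.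
  - pose proof (W (fun t => f (t + b)) (- b) l H) as H'. cbv beta in H'.
    replace f with (fun t => f (t + - b + b)); [exact H'|].
    extensionality t. f_equal. ring.
  - exact (W f b l H).
Qed.

Lemma integral_T_E f : II integral_T f = CInt f 0 (2 * PI).
Proof. destruct (proj2_sig integral_T_exists) as [E _]. unfold integral_T. now rewrite E. Qed.

Lemma wt_T u : wt integral_T u = 1.
Proof. destruct (proj2_sig integral_T_exists) as [_ [E _]]. unfold integral_T. now rewrite E. Qed.

Lemma mass_T : mass integral_T = 2 * PI.
Proof. destruct (proj2_sig integral_T_exists) as [_ [_ [E _]]]. exact E. Qed.

Lemma bdry_T (H : R -> C) : H 0 = H (2 * PI) -> bdry integral_T H.
Proof. destruct (proj2_sig integral_T_exists) as [_ [_ [_ E]]]. apply E. Qed.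

Lemma integral_R_E f : II integral_R f = int_R f.
Proof. destruct (proj2_sig integral_R_exists) as [E _]. unfold integral_R. now rewrite E. Qed.

Lemma wt_R u : wt integral_R u = bump u.
Proof. destruct (proj2_sig integral_R_exists) as [_ [E _]]. unfold integral_R. now rewrite E. Qed.

Lemma mass_R : mass integral_R = PI.
Proof. destruct (proj2_sig integral_R_exists) as [_ [_ [E _]]]. exact E. Qed.

Lemma bdry_R (H : R -> C) : bdry integral_R H.
Proof. destruct (proj2_sig integral_R_exists) as [_ [_ [_ E]]]. apply E. Qed.

Lemma integral_R_affine f a b K : 0 < a -> dominated (wt integral_R) K (fun t => f (a * t + b)) ->
  II integral_R f = (a * II integral_R (fun t => f (a * t + b)%R))%C.
Proof.
  destruct (proj2_sig integral_R_exists) as [E1 [E2 _]]. unfold integral_R. rewrite E1, E2. apply int_R_affine.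
Qed.

Opaque CInt int_R.

(** * Iterated directional derivatives: locality, symmetry, linearity *)

Lemma Derive_shift (F : R -> R) y : Derive F y = Derive (fun s => F (y + s)) 0.
Proof.
  unfold Derive. f_equal. apply Lim_ext. intros h. f_equal. f_equal; f_equal; ring.
Qed.

Section Smooth.
Context {V : NormedModule R_AbsRing}.
Implicit Types (f g : V -> C) (p v w : V).

Lemma plus_scal_assoc p v (s t : R) : plus p (scal (s + t) v) = plus (plus p (scal s v)) (scal t v).
Proof. rewrite <- plus_assoc. f_equal. exact (scal_distr_r (K := R_AbsRing) s t v). Qed.

Lemma plus_scal_0 p v : plus p (scal 0 v) = p.
Proof. replace (scal 0 v) with (zero : V); [apply plus_zero_r|]. symmetry. exact (scal_zero_l (K := R_AbsRing) v). Qed.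

Lemma continuous_line p v t : continuous (fun s : R => plus p (scal s v)) t.
Proof.
  apply (continuous_plus (V := V)); [apply continuous_const|].
  apply (continuous_scal_l (K := R_AbsRing) (V := V)). apply continuous_id.
Qed.

Lemma derivable_cder v f p : derivable_along v f p -> cder (line f v p) 0 (dir v f p).
Proof. intros [H1 H2]. split; now apply Derive_correct. Qed.

Lemma cder_derivable v f p l : cder (line f v p) 0 l -> derivable_along v f p /\ dir v f p = l.
Proof.
  intros [H1 H2]. split; [split; eexists; eassumption|].
  unfold dir. apply injective_projections; now apply is_derive_unique.
Qed.

(** [dir] differentiates only at parameter 0; the line is rebased at its point of parameter t. *)
Lemma line_cder v f p t : derivable_along v f (plus p (scal t v)) ->
  cder (line f v p) t (dir v f (plus p (scal t v))).
Proof.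
  intros H. apply derivable_cder in H.
  pose proof (cder_comp_affine (line f v (plus p (scal t v))) 1 (- t) t (dir v f (plus p (scal t v)))) as A.
  replace (1 * t + - t) with 0 in A by ring. specialize (A H). rewrite Cmult_1_l in A.
  eapply cder_ext; [|exact A]. intros s. unfold line.
  rewrite <- plus_scal_assoc. do 3 f_equal. ring.
Qed.

Lemma locally_line (P : V -> Prop) p v : locally p P -> locally 0 (fun t : R => P (plus p (scal t v))).
Proof.
  intros H. apply (continuous_line p v 0 P). now rewrite plus_scal_0.
Qed.

Lemma dir_ext_loc v f g p : locally p (fun q => f q = g q) -> dir v f p = dir v g p.
Proof.
  intros H. apply (locally_line _ _ v) in H. unfold dir.
  f_equal; apply Derive_ext_loc; generalize H; apply filter_imp; unfold line; intros t Ht; cbv beta in Ht; cbn; now rewrite Ht.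
Qed.

Lemma derivable_ext_loc v f g p : locally p (fun q => f q = g q) -> derivable_along v f p -> derivable_along v g p.
Proof.
  intros H [H1 H2]. apply (locally_line _ _ v) in H.
  split.
  - apply (ex_derive_ext_loc (fun t => fst (line f v p t))); [|exact H1].
    generalize H. apply filter_imp. unfold line. intros t Ht. cbv beta in Ht. cbn. now rewrite Ht.
  - apply (ex_derive_ext_loc (fun t => snd (line f v p t))); [|exact H2].
    generalize H. apply filter_imp. unfold line. intros t Ht. cbv beta in Ht. cbn. now rewrite Ht.
Qed.

Lemma dirs_app l l' f : dirs (l ++ l') f = dirs l (dirs l' f).
Proof. unfold dirs. apply fold_right_app. Qed.

Variables (b : list V) (Om : V -> Prop).
Hypothesis HOm : open Om.

Lemma dirs_ext_on l f g : (forall p, Om p -> f p = g p) -> forall p, Om p -> dirs l f p = dirs l g p.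
Proof.
  intros H. induction l as [|v l IH]; cbn; auto.
  intros p Hp. apply dir_ext_loc. generalize (HOm p Hp). apply filter_imp. exact IH.
Qed.

Lemma smooth_on_dirs l f : incl l b -> smooth_on b Om f -> smooth_on b Om (dirs l f).
Proof.
  intros Hl Hf l' Hl' p Hp. rewrite <- dirs_app.
  apply Hf; auto. now apply incl_app.
Qed.

Lemma smooth_continuous f p : smooth_on b Om f -> Om p -> continuous f p.
Proof. intros H Hp. apply (H [] (incl_nil_l _) p Hp). Qed.

Lemma smooth_derivable f v p : smooth_on b Om f -> In v b -> Om p -> derivable_along v f p.
Proof. intros H Hv Hp. now apply (H [] (incl_nil_l _) p Hp). Qed.

Lemma incl_single (v : V) : In v b -> incl [v] b.
Proof. intros H x [<-|[]]. exact H. Qed.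

Lemma smooth_dir f v : smooth_on b Om f -> In v b -> smooth_on b Om (dir v f).
Proof. intros H Hv. apply (smooth_on_dirs [v]); auto using incl_single. Qed.

(** The theorem of Schwarz for a function of two real variables, applied to the real and imaginary
    parts of [f] on the plane p + s v + t w. Most of the work identifies partial derivatives in s
    and t at arbitrary parameters with [dir], and uses that [Om] is open to have them near (0,
    0). *)
Lemma dir_comm f v w p : smooth_on b Om f -> In v b -> In w b -> Om p ->
  dir v (dir w f) p = dir w (dir v f) p.
Proof.
  intros Hf Hv Hw Hp.
  assert (X : forall (k : C -> R), (k = fst \/ k = snd) ->
    k (dir v (dir w f) p) = k (dir w (dir v f) p)).
  { intros k Hk.
    set (q := fun s t : R => plus (plus p (scal s v)) (scal t w)).
    set (G := fun (h : V -> C) (s t : R) => k (h (q s t))).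
    assert (Kd : forall v h p, k (dir v h p) = Derive (fun s => k (h (plus p (scal s v)))) 0).
    { intros. destruct Hk as [-> | ->]; reflexivity. }
    assert (Dt : forall h s t, Derive (fun t => G h s t) t = G (dir w h) s t).
    { intros h s t. unfold G. rewrite Kd, Derive_shift. apply Derive_ext. intros r.
      unfold q. now rewrite plus_scal_assoc. }
    assert (Q2 : forall s r t, q (s + r) t = plus (q s t) (scal r v)).
    { intros s r t. unfold q. rewrite plus_scal_assoc, <- !plus_assoc. f_equal. f_equal. apply plus_comm. }
    assert (Ds : forall h s t, Derive (fun s => G h s t) s = G (dir v h) s t).
    { intros h s t. unfold G. rewrite Kd, Derive_shift. apply Derive_ext. intros r.
      now rewrite Q2. }
    assert (Hq : continuous (fun z : R2 => q (fst z) (snd z)) (0, 0)).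
    { unfold q. apply (continuous_plus (V := V)); [apply (continuous_plus (V := V)); [apply continuous_const|]|];
      apply (continuous_scal_l (K := R_AbsRing) (V := V)); cts. }
    assert (q0 : q 0 0 = p) by (unfold q; now rewrite !plus_scal_0).
    assert (Ed : forall h u r, In u b -> Om (plus p r) -> smooth_on b Om h ->
       ex_derive (fun s => k (h (plus (plus p r) (scal s u)))) 0).
    { intros h u r Hu Hr Hh. destruct (smooth_derivable h u _ Hh Hu Hr). destruct Hk as [-> | ->]; auto. }
    assert (Es : forall (F : R -> R) y, ex_derive (fun s => F (y + s)) 0 -> ex_derive F y).
    { intros F y HF.
      apply (ex_derive_ext (fun s => (fun s => F (y + s)) (s - y))).
      - intros t. f_equal. ring.
      - apply (ex_derive_comp (fun s => F (y + s)) (fun s => s - y)).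
        + now replace (y - y) with 0 by ring.
        + auto_derive; auto. }
    assert (Eds : forall h s t, smooth_on b Om h -> Om (q s t) -> ex_derive (fun s => G h s t) s).
    { intros h s t Hh Hqq. apply Es. unfold G.
      apply (ex_derive_ext (fun r => k (h (plus (q s t) (scal r v))))).
      - intros r. now rewrite Q2.
      - unfold q in *. rewrite <- plus_assoc in *. now apply Ed. }
    assert (Edt : forall h s t, smooth_on b Om h -> Om (q s t) -> ex_derive (fun t => G h s t) t).
    { intros h s t Hh Hqq. apply Es. unfold G.
      apply (ex_derive_ext (fun r => k (h (plus (q s t) (scal r w))))).
      - intros r. unfold q. now rewrite plus_scal_assoc.
      - unfold q in *. rewrite <- (plus_assoc p) in *. now apply Ed. }
    assert (Cd : forall h, smooth_on b Om h -> continuity_2d_pt (G h) 0 0).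
    { intros h Hh. apply continuity_2d_pt_filterlim. unfold G.
      assert (C1 : continuous (fun z : R2 => h (q (fst z) (snd z))) (0, 0)).
      { apply (continuous_comp (fun z : R2 => q (fst z) (snd z)) h); auto.
        cbn [fst snd]. rewrite q0. now apply smooth_continuous. }
      destruct Hk as [-> | ->].
      - apply (continuous_fst_C (fun z : R2 => h (q (fst z) (snd z))) _ C1).
      - apply (continuous_snd_C (fun z : R2 => h (q (fst z) (snd z))) _ C1). }
    assert (E1 : (fun z => Derive (fun t => G f z t) 0) = (fun z => G (dir w f) z 0)).
    { extensionality z. apply Dt. }
    assert (E2 : (fun t => Derive (fun s => G f s t) 0) = (fun t => G (dir v f) 0 t)).
    { extensionality z. apply Ds. }
    assert (E1' : (fun z y => Derive (fun t => G f z t) y) = G (dir w f)).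
    { extensionality z. extensionality y. apply Dt. }
    assert (Sv : smooth_on b Om (dir v f)) by now apply smooth_dir.
    assert (Sw : smooth_on b Om (dir w f)) by now apply smooth_dir.
    pose proof (Schwarz (G f) 0 0) as Sch.
    transitivity (G (dir v (dir w f)) 0 0); [unfold G; now rewrite q0|].
    transitivity (G (dir w (dir v f)) 0 0); [|unfold G; now rewrite q0].
    rewrite <- Ds, <- Dt, <- E1, <- E2. apply Sch; clear Sch.
    - assert (L : locally (0, 0) (fun z : R2 => Om (q (fst z) (snd z)))).
      { apply (Hq Om). cbn [fst snd]. rewrite q0. now apply HOm. }
      apply locally_2d_locally. generalize L. apply filter_imp. intros [s t] Hst. cbn in Hst |- *.
      repeat split.
      + now apply Eds. + now apply Edt.
      + apply (ex_derive_ext (fun s => G (dir w f) s t)); [intros; now rewrite Dt|]. now apply Eds.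
      + apply (ex_derive_ext (fun t => G (dir v f) s t)); [intros; now rewrite Ds|]. now apply Edt.
    - replace (fun u v0 : R => Derive (fun z => Derive (fun t => G f z t) v0) u) with (G (dir v (dir w f))).
      + apply Cd. now apply smooth_dir.
      + extensionality s. extensionality t.
        rewrite <- Ds. apply Derive_ext. intros. now rewrite Dt.
    - replace (fun u v0 : R => Derive (fun z => Derive (fun t => G f t z) u) v0) with (G (dir w (dir v f))).
      + apply Cd. now apply smooth_dir.
      + extensionality s. extensionality t.
        rewrite <- Dt. apply Derive_ext. intros. now rewrite Ds. }
  apply injective_projections; apply X; auto.
Qed.

(** Only a swap of two adjacent directions needs analysis. Under an outer derivative the equality
    has to hold in a neighbourhood, hence on an open set. *)
Lemma dirs_perm f l l' : smooth_on b Om f -> Permutation l l' -> incl l b ->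
  forall p, Om p -> dirs l f p = dirs l' f p.
Proof.
  intros Hf HP. induction HP as [|x l l' HP IH|x y l|l l' l'' H1 IH1 H2 IH2]; intros Hl p Hp.
  - reflexivity.
  - cbn. apply dir_ext_loc. generalize (HOm p Hp). apply filter_imp. intros q Hq.
    apply IH; auto. intros z Hz. apply Hl. now right.
  - cbn. apply dir_comm; auto.
    + apply smooth_on_dirs; auto. intros z Hz. apply Hl. now right; right.
    + apply Hl. now left.
    + apply Hl. right; now left.
  - rewrite IH1 by auto. apply IH2; auto. intros z Hz. apply Hl.
    apply Permutation_in with l'; auto. now apply Permutation_sym.
Qed.

Lemma derivable_plus v f g p : derivable_along v f p -> derivable_along v g p ->
  derivable_along v (fun q => (f q + g q)%C) p /\
  dir v (fun q => (f q + g q)%C) p = (dir v f p + dir v g p)%C.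
Proof.
  intros H1 H2. apply derivable_cder in H1. apply derivable_cder in H2.
  apply cder_derivable. exact (cder_plus _ _ _ _ _ H1 H2).
Qed.

Lemma derivable_scal v f c p : derivable_along v f p ->
  derivable_along v (fun q => (c * f q)%C) p /\ dir v (fun q => (c * f q)%C) p = (c * dir v f p)%C.
Proof.
  intros H1. apply derivable_cder in H1. apply cder_derivable. exact (cder_scal c _ _ _ H1).
Qed.

Lemma dirs_plus f g l : smooth_on b Om f -> smooth_on b Om g -> incl l b ->
  forall p, Om p -> dirs l (fun q => (f q + g q)%C) p = (dirs l f p + dirs l g p)%C.
Proof.
  intros Hf Hg. induction l as [|v l IH]; intros Hl p Hp; [reflexivity|]. cbn.
  assert (Hl' : incl l b) by (intros z Hz; apply Hl; now right).
  assert (Hv : In v b) by (apply Hl; now left).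
  rewrite (dir_ext_loc v _ (fun q => (dirs l f q + dirs l g q)%C)).
  - apply derivable_plus.
    + apply (Hf l Hl' p Hp); auto.
    + apply (Hg l Hl' p Hp); auto.
  - generalize (HOm p Hp). apply filter_imp. intros q Hq. now apply IH.
Qed.

Lemma dirs_scal f c l : smooth_on b Om f -> incl l b ->
  forall p, Om p -> dirs l (fun q => (c * f q)%C) p = (c * dirs l f p)%C.
Proof.
  intros Hf. induction l as [|v l IH]; intros Hl p Hp; [reflexivity|]. cbn.
  assert (Hl' : incl l b) by (intros z Hz; apply Hl; now right).
  assert (Hv : In v b) by (apply Hl; now left).
  rewrite (dir_ext_loc v _ (fun q => (c * dirs l f q)%C)).
  - apply derivable_scal. apply (Hf l Hl' p Hp); auto.
  - generalize (HOm p Hp). apply filter_imp. intros q Hq. now apply IH.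
Qed.

Lemma smooth_plus f g : smooth_on b Om f -> smooth_on b Om g -> smooth_on b Om (fun q => (f q + g q)%C).
Proof.
  intros Hf Hg l Hl p Hp.
  assert (E : locally p (fun q => (dirs l f q + dirs l g q)%C = dirs l (fun q => (f q + g q)%C) q)).
  { generalize (HOm p Hp). apply filter_imp. intros q Hq. symmetry. now apply dirs_plus. }
  destruct (Hf l Hl p Hp) as [C1 D1], (Hg l Hl p Hp) as [C2 D2]. split.
  - eapply continuous_ext_loc; [exact E|]. now apply continuous_Cplus.
  - intros v Hv. eapply derivable_ext_loc; [exact E|]. apply derivable_plus; auto.
Qed.

Lemma smooth_scal f c : smooth_on b Om f -> smooth_on b Om (fun q => (c * f q)%C).
Proof.
  intros Hf l Hl p Hp.
  assert (E : locally p (fun q => (c * dirs l f q)%C = dirs l (fun q => (c * f q)%C) q)).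
  { generalize (HOm p Hp). apply filter_imp. intros q Hq. symmetry. now apply dirs_scal. }
  destruct (Hf l Hl p Hp) as [C1 D1]. split.
  - eapply continuous_ext_loc; [exact E|]. apply continuous_Cmult; auto. apply continuous_const.
  - intros v Hv. eapply derivable_ext_loc; [exact E|]. apply derivable_scal; auto.
Qed.
End Smooth.

Lemma two_PI_pos : 0 < 2 * PI.
Proof. pose proof PI_RGT_0. lra. Qed.

(** * Compactness of the torus *)

(** The tube lemma at [s = 0] for [s * f t w]. *)
Lemma compact_bounded (T : UniformSpace) (f : T -> R -> R) t0 a b :
  (forall w, continuous (fun p : T * R => f (fst p) (snd p)) (t0, w)) ->
  exists K, 0 <= K /\ locally t0 (fun t => forall w, a <= w <= b -> Rabs (f t w) <= K).
Proof.
  intros H.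
  pose proof (tube (T := prod_UniformSpace R_UniformSpace T) a b
    (fun st w => Rabs (fst st * f (snd st) w) <= 1) (0, t0)) as L.
  destruct L as [d Hd].
  - intros w _.
    assert (C : continuous (fun p : (R * T) * R => fst (fst p) * f (snd (fst p)) (snd p)) (0, t0, w)).
    { apply continuous_Rmult; [cts|].
      apply (continuous_comp (fun p : (R * T) * R => (snd (fst p), snd p)) (fun p : T * R => f (fst p) (snd p))).
      - apply continuous_pair; cts.
      - apply H. }
    specialize (C _ (locally_ball _ (mkposreal 1 Rlt_0_1))). unfold filtermap in C.
    generalize C. apply filter_imp. intros [[s t] v] Hv.
    change (Rabs (s * f t v - 0 * f t0 w) < 1) in Hv. cbn.
    rewrite Rmult_0_l, Rminus_0_r in Hv. lra.
  - pose proof (cond_pos d). exists (2 / d). split.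
    { apply Rlt_le, Rdiv_lt_0_compat; lra. }
    exists d. intros t Ht w Hw.
    specialize (Hd (d / 2, t)). cbn in Hd.
    assert (B : Rabs (d / 2 * f t w) <= 1).
    { apply Hd; auto. split; auto. change (Rabs (d / 2 - 0) < d).
      rewrite Rminus_0_r, Rabs_pos_eq; lra. }
    rewrite Rabs_mult, (Rabs_pos_eq (d / 2)) in B by lra.
    apply Rle_div_r; [lra|]. lra.
Qed.

Lemma period_reduce x : exists x0, 0 <= x0 <= 2 * PI /\ exists k : Z, x = x0 + IZR k * (2 * PI).
Proof.
  pose proof two_PI_pos as P.
  exists (x - IZR (Int_part (x / (2 * PI))) * (2 * PI)). split.
  - pose proof (base_fp (x / (2 * PI))) as [H1 H2]. unfold frac_part in *.
    assert (E : x = x / (2 * PI) * (2 * PI)) by (field; lra).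
    set (k := IZR (Int_part (x / (2 * PI)))) in *. set (y := x / (2 * PI)) in *. nra.
  - exists (Int_part (x / (2 * PI))). ring.
Qed.

Lemma period_Z (f : R -> C) : (forall x, f (x + 2 * PI) = f x) ->
  forall (k : Z) x, f (x + IZR k * (2 * PI)) = f x.
Proof.
  intros H.
  assert (N : forall (n : nat) x, f (x + INR n * (2 * PI)) = f x).
  { induction n as [|n IH]; intros x.
    - cbn. f_equal. ring.
    - rewrite S_INR. replace (x + (INR n + 1) * (2 * PI)) with (x + INR n * (2 * PI) + 2 * PI) by ring.
      now rewrite H. }
  intros k x. destruct (Z.le_ge_cases 0 k) as [Hk|Hk].
  - rewrite <- (Z2Nat.id k Hk), <- INR_IZR_INZ. apply N.
  - rewrite <- (N (Z.to_nat (- k)) (x + IZR k * (2 * PI))).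
    f_equal. rewrite INR_IZR_INZ, Z2Nat.id by lia. rewrite opp_IZR. ring.
Qed.

Definition in_box (q : R2) : Prop := 0 <= fst q <= 2 * PI /\ 0 <= snd q <= 2 * PI.

Lemma periodic_reduce (p : R2) : exists q, in_box q /\ forall f, periodic f -> f p = f q.
Proof.
  destruct p as [x y].
  destruct (period_reduce x) as [x0 [Hx [k Ex]]], (period_reduce y) as [y0 [Hy [l Ey]]].
  exists (x0, y0). split; [split; auto|]. intros f Hf. subst x y.
  rewrite (period_Z (fun x => f (x, y0 + IZR l * (2 * PI))) (fun x => proj1 (Hf x _)) k x0).
  exact (period_Z (fun y => f (x0, y)) (fun y => proj2 (Hf x0 y)) l y0).
Qed.

Lemma tube2 {T : UniformSpace} (Q : T -> R2 -> Prop) (t0 : T) :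
  (forall x, locally (t0, x) (fun p => Q (fst p) (snd p))) ->
  locally t0 (fun t => forall x, in_box x -> Q t x).
Proof.
  intros H.
  assert (L : locally t0 (fun t => forall u, 0 <= u <= 2 * PI -> forall w, 0 <= w <= 2 * PI -> Q t (u, w))).
  { apply (tube 0 (2 * PI) (fun t u => forall w, 0 <= w <= 2 * PI -> Q t (u, w))). intros u _.
    apply (tube (T := prod_UniformSpace T R_UniformSpace) 0 (2 * PI) (fun tu w => Q (fst tu) (snd tu, w))).
    intros w _. destruct (H (u, w)) as [d Hd]. exists d. intros [[t u'] w'] [[H1 H2] H3].
    apply (Hd (t, (u', w'))). split; [exact H1|split; [exact H2|exact H3]]. }
  generalize L. apply filter_imp. intros t Ht [u w] [Hu Hw]. now apply Ht.
Qed.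

(** On the compact box of one period this is the tube lemma in two variables; periodicity of [g t],
    needed only for t near [t0], carries the estimate to all of the plane. *)
Lemma torus_uniform {T : UniformSpace} (g : T -> R2 -> C) (t0 : T) :
  locally t0 (fun t => periodic (g t)) ->
  (forall x, continuous (fun p : T * R2 => g (fst p) (snd p)) (t0, x)) ->
  forall e, 0 < e -> locally t0 (fun t => forall x, Cmod (g t x - g t0 x)%C < e).
Proof.
  intros Hp Hc e He.
  assert (L : locally t0 (fun t => forall x, in_box x -> Cmod (g t x - g t0 x)%C < e)).
  { apply (tube2 (fun t x => Cmod (g t x - g t0 x)%C < e)). intros x.
    pose proof (proj1 (C_continuous _ _) (Hc x) (e / 2) ltac:(lra)) as H1. cbn in H1.
    assert (C2 : continuous (fun p : T * R2 => g t0 (snd p)) (t0, x)).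
    { apply (continuous_comp (fun p : T * R2 => (t0, snd p)) (fun p : T * R2 => g (fst p) (snd p))).
      - apply continuous_pair; cts.
      - apply Hc. }
    pose proof (proj1 (C_continuous _ _) C2 (e / 2) ltac:(lra)) as H2. cbn in H2.
    generalize (filter_and _ _ H1 H2). apply filter_imp. intros [t y] [E1 E2]. cbn in *.
    replace (g t y - g t0 y)%C with ((g t y - g t0 x) - (g t0 y - g t0 x))%C by ring.
    eapply Rle_lt_trans; [apply Cmod_triangle|]. rewrite Cmod_opp. lra. }
  pose proof (locally_singleton _ _ Hp) as Hp0.
  generalize (filter_and _ _ L Hp). apply filter_imp. intros t [Ht Htp] x.
  destruct (periodic_reduce x) as [q [Hq E]]. rewrite (E _ Htp), (E _ Hp0). auto.
Qed.

(** Uniform continuity at t = 0 of the family t * f: if |t f| < 1 everywhere for t = d / 2, then |f|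
    is at most 2 / d. *)
Lemma torus_bounded (f : R2 -> C) : periodic f -> (forall x, continuous f x) ->
  exists K, forall x, Cmod (f x) <= K.
Proof.
  intros Hp Hc.
  assert (L : locally (0 : R) (fun t => forall x, Cmod (t * f x - 0 * f x)%C < 1)).
  { apply (torus_uniform (fun (t : R) x => (t * f x)%C) 0).
    - apply filter_forall. intros t x y. now rewrite (proj1 (Hp x y)), (proj2 (Hp x y)).
    - intros x. apply continuous_Cmult; [cts|].
      apply (continuous_comp (fun p : R * R2 => snd p) f); [cts|apply Hc].
    - lra. }
  destruct L as [d Hd]. pose proof (cond_pos d). exists (2 / d). intros x.
  assert (B : Cmod (RtoC (d / 2) * f x - 0 * f x)%C < 1).
  { apply Hd. change (Rabs (d / 2 - 0) < d). rewrite Rminus_0_r, Rabs_pos_eq; lra. }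
  replace (RtoC (d / 2) * f x - 0 * f x)%C with (RtoC (d / 2) * f x)%C in B by ring.
  rewrite Cmod_mult, Cmod_R, (Rabs_pos_eq (d / 2)) in B by lra.
  apply Rle_div_r; lra.
Qed.

(** * Symmetric sums *)

Definition symsum (N : nat) (a : Z -> C) : C :=
  csum (2 * N + 1) (fun k => a (Z.of_nat k - Z.of_nat N)%Z).

Lemma csum_ext n f g : (forall k, f k = g k) -> csum n f = csum n g.
Proof. intros H. induction n; cbn; congruence. Qed.

Lemma csum_head n f : csum (S n) f = (f 0%nat + csum n (fun k => f (S k)))%C.
Proof.
  induction n as [|n IH]; [cbn; ring|].
  change (csum (S (S n)) f) with (csum (S n) f + f (S n))%C. rewrite IH. cbn. ring.
Qed.

Lemma symsum_0 a : symsum 0 a = a 0%Z.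
Proof. unfold symsum. cbn. ring. Qed.

Lemma symsum_S N a : symsum (S N) a = (symsum N a + (a (Z.of_nat (S N)) + a (- Z.of_nat (S N))%Z))%C.
Proof.
  unfold symsum. replace (2 * S N + 1)%nat with (S (S (2 * N + 1))) by lia.
  rewrite csum_head. cbn [csum].
  rewrite (csum_ext _ _ (fun k => a (Z.of_nat k - Z.of_nat N)%Z)) by (intros k; f_equal; lia).
  replace (Z.of_nat 0 - Z.of_nat (S N))%Z with (- Z.of_nat (S N))%Z by lia.
  replace (Z.of_nat (S (2 * N + 1)) - Z.of_nat (S N))%Z with (Z.of_nat (S N)) by lia. ring.
Qed.

Lemma symsum_ext N a b : (forall k, a k = b k) -> symsum N a = symsum N b.
Proof. intros H. unfold symsum. apply csum_ext. auto. Qed.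

Lemma csum_plus n f g : csum n (fun k => f k + g k)%C = (csum n f + csum n g)%C.
Proof. induction n as [|n IH]; cbn; [ring|rewrite IH; ring]. Qed.

Lemma csum_scal n c f : csum n (fun k => c * f k)%C = (c * csum n f)%C.
Proof. induction n as [|n IH]; cbn; [ring|rewrite IH; ring]. Qed.

Lemma csum_exchange n m (f : nat -> nat -> C) :
  csum n (fun k => csum m (fun l => f k l)) = csum m (fun l => csum n (fun k => f k l)).
Proof.
  induction n as [|n IH]; cbn.
  - induction m as [|m IHm]; cbn; [reflexivity|rewrite <- IHm; ring].
  - rewrite IH. now rewrite <- csum_plus.
Qed.

Lemma symsum_exchange N M (a : Z -> Z -> C) :
  symsum N (fun k => symsum M (fun l => a k l)) = symsum M (fun l => symsum N (fun k => a k l)).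
Proof. unfold symsum. apply csum_exchange. Qed.

Lemma symsum_scal N c a : symsum N (fun k => c * a k)%C = (c * symsum N a)%C.
Proof. apply csum_scal. Qed.

Lemma symsum_minus N a b : symsum N (fun k => a k - b k)%C = (symsum N a - symsum N b)%C.
Proof.
  transitivity (symsum N (fun k => a k + (-1) * b k)%C); [apply symsum_ext; intros; ring|].
  unfold symsum at 1. rewrite csum_plus. 
  change (symsum N a + symsum N (fun k => (-1) * b k)%C = symsum N a - symsum N b)%C.
  rewrite symsum_scal. ring.
Qed.

Lemma symsum_delta N m (x : C) :
  symsum N (fun k => if Z.eq_dec k m then x else 0%C) = if Z_le_dec (Z.abs m) (Z.of_nat N) then x else 0%C.
Proof.
  induction N as [|N IH].
  - rewrite symsum_0. destruct (Z.eq_dec 0 m), (Z_le_dec (Z.abs m) (Z.of_nat 0)); auto; lia.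
  - rewrite symsum_S, IH.
    destruct (Z_le_dec (Z.abs m) (Z.of_nat N)), (Z_le_dec (Z.abs m) (Z.of_nat (S N))),
      (Z.eq_dec (Z.of_nat (S N)) m), (Z.eq_dec (- Z.of_nat (S N)) m); try lia; ring.
Qed.

Definition inv_succ (n : nat) : R := / (INR n + 1).

Lemma inv_succ_pos n : 0 < inv_succ n.
Proof. apply Rinv_0_lt_compat. pose proof (pos_INR n). lra. Qed.

(** The quadratic decay is compared with 1 / ((x + 1) (x + 2)), whose sums telescope; [inv_succ]
    thereby serves as an explicit rate for all Fourier tails. *)
Lemma bump_telescope n : bump (INR (S n)) <= 2 * (inv_succ n - inv_succ (S n)).
Proof.
  unfold bump, inv_succ. rewrite !S_INR. set (x := INR n). assert (0 <= x) by apply pos_INR.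
  replace (2 * (/ (x + 1) - / (x + 1 + 1))) with (/ ((x + 1) * (x + 2) / 2)) by (field; lra).
  apply Rinv_le_contravar; nra.
Qed.

Lemma bump_even x : bump (- x) = bump x.
Proof. unfold bump. f_equal. ring. Qed.

Lemma IZR_opp_nat n : IZR (- Z.of_nat n) = - INR n.
Proof. now rewrite opp_IZR, <- INR_IZR_INZ. Qed.

(** Each step adds the two terms of index n and -n, each at most 2 K times the telescoping
    difference. *)
Lemma symsum_cauchy K a N M : 0 <= K -> (forall k, Cmod (a k) <= K * bump (IZR k)) -> (N <= M)%nat ->
  Cmod (symsum M a - symsum N a)%C <= 4 * K * (inv_succ N - inv_succ M).
Proof.
  intros HK Ha. induction 1 as [|M HM IH].
  - unfold Cminus. rewrite Cplus_opp_r, Cmod_0. lra.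
  - rewrite symsum_S.
    replace (symsum M a + (a (Z.of_nat (S M)) + a (- Z.of_nat (S M))%Z) - symsum N a)%C
      with ((symsum M a - symsum N a) + (a (Z.of_nat (S M)) + a (- Z.of_nat (S M))%Z))%C by ring.
    eapply Rle_trans; [apply Cmod_triangle|].
    pose proof (Cmod_triangle (a (Z.of_nat (S M))) (a (- Z.of_nat (S M))%Z)) as T.
    pose proof (Ha (Z.of_nat (S M))) as A1. pose proof (Ha (- Z.of_nat (S M))%Z) as A2.
    rewrite IZR_opp_nat, bump_even in A2. rewrite <- INR_IZR_INZ in A1.
    pose proof (bump_telescope M). nra.
Qed.

(** The constant 5 is 1 for the central term plus 4 for the tail from 0. The bound does not depend
    on N, so double sums cost 25. *)
Lemma symsum_bound K a N : 0 <= K -> (forall k, Cmod (a k) <= K * bump (IZR k)) ->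
  Cmod (symsum N a) <= 5 * K.
Proof.
  intros HK Ha. pose proof (symsum_cauchy K a 0 N HK Ha (Nat.le_0_l N)) as H.
  rewrite symsum_0 in H. pose proof (Ha 0%Z) as H0.
  eapply Rle_trans; [apply (Cmod_minus_le _ (a 0%Z))|].
  pose proof (inv_succ_pos N). pose proof (bump_le1 0). 
  assert (E : inv_succ 0 = 1) by (unfold inv_succ; cbn; field). rewrite E in H. nra.
Qed.

Lemma inv_succ_small e : 0 < e -> exists N, forall n, (N <= n)%nat -> inv_succ n < e.
Proof.
  intros He. destruct (INR_unbounded (/ e)) as [N HN]. exists N. intros n Hn.
  unfold inv_succ. rewrite <- (Rinv_inv e). apply le_INR in Hn.
  assert (0 < / e) by now apply Rinv_0_lt_compat.
  apply Rinv_lt_contravar; [apply Rmult_lt_0_compat; lra|lra].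
Qed.

(** * Fourier series of one variable *)

Definition per (h : R -> C) : Prop := forall t, h (t + 2 * PI) = h t.

Definition coef (h : R -> C) (m : Z) : C :=
  (/ RtoC (2 * PI) * CInt (fun t => h t * cis (- (t * IZR m)))%C 0 (2 * PI))%C.

Lemma RtoC_2PI_neq : RtoC (2 * PI) <> 0%C.
Proof. intros E. apply RtoC_inj in E. pose proof two_PI_pos. lra. Qed.

Lemma cis_2PI_Z (k : Z) t : cis (t + IZR k * (2 * PI)) = cis t.
Proof.
  apply (period_Z cis). intros x. unfold cis.
  now rewrite cos_plus, sin_plus, cos_2PI, sin_2PI, !Rmult_1_r, !Rmult_0_r, Rminus_0_r, Rplus_0_r.
Qed.

Lemma per_cis m : per (fun t => cis (- (t * IZR m))).
Proof.
  intros t. rewrite <- (cis_2PI_Z (- m) (- (t * IZR m))). f_equal. rewrite opp_IZR. ring.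
Qed.

Lemma per_mult f g : per f -> per g -> per (fun t => f t * g t)%C.
Proof. intros Hf Hg t. now rewrite Hf, Hg. Qed.

Lemma continuous_mult_cis (h : R -> C) a : (forall t, continuous h t) ->
  forall t, continuous (fun t => h t * cis (- (t * a)))%C t.
Proof. intros H t. apply continuous_Cmult; auto. cts. Qed.

Lemma CInt_translate f b x y : (forall t, continuous f t) ->
  CInt (fun t => f (t + b)) x y = CInt f (x + b) (y + b).
Proof.
  intros Hf. pose proof (CInt_affine f 1 b x y) as A. rewrite !Rmult_1_l, Cmult_1_l in A.
  rewrite A by (auto; lra). f_equal. extensionality t. f_equal. ring.
Qed.

Lemma CInt_per f a : (forall t, continuous f t) -> per f -> CInt f a (a + 2 * PI) = CInt f 0 (2 * PI).
Proof.
  intros Hf Hp. rewrite <- (CInt_Chasles f a 0 _) by auto.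
  rewrite <- (CInt_Chasles f 0 (2 * PI) (a + 2 * PI)) by auto.
  assert (E : CInt f (2 * PI) (a + 2 * PI) = CInt f 0 a).
  { replace (2 * PI) with (0 + 2 * PI) at 1 by ring. rewrite <- CInt_translate by auto.
    f_equal. apply functional_extensionality. exact Hp. }
  rewrite E. rewrite <- (Cplus_0_l (CInt f 0 (2 * PI))) at 2.
  assert (E2 : (CInt f a 0 + CInt f 0 a)%C = 0%C).
  { rewrite CInt_Chasles by auto. apply CInt_unique.
    apply (is_RInt_point (V := C_R_CompleteNormedModule)). }
  rewrite <- E2. ring.
Qed.

(** Multiplication by 1 + cos only mixes the frequencies m - 1, m, m + 1, so orthogonality to all
    exponentials is inherited by every power of 1 + cos. *)
Lemma cis_half t (m : Z) : (RtoC (1 + cos t)%R * cis (- (t * IZR m)) =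
  cis (- (t * IZR m)) + RtoC (/2) * (cis (- (t * IZR (m - 1))) + cis (- (t * IZR (m + 1)))))%C.
Proof.
  rewrite minus_IZR, plus_IZR.
  replace (- (t * (IZR m - 1))) with (- (t * IZR m) + t) by ring.
  replace (- (t * (IZR m + 1))) with (- (t * IZR m) + - t) by ring.
  rewrite !cis_plus. set (z := cis (- (t * IZR m))).
  unfold cis. rewrite cos_neg, sin_neg. destruct z as [x y].
  unfold Cplus, Cmult, RtoC; cbn. f_equal; field.
Qed.

(** A continuous function all of whose Fourier coefficients vanish is orthogonal to the
    powers of [1 + cos], which concentrate at 0. *)
Lemma fourier_unique_0 (h : R -> C) : (forall t, continuous h t) ->
  (forall m, CInt (fun t => h t * cis (- (t * IZR m)))%C (- PI) PI = 0%C) -> h 0 = 0%C.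
Proof.
  intros Hc H0.
  set (T := fun n t => ((1 + cos t) / 2) ^ n).
  assert (HT : forall n t, continuous (T n) t).
  { intros n t. apply (ex_derive_continuous (V := R_NormedModule)). unfold T. auto_derive. auto. }
  (* The claim is made for all frequencies m at once, since the induction on the power shifts m by
     one on either side. *)
  assert (O : forall n m, CInt (fun t => h t * RtoC (T n t) * cis (- (t * IZR m)))%C (- PI) PI = 0%C).
  { induction n as [|n IH]; intros m.
    - rewrite <- (H0 m). f_equal. extensionality t. unfold T. cbn [pow]. ring.
    - transitivity (CInt (fun t => RtoC (/2) * (h t * RtoC (T n t) * cis (- (t * IZR m)) +
        RtoC (/2) * (h t * RtoC (T n t) * cis (- (t * IZR (m - 1))) + h t * RtoC (T n t) * cis (- (t * IZR (m + 1))))))%C (- PI) PI).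
      + f_equal. extensionality t.
        assert (E : T (S n) t = / 2 * T n t * (1 + cos t)) by (unfold T; cbn [pow]; field).
        rewrite E, !RtoC_mult.
        replace (h t * (RtoC (/2) * RtoC (T n t) * RtoC (1 + cos t)%R) * cis (- (t * IZR m)))%C
          with (RtoC (/2) * (h t * RtoC (T n t)) * (RtoC (1 + cos t)%R * cis (- (t * IZR m))))%C by ring.
        rewrite cis_half. ring.
      + assert (W : forall k, forall t, continuous (fun t => h t * RtoC (T n t) * cis (- (t * IZR k)))%C t).
        { intros k. apply continuous_mult_cis. intros t. apply continuous_Cmult; auto. apply continuous_RtoC. apply HT. }
        rewrite CInt_scal, CInt_plus, CInt_scal, CInt_plus, !IH; auto.
        * ring.
        * intros t. apply continuous_Cplus; apply W.
        * intros t. apply continuous_Cmult; [cts|]. apply continuous_Cplus; apply W.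
        * intros t. apply continuous_Cplus; [apply W|]. apply continuous_Cmult; [cts|]. apply continuous_Cplus; apply W. }
  pose proof PI_RGT_0 as HPI.
  apply Cmod_small. intros e He.
  destruct (proj1 (C_continuous _ _) (Hc 0) e He) as [[d0 Hd0] Hd].
  (* The bound 1 keeps d below PI, where the cosine decreases. *)
  set (d := Rmin d0 1). assert (d01 : 0 < d <= 1 /\ d <= d0).
  { unfold d. repeat split; [apply Rmin_pos; lra|apply Rmin_r|apply Rmin_l]. }
  destruct d01 as [[d1 d2] d3].
  pose proof PI2_1 as P2.
  destruct (compact_bounded R_UniformSpace (fun _ t => Cmod (h t - h 0)%C) 0 (- PI) PI) as [B [HB0 HB]].
  { intros w. apply (continuous_comp (fun p : R * R => snd p) (fun t => Cmod (h t - h 0)%C)); [cts|].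
    apply (continuous_comp (fun t => (h t - h 0)%C) Cmod).
    - apply continuous_Cminus; auto. apply continuous_const.
    - apply (continuous_ext (fun z : C => @norm _ C_R_NormedModule z)); [intros; symmetry; apply Cmod_norm|].
      apply (filterlim_norm (K := R_AbsRing) (V := C_R_NormedModule)). }
  apply locally_singleton in HB.
  (* On |t| >= d the kernel is at most r^n, on |t| <= d / 2 it is at least s^n, and r < s: relative
     to its mass, the kernel is exponentially small away from 0. *)
  set (r := (1 + cos d) / 2). set (s := (1 + cos (d / 2)) / 2).
  assert (cosd : -1 < cos d).
  { rewrite <- cos_PI. apply cos_decreasing_1; lra. }
  assert (rs : 0 < r < s).
  { unfold r, s. split; [lra|].
    assert (cos d < cos (d / 2)) by (apply cos_decreasing_1; lra). lra. }
  assert (T0 : forall n t, 0 <= T n t).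
  { intros n t. unfold T. apply pow_le. pose proof (COS_bound t). lra. }
  assert (Tr : forall n t, - PI <= t <= PI -> d <= Rabs t -> T n t <= r ^ n).
  { intros n t Ht Hdt. unfold T, r. apply pow_incr. pose proof (COS_bound t). split; [lra|].
    assert (cos t <= cos d); [|lra].
    rewrite <- (Rabs_pos_eq d) by lra.
    assert (Ca : cos t = cos (Rabs t)) by (unfold Rabs; destruct Rcase_abs; [now rewrite cos_neg|auto]).
    rewrite Ca, (Rabs_pos_eq d) by lra. apply cos_decr_1; try lra.
    - unfold Rabs; destruct Rcase_abs; lra. }
  assert (Ts : forall n t, - (d / 2) <= t <= d / 2 -> s ^ n <= T n t).
  { intros n t Ht. unfold T, s. apply pow_incr. split; [unfold s in rs; lra|].
    assert (cos (d / 2) <= cos t); [|lra].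
    assert (Ca : cos t = cos (Rabs t)) by (unfold Rabs; destruct Rcase_abs; [now rewrite cos_neg|auto]).
    rewrite Ca. apply cos_decr_1; try lra; try apply Rabs_pos.
    - unfold Rabs; destruct Rcase_abs; lra.
    - unfold Rabs; destruct Rcase_abs; lra. }
  assert (exT : forall n a b, ex_RInt (T n) a b).
  { intros n a b. apply (ex_RInt_continuous (V := R_CompleteNormedModule)). intros; apply HT. }
  set (I := fun n => RInt (T n) (- PI) PI).
  assert (Ilow : forall n, d * s ^ n <= I n).
  { intros n. unfold I.
    rewrite <- (RInt_Chasles (V := R_CompleteNormedModule) (T n) (- PI) (- (d / 2)) PI) by auto.
    rewrite <- (RInt_Chasles (V := R_CompleteNormedModule) (T n) (- (d / 2)) (d / 2) PI) by auto.
    assert (0 <= RInt (T n) (- PI) (- (d / 2))) by (apply RInt_ge_0; auto; lra).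
    assert (0 <= RInt (T n) (d / 2) PI) by (apply RInt_ge_0; auto; lra).
    assert (M : RInt (fun _ => s ^ n) (- (d / 2)) (d / 2) <= RInt (T n) (- (d / 2)) (d / 2)).
    { apply RInt_le; auto; [lra|apply ex_RInt_const|]. intros t Ht. apply Ts. lra. }
    rewrite RInt_const in M. change (scal (d / 2 - - (d / 2)) (s ^ n)) with ((d / 2 - - (d / 2)) * s ^ n) in M.
    change (d * s ^ n <= RInt (T n) (- PI) (- (d / 2)) + (RInt (T n) (- (d / 2)) (d / 2) + RInt (T n) (d / 2) PI)). lra. }
  (* By orthogonality the integral of (h - h 0) T is -h(0) times the mass of T. It is estimated by e
     near 0, by continuity, and by B r^n elsewhere. *)
  assert (Main : forall n, Cmod (h 0) * I n <= e * I n + 2 * PI * (B * r ^ n)).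
  { intros n.
    assert (E : CInt (fun t => (h t - h 0) * RtoC (T n t))%C (- PI) PI = (- (h 0 * RtoC (I n)))%C).
    { transitivity (CInt (fun t => h t * RtoC (T n t) * cis (- (t * IZR 0)) - h 0 * RtoC (T n t))%C (- PI) PI).
      - f_equal. extensionality t. rewrite Rmult_0_r, Ropp_0, cis_0. ring.
      - rewrite CInt_minus, O, CInt_scal.
        + assert (E1 : CInt (fun t => RtoC (T n t)) (- PI) PI = RtoC (I n)).
          { apply CInt_unique. apply (is_RInt_fct_extend_pair (U := R_NormedModule) (V := R_NormedModule)
              (fun t => RtoC (T n t)) (- PI) PI (I n) 0).
            - apply (RInt_correct (V := R_CompleteNormedModule)). apply exT.
            - replace 0 with (scal (PI - - PI) 0) by apply (scal_zero_r (K := R_AbsRing) (V := R_NormedModule)).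
              apply (is_RInt_const (V := R_NormedModule)). }
          rewrite E1. ring.
        + intros t. apply continuous_RtoC. apply HT.
        + apply continuous_mult_cis. intros t. apply continuous_Cmult; auto. apply continuous_RtoC. apply HT.
        + intros t. apply continuous_Cmult; [apply continuous_const|]. apply continuous_RtoC. apply HT. }
    assert (In : 0 <= I n) by (apply RInt_ge_0; auto; lra).
    replace (Cmod (h 0) * I n) with (Cmod (CInt (fun t => (h t - h 0) * RtoC (T n t))%C (- PI) PI))
      by (rewrite E, Cmod_opp, Cmod_mult, Cmod_R, Rabs_pos_eq; auto).
    rewrite <- norm_Cmod.
    apply (norm_RInt_le (V := C_R_CompleteNormedModule) (fun t => (h t - h 0) * RtoC (T n t))%C
      (fun t => e * T n t + B * r ^ n) (- PI) PI); [lra| | |].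
    - intros t Ht. rewrite norm_Cmod, Cmod_mult, Cmod_R, (Rabs_pos_eq (T n t)) by auto.
      assert (Rn : 0 <= r ^ n) by (apply pow_le; lra).
      destruct (Rlt_or_le (Rabs t) d) as [L|L].
      + assert (Hh : Cmod (h t - h 0)%C < e).
        { apply Hd. change (Rabs (t - 0) < d0). rewrite Rminus_0_r. lra. }
        specialize (T0 n t). assert (0 <= B * r ^ n) by now apply Rmult_le_pos. nra.
      + specialize (HB t Ht). rewrite Rabs_pos_eq in HB by apply Cmod_ge_0.
        specialize (Tr n t Ht L). specialize (T0 n t). pose proof (Cmod_ge_0 (h t - h 0)%C).
        assert (Cmod (h t - h 0)%C * T n t <= B * r ^ n) by (apply Rmult_le_compat; auto). nra.
    - apply CInt_correct. intros t. apply continuous_Cmult.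
      + apply continuous_Cminus; auto. apply continuous_const.
      + apply continuous_RtoC. apply HT.
    - apply (is_RInt_plus (V := R_NormedModule)).
      + apply (is_RInt_scal (V := R_NormedModule)). apply (RInt_correct (V := R_CompleteNormedModule)). apply exT.
      + replace (2 * PI * (B * r ^ n)) with (scal (PI - - PI) (B * r ^ n))
          by (unfold scal; cbn; unfold mult; cbn; ring).
        apply (is_RInt_const (V := R_NormedModule)). }
  apply le_epsilon. intros e2 He2.
  (* After division by the mass, which is at least d s^n, the far part is a multiple of (r / s)^n.
     The summand 1 in [A] keeps it positive when B = 0. *)
  assert (Lim : exists n, 2 * PI * B / d * (r / s) ^ n < e2).
  { set (A := 2 * PI * B / d + 1).
    assert (A0 : 2 * PI * B / d < A) by (unfold A; lra).
    assert (A1 : 0 <= 2 * PI * B / d) by (apply Rdiv_le_0_compat; nra).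
    destruct (pow_lt_1_zero (r / s)) with (y := e2 / A) as [N HN].
    - rewrite Rabs_pos_eq; [apply Rlt_div_l; lra|apply Rdiv_le_0_compat; lra].
    - apply Rdiv_lt_0_compat; lra.
    - exists N. specialize (HN N (le_n _)).
      assert (P : 0 < (r / s) ^ N) by (apply pow_lt, Rdiv_lt_0_compat; lra).
      rewrite Rabs_pos_eq in HN by lra. apply Rlt_div_r in HN; [|lra]. nra. }
  destruct Lim as [n Hn]. specialize (Main n). specialize (Ilow n).
  assert (Sn : 0 < s ^ n) by (apply pow_lt; lra).
  assert (Rn : 0 < r ^ n) by (apply pow_lt; lra).
  assert (In : 0 < I n) by nra.
  unfold Rdiv in Hn at 2. rewrite Rpow_mult_distr, pow_inv in Hn.
  assert (X : 2 * PI * (B * r ^ n) <= e2 * (d * s ^ n)).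
  { replace (2 * PI * (B * r ^ n)) with (2 * PI * B / d * (r ^ n * / s ^ n) * (d * s ^ n)) by (field; lra).
    apply Rmult_le_compat_r; nra. }
  apply (Rmult_le_reg_r (I n)); auto. nra.
Qed.

(** A translation brings t0 to 0. It multiplies the Fourier coefficients by unimodular numbers, and
    periodicity moves the interval of integration to [-PI, PI]. *)
Lemma fourier_unique (h : R -> C) : (forall t, continuous h t) -> per h ->
  (forall m, coef h m = 0%C) -> forall t, h t = 0%C.
Proof.
  intros Hc Hp H t0.
  assert (Hz : forall m, CInt (fun t => h t * cis (- (t * IZR m)))%C 0 (2 * PI) = 0%C).
  { intros m. specialize (H m). unfold coef in H.
    rewrite <- (Cmult_1_l (CInt _ _ _)), <- (Cinv_r _ RtoC_2PI_neq), <- Cmult_assoc, H. ring. }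
  replace t0 with (0 + t0) at 1 by ring.
  apply (fourier_unique_0 (fun t => h (t + t0))).
  - intros t. apply (continuous_comp (fun t => t + t0) h); [cts|auto].
  - intros m.
    transitivity (CInt (fun t => cis (t0 * IZR m) * (fun t => h t * cis (- (t * IZR m))%R) (t + t0)%R)%C (- PI) PI).
    { f_equal. extensionality t. cbv beta.
      replace (cis (t0 * IZR m) * (h (t + t0)%R * cis (- ((t + t0) * IZR m))%R))%C
        with (h (t + t0)%R * (cis (t0 * IZR m) * cis (- ((t + t0) * IZR m))%R))%C by ring.
      rewrite <- cis_plus. do 2 f_equal. ring. }
    assert (W : forall t, continuous (fun t => h t * cis (- (t * IZR m)))%C t) by now apply continuous_mult_cis.
    rewrite CInt_scal, (CInt_translate (fun t => h t * cis (- (t * IZR m)))%C) by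
      first [exact W | intros t; apply (continuous_comp (fun t => t + t0) (fun t => h t * cis (- (t * IZR m)))%C); [cts|apply W]].
    replace (PI + t0) with (- PI + t0 + 2 * PI) by ring.
    rewrite CInt_per, Hz; auto; [ring|]. apply per_mult; auto. apply per_cis.
Qed.

Lemma coef_minus (f g : R -> C) m : (forall t, continuous f t) -> (forall t, continuous g t) ->
  coef (fun t => f t - g t)%C m = (coef f m - coef g m)%C.
Proof.
  intros Hf Hg. unfold coef.
  replace (fun t : R => (f t - g t) * cis (- (t * IZR m)))%C
    with (fun t => f t * cis (- (t * IZR m)) - g t * cis (- (t * IZR m)))%C
    by (apply functional_extensionality; intros; ring).
  rewrite CInt_minus by now apply continuous_mult_cis. ring.
Qed.

Lemma coef_plus (f g : R -> C) m : (forall t, continuous f t) -> (forall t, continuous g t) ->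
  coef (fun t => f t + g t)%C m = (coef f m + coef g m)%C.
Proof.
  intros Hf Hg. unfold coef.
  replace (fun t : R => (f t + g t) * cis (- (t * IZR m)))%C
    with (fun t => f t * cis (- (t * IZR m)) + g t * cis (- (t * IZR m)))%C
    by (apply functional_extensionality; intros; ring).
  rewrite CInt_plus by now apply continuous_mult_cis. ring.
Qed.

Lemma coef_bound (f : R -> C) m M : (forall t, continuous f t) -> (forall t, Cmod (f t) <= M) -> Cmod (coef f m) <= M.
Proof.
  intros Hf HM. unfold coef. pose proof two_PI_pos.
  rewrite Cmod_mult, Cmod_inv by apply RtoC_2PI_neq. rewrite Cmod_R, Rabs_pos_eq by lra.
  apply (Rmult_le_reg_l (2 * PI)); [lra|]. rewrite <- Rmult_assoc, Rinv_r by lra. rewrite Rmult_1_l.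
  replace (2 * PI * M) with ((2 * PI - 0) * M) by ring.
  apply CInt_bound; [lra|now apply continuous_mult_cis|].
  intros t _. rewrite Cmod_mult, Cmod_cis, Rmult_1_r. auto.
Qed.

Lemma coef_cis a (k m : Z) :
  coef (fun t => a * cis (t * IZR k))%C m = if Z.eq_dec k m then a else 0%C.
Proof.
  unfold coef.
  replace (fun t => a * cis (t * IZR k) * cis (- (t * IZR m)))%C with (fun t => a * cis (IZR (k - m) * t + 0))%C.
  2:{ extensionality t. rewrite <- Cmult_assoc, <- cis_plus. do 2 f_equal.
      rewrite minus_IZR. ring. }
  rewrite CInt_scal by (intros t; cts).
  destruct (Z.eq_dec k m) as [->|N].
  - rewrite Z.sub_diag.
    rewrite (CInt_derive (fun t => RtoC t) (fun t => cis (0 * t + 0))).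
    + field. apply RtoC_2PI_neq.
    + intros t. rewrite Rmult_0_l, Rplus_0_l, cis_0. split; cbn [fst snd RtoC]; auto_derive; auto.
    + intros t. cts.
  - assert (Nz : RtoC (IZR (k - m)) <> 0%C).
    { intros E. apply RtoC_inj in E. apply eq_IZR in E. lia. }
    assert (Nz2 : (Ci * RtoC (IZR (k - m)))%C <> 0%C).
    { apply Cmult_neq_0; auto. intros E. injection E. lra. }
    rewrite (CInt_derive (fun t => / (Ci * RtoC (IZR (k - m))) * cis (IZR (k - m) * t + 0))%C).
    + replace (IZR (k - m) * (2 * PI) + 0) with (0 + IZR (k - m) * (2 * PI)) by ring.
      rewrite cis_2PI_Z, Rmult_0_r, Rplus_0_r. ring.
    + intros t.
      replace (cis (IZR (k - m) * t + 0)) with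
        (/ (Ci * RtoC (IZR (k - m))) * (Ci * RtoC (IZR (k - m)) * cis (IZR (k - m) * t + 0)))%C.
      * apply cder_scal. apply cder_cis.
      * rewrite Cmult_assoc, Cinv_l by auto. ring.
    + intros t. cts.
Qed.

Lemma continuous_csum {T : UniformSpace} n (f : nat -> T -> C) t : (forall k, continuous (f k) t) ->
  continuous (fun t => csum n (fun k => f k t)) t.
Proof.
  intros H. induction n as [|n IH]; cbn; [apply continuous_const|now apply continuous_Cplus].
Qed.

Lemma continuous_symsum {T : UniformSpace} N (f : Z -> T -> C) t : (forall k, continuous (f k) t) ->
  continuous (fun t => symsum N (fun k => f k t)) t.
Proof. intros H. unfold symsum. apply (continuous_csum _ (fun k => f (Z.of_nat k - Z.of_nat N)%Z)). auto. Qed.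

Lemma coef_csum n (f : nat -> R -> C) m : (forall k t, continuous (f k) t) ->
  coef (fun t => csum n (fun k => f k t)) m = csum n (fun k => coef (f k) m).
Proof.
  intros H. induction n as [|n IH]; cbn.
  - unfold coef. replace (fun t => 0 * cis (- (t * IZR m)))%C with (fun t => 0 * (0 * cis (- (t * IZR m))))%C.
    + rewrite CInt_scal; [ring|]. intros t. cts.
    + apply functional_extensionality. intros. ring.
  - rewrite coef_plus, IH; auto. intros t. now apply continuous_csum.
Qed.

Lemma coef_symsum N (a : Z -> C) m :
  coef (fun t => symsum N (fun k => a k * cis (t * IZR k)))%C m =
  if Z_le_dec (Z.abs m) (Z.of_nat N) then a m else 0%C.
Proof.
  unfold symsum at 1. rewrite (coef_csum _ (fun k t => a (Z.of_nat k - Z.of_nat N)%Z * cis (t * IZR (Z.of_nat k - Z.of_nat N)%Z))%C).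
  - rewrite (csum_ext _ _ (fun k => if Z.eq_dec (Z.of_nat k - Z.of_nat N) m then a m else 0%C)).
    + exact (symsum_delta N m (a m)).
    + intros k. rewrite coef_cis. destruct Z.eq_dec; congruence.
  - intros k t. cts.
Qed.

(** Summable coefficients make the partial sums converge uniformly to some [g], with the explicit
    rate. Then [g] is continuous, periodic and has the coefficients of [h], so uniqueness identifies
    the two. *)
Lemma fourier_inversion (h : R -> C) K : (forall t, continuous h t) -> per h -> 0 <= K ->
  (forall m, Cmod (coef h m) <= K * bump (IZR m)) ->
  forall N t, Cmod (h t - symsum N (fun m => coef h m * cis (t * IZR m)))%C <= 4 * K * inv_succ N.
Proof.
  intros Hc Hp HK HB.
  set (S := fun N t => symsum N (fun m => coef h m * cis (t * IZR m))%C).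
  assert (Hb : forall t m, Cmod (coef h m * cis (t * IZR m))%C <= K * bump (IZR m)).
  { intros t m. rewrite Cmod_mult, Cmod_cis, Rmult_1_r. auto. }
  assert (Sc : forall N M t, (N <= M)%nat -> Cmod (S M t - S N t)%C <= 4 * K * inv_succ N).
  { intros N M t HNM. eapply Rle_trans; [apply (symsum_cauchy K); auto|].
    pose proof (inv_succ_pos M). nra. }
  assert (K1 : 0 < 4 * K + 1) by lra.
  assert (Ex : forall t, exists g, forall N, Cmod (g - S N t)%C <= 4 * K * inv_succ N).
  { intros t.
    destruct (proj1 (filterlim_locally_cauchy (U := C_R_CompleteNormedModule) (F := eventually) (fun N => S N t))) as [g Hg].
    - intros e. destruct (inv_succ_small (e / (4 * K + 1))) as [N HN].
      { apply Rdiv_lt_0_compat; [apply cond_pos|lra]. }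
      assert (HN' : forall n, (N <= n)%nat -> 4 * K * inv_succ n < e).
      { intros n Hn. specialize (HN n Hn). apply Rlt_div_r in HN; [|lra]. pose proof (inv_succ_pos n). nra. }
      exists (fun n => (N <= n)%nat). split; [now exists N|].
      assert (W : forall u v, (N <= u)%nat -> (u <= v)%nat -> Cmod (S v t - S u t)%C < e).
      { intros u v Hu Hv. eapply Rle_lt_trans; [apply Sc; auto|auto]. }
      assert (W2 : forall u v, (N <= u)%nat -> (N <= v)%nat -> Cmod (S v t - S u t)%C < e).
      { intros u v Hu Hv. destruct (Nat.le_ge_cases u v); [now apply W|]. rewrite Cmod_minus_sym. now apply W. }
      intros u v Hu Hv. specialize (W2 u v Hu Hv). split.
      + change (Rabs (fst (S v t - S u t)%C) < e). eapply Rle_lt_trans; [apply Rabs_fst_Cmod|exact W2].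
      + change (Rabs (snd (S v t - S u t)%C) < e). eapply Rle_lt_trans; [apply Rabs_snd_Cmod|exact W2].
    - exists g. intros N. apply le_epsilon. intros e He.
      destruct (proj1 (C_filterlim eventually (fun N => S N t) g) Hg e He) as [M HM].
      set (L := Nat.max N M). specialize (HM L (Nat.le_max_r _ _)).
      replace (g - S N t)%C with ((g - S L t) + (S L t - S N t))%C by ring.
      eapply Rle_trans; [apply Cmod_triangle|]. rewrite (Cmod_minus_sym g).
      pose proof (Sc N L t (Nat.le_max_l _ _)). lra. }
  set (g := fun t => proj1_sig (constructive_indefinite_description _ (Ex t))).
  assert (Hg : forall t N, Cmod (g t - S N t)%C <= 4 * K * inv_succ N).
  { intros t N. unfold g. now destruct (constructive_indefinite_description _ (Ex t)). }
  assert (Sct : forall N t, continuous (S N) t).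
  { intros N t. apply (continuous_symsum N (fun m t => coef h m * cis (t * IZR m))%C). intros k. cts. }
  assert (small : forall e, 0 < e -> exists N, forall n, (N <= n)%nat -> 4 * K * inv_succ n < e).
  { intros e He. destruct (inv_succ_small (e / (4 * K + 1))) as [N HN]; [apply Rdiv_lt_0_compat; lra|].
    exists N. intros n Hn. specialize (HN n Hn). apply Rlt_div_r in HN; [|lra]. pose proof (inv_succ_pos n). nra. }
  assert (gc : forall t, continuous g t).
  { intros t. apply C_continuous. intros e He. destruct (small (e / 3)) as [N HN]; [lra|].
    specialize (HN N (le_n _)).
    generalize (proj1 (C_continuous _ _) (Sct N t) (e / 3) ltac:(lra)). apply filter_imp. intros s Hs.
    pose proof (Hg s N) as G1. pose proof (Hg t N) as G2. rewrite Cmod_minus_sym in G2.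
    replace (g s - g t)%C with ((g s - S N s) + ((S N s - S N t) + (S N t - g t)))%C by ring.
    eapply Rle_lt_trans; [apply Cmod_triangle|].
    pose proof (Cmod_triangle (S N s - S N t) (S N t - g t))%C. lra. }
  assert (gp : per g).
  { intros t. replace (g (t + 2 * PI)) with (g t + (g (t + 2 * PI)%R - g t))%C by ring.
    rewrite (Cmod_small (g (t + 2 * PI)%R - g t)%C); [ring|]. intros e He.
    destruct (small (e / 2)) as [N HN]; [lra|]. specialize (HN N (le_n _)).
    assert (E : S N (t + 2 * PI) = S N t).
    { apply symsum_ext. intros k. f_equal. rewrite <- (cis_2PI_Z k (t * IZR k)). f_equal. ring. }
    pose proof (Hg (t + 2 * PI) N) as G1. pose proof (Hg t N) as G2. rewrite Cmod_minus_sym in G2.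
    rewrite E in G1.
    replace (g (t + 2 * PI)%R - g t)%C with ((g (t + 2 * PI)%R - S N t) + (S N t - g t))%C by ring.
    eapply Rle_trans; [apply Cmod_triangle|]. lra. }
  assert (gh : forall t, h t = g t).
  { intros t. replace (h t) with (g t + (h t - g t))%C by ring.
    rewrite (fourier_unique (fun t => h t - g t)%C); [ring| | |].
    - intros s. now apply continuous_Cminus.
    - intros s. now rewrite Hp, gp.
    - intros m. rewrite coef_minus by auto. apply Cmod_small. intros e He.
      destruct (small e He) as [N0 HN]. set (N := Nat.max N0 (Z.to_nat (Z.abs m))).
      (* N exceeds |m|, so the partial sum already has the m-th coefficient of [h]; the distance to
         [g] bounds the remaining discrepancy. *)
      specialize (HN N (Nat.le_max_l _ _)).
      assert (E : coef (S N) m = coef h m).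
      { unfold S. rewrite coef_symsum. destruct Z_le_dec as [|Hn]; auto. exfalso. apply Hn.
        unfold N. lia. }
      rewrite <- E, <- coef_minus by auto. apply coef_bound.
      + intros s. now apply continuous_Cminus.
      + intros s. rewrite Cmod_minus_sym. pose proof (Hg s N). lra. }
  intros N t. rewrite gh. apply Hg.
Qed.

(** * Smooth functions on the torus *)

Lemma open_everywhere (T : UniformSpace) : open (@everywhere T).
Proof. intros x _. apply filter_forall. now intros. Qed.

Lemma e1_basis : In e1 basis2. Proof. now left. Qed.
Lemma e2_basis : In e2 basis2. Proof. right; now left. Qed.

Lemma plus_scal_R2 (x y t a b : R) : 
  plus ((x, y) : prod_NormedModule R_AbsRing R_NormedModule R_NormedModule)
    (scal t ((a, b) : prod_NormedModule R_AbsRing R_NormedModule R_NormedModule)) = (x + t * a, y + t * b).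
Proof. reflexivity. Qed.

Lemma plus_scal_e1 (w t : R) : 
  plus ((0, w) : prod_NormedModule R_AbsRing R_NormedModule R_NormedModule)
    (scal t (e1 : prod_NormedModule R_AbsRing R_NormedModule R_NormedModule)) = (t, w).
Proof. unfold e1. rewrite plus_scal_R2. f_equal; ring. Qed.

Lemma plus_scal_e2 (u t : R) : 
  plus ((u, 0) : prod_NormedModule R_AbsRing R_NormedModule R_NormedModule)
    (scal t (e2 : prod_NormedModule R_AbsRing R_NormedModule R_NormedModule)) = (u, t).
Proof. unfold e2. rewrite plus_scal_R2. f_equal; ring. Qed.

Lemma line_e1 (f : R2 -> C) w t : line f e1 (0, w) t = f (t, w).
Proof. unfold line. f_equal. apply plus_scal_e1. Qed.

Lemma line_e2 (f : R2 -> C) u t : line f e2 (u, 0) t = f (u, t).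
Proof. unfold line. f_equal. apply plus_scal_e2. Qed.

Lemma cder_e1 (f : R2 -> C) u w : derivable_along e1 f (u, w) ->
  cder (fun u => f (u, w)) u (dir e1 f (u, w)).
Proof.
  intros H. apply (cder_ext (line f e1 (0, w))); [intros; apply line_e1|].
  refine (eq_ind _ (fun q => cder (line f e1 (0, w)) u (dir e1 f q)) _ _ (plus_scal_e1 w u)).
  apply line_cder. exact (eq_ind_r (fun q => derivable_along e1 f q) H (plus_scal_e1 w u)).
Qed.

Lemma cder_e2 (f : R2 -> C) u w : derivable_along e2 f (u, w) ->
  cder (fun w => f (u, w)) w (dir e2 f (u, w)).
Proof.
  intros H. apply (cder_ext (line f e2 (u, 0))); [intros; apply line_e2|].
  refine (eq_ind _ (fun q => cder (line f e2 (u, 0)) w (dir e2 f q)) _ _ (plus_scal_e2 u w)).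
  apply line_cder. exact (eq_ind_r (fun q => derivable_along e2 f q) H (plus_scal_e2 u w)).
Qed.

Lemma periodic_dir v (f : R2 -> C) : periodic f -> periodic (dir v f).
Proof.
  intros H x y. unfold dir, line.
  assert (E1 : forall t : R, f (plus (x + 2 * PI, y) (scal t v)) = f (plus (x, y) (scal t v))).
  { intros t. destruct v as [v1 v2]. rewrite !plus_scal_R2.
    replace (x + 2 * PI + t * v1) with (x + t * v1 + 2 * PI) by ring. apply H. }
  assert (E2 : forall t : R, f (plus (x, y + 2 * PI) (scal t v)) = f (plus (x, y) (scal t v))).
  { intros t. destruct v as [v1 v2]. rewrite !plus_scal_R2.
    replace (y + 2 * PI + t * v2) with (y + t * v2 + 2 * PI) by ring. apply H. }
  split; (f_equal; apply Derive_ext; intros t; [rewrite ?E1, ?E2; reflexivity|rewrite ?E1, ?E2; reflexivity]).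
Qed.

Lemma periodic_dirs l (f : R2 -> C) : periodic f -> periodic (dirs l f).
Proof. intros H. induction l as [|v l IH]; cbn; auto using periodic_dir. Qed.

Lemma smooth_T2_dirs l f : incl l basis2 -> smooth_T2 f -> smooth_T2 (dirs l f).
Proof.
  intros Hl [H1 H2]. split; [now apply periodic_dirs|now apply smooth_on_dirs].
Qed.

Lemma smooth_T2_dir v f : In v basis2 -> smooth_T2 f -> smooth_T2 (dir v f).
Proof. intros Hv. apply (smooth_T2_dirs [v]). now apply incl_single. Qed.

Lemma smooth_T2_scal c f : smooth_T2 f -> smooth_T2 (fun x => (c * f x)%C).
Proof.
  intros [H1 H2]. split.
  - intros x y. now rewrite (proj1 (H1 x y)), (proj2 (H1 x y)).
  - apply smooth_scal; auto. apply open_everywhere.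
Qed.

Lemma smooth_T2_plus f g : smooth_T2 f -> smooth_T2 g -> smooth_T2 (fun x => (f x + g x)%C).
Proof.
  intros [H1 H2] [H3 H4]. split.
  - intros x y. now rewrite (proj1 (H1 x y)), (proj2 (H1 x y)), (proj1 (H3 x y)), (proj2 (H3 x y)).
  - apply smooth_plus; auto. apply open_everywhere.
Qed.

Lemma smooth_T2_minus f g : smooth_T2 f -> smooth_T2 g -> smooth_T2 (fun x => (f x - g x)%C).
Proof.
  intros Hf Hg. replace (fun x => (f x - g x)%C) with (fun x => (f x + (-1) * g x)%C).
  - apply smooth_T2_plus; auto. now apply smooth_T2_scal.
  - extensionality x. ring.
Qed.

Lemma smooth_T2_continuous f : smooth_T2 f -> forall x, continuous f x.
Proof. intros [_ H] x. now apply (smooth_continuous basis2 everywhere). Qed.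

Lemma smooth_T2_bounded f : smooth_T2 f -> exists K, forall x, Cmod (f x) <= K.
Proof. intros H. apply torus_bounded; [apply H|now apply smooth_T2_continuous]. Qed.

(** * Fourier series of two variables *)

Definition fcoef (f : R2 -> C) (m n : Z) : C := coef (fun x => coef (fun y => f (x, y)) n) m.

Lemma curry_dominated (f : R2 -> C) K : (forall x, continuous f x) -> (forall x, Cmod (f x) <= K) ->
  dominated2 (wt integral_T) K (fun u w => f (u, w)).
Proof.
  intros Hc HK. split.
  - intros p. apply (continuous_ext f); [now intros []|apply Hc].
  - intros u w. rewrite !wt_T, !Rmult_1_r. apply HK.
Qed.

(** Recasts the iterated coefficient as the abstract transform over a period, to which [FT_decay]
    applies. *)
Lemma fcoef_FT (f : R2 -> C) K m n : (forall x, continuous f x) -> (forall x, Cmod (f x) <= K) ->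
  fcoef f m n = (/ RtoC (2 * PI) * / RtoC (2 * PI) * FT integral_T (fun u w => f (u, w)) (IZR m) (IZR n))%C.
Proof.
  intros Hc HK. pose proof (curry_dominated f K Hc HK) as D.
  unfold fcoef, coef at 1, FT. rewrite <- Cmult_assoc. f_equal.
  assert (D1 : dominated2 (wt integral_T) K (fun u w => (f (u, w) * cis (- (w * IZR n)))%C)).
  { apply (dom2_mult integral_T K (fun u w => f (u, w)) (fun _ w => cis (- (w * IZR n)))); auto.
    - intros p. cts.
    - intros u w. rewrite Cmod_cis. lra. }
  pose proof (dom2_outer integral_T _ _ D1) as D2.
  assert (D3 : dominated (wt integral_T) (mass integral_T * K)
    (fun u => (integral_T (fun w => (f (u, w) * cis (- (w * IZR n)))%C) * cis (- (u * IZR m)))%C)).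
  { apply dom_mult; auto.
    - intros t. cts.
    - intros t. rewrite Cmod_cis. lra. }
  refine (eq_trans _ (II_scal integral_T _ _ (/ RtoC (2 * PI))%C D3)).
  rewrite integral_T_E. apply (f_equal (fun F => CInt F 0 (2 * PI))).
  extensionality u. unfold coef. rewrite integral_T_E. ring.
Qed.

Lemma curry_cis_dominated (f : R2 -> C) K a b : (forall x, continuous f x) -> (forall x, Cmod (f x) <= K) ->
  dominated2 (wt integral_T) K (fun u w => (f (u, w) * cis (- (u * a + w * b)))%C).
Proof.
  intros Hc HK. apply (dom2_mult integral_T K (fun u w => f (u, w)) (fun u w => cis (- (u * a + w * b)))).
  - now apply curry_dominated.
  - intros p. cts.
  - intros u w. rewrite Cmod_cis. lra.
Qed.

Lemma fcoef_II2 (f : R2 -> C) K m n : (forall x, continuous f x) -> (forall x, Cmod (f x) <= K) ->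
  fcoef f m n = (/ RtoC (2 * PI) * / RtoC (2 * PI) *
    II2 integral_T (fun u w => f (u, w) * cis (- (u * IZR m + w * IZR n)))%C)%C.
Proof.
  intros Hc HK. rewrite (fcoef_FT f K) by auto. f_equal.
  apply (FT_II2 integral_T K (fun u w => f (u, w))). now apply curry_dominated.
Qed.

Lemma fcoef_minus (f g : R2 -> C) K L m n : (forall x, continuous f x) -> (forall x, Cmod (f x) <= K) ->
  (forall x, continuous g x) -> (forall x, Cmod (g x) <= L) ->
  fcoef (fun x => f x - g x)%C m n = (fcoef f m n - fcoef g m n)%C.
Proof.
  intros Hf HK Hg HL.
  assert (Hfg : forall x, continuous (fun x => f x - g x)%C x) by (intros; now apply continuous_Cminus).
  assert (HKL : forall x, Cmod (f x - g x)%C <= K + L).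
  { intros x. unfold Cminus. eapply Rle_trans; [apply Cmod_triangle|]. rewrite Cmod_opp.
    specialize (HK x). specialize (HL x). lra. }
  rewrite (fcoef_II2 f K), (fcoef_II2 g L), (fcoef_II2 (fun x => f x - g x)%C (K + L)) by auto.
  pose proof (fun h B => curry_cis_dominated h B (IZR m) (IZR n)) as W.
  transitivity (/ RtoC (2 * PI) * / RtoC (2 * PI) * 
    (II2 integral_T (fun u w => f (u, w) * cis (- (u * IZR m + w * IZR n))
      + (-1) * (g (u, w) * cis (- (u * IZR m + w * IZR n)))))%C)%C.
  - apply (f_equal (Cmult _)), (f_equal (II2 _)).
    extensionality u. extensionality w. ring.
  - rewrite (II2_plus integral_T _ _ _ _ (W f K Hf HK) (dom2_scal integral_T _ (-1)%C _ (W g L Hg HL))).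
    pose proof (II2_scal integral_T _ (-1)%C _ (W g L Hg HL)) as E. cbv beta in E. rewrite E. ring.
Qed.

Lemma fcoef_bound (f : R2 -> C) K m n : (forall x, continuous f x) -> (forall x, Cmod (f x) <= K) ->
  Cmod (fcoef f m n) <= K.
Proof.
  intros Hc HK. rewrite (fcoef_II2 f K) by auto.
  pose proof two_PI_pos.
  rewrite !Cmod_mult, !Cmod_inv by apply RtoC_2PI_neq. rewrite Cmod_R, Rabs_pos_eq by lra.
  pose proof (II2_bound integral_T _ _ (curry_cis_dominated f K (IZR m) (IZR n) Hc HK)) as B.
  rewrite mass_T in B.
  apply Rle_trans with (/ (2 * PI) * / (2 * PI) * (2 * PI * (2 * PI) * K)).
  - apply Rmult_le_compat_l; auto. apply Rlt_le, Rmult_lt_0_compat; apply Rinv_0_lt_compat; lra.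
  - right. field. lra.
Qed.

(** [FT_decay] over a period, with a trivial index set and the smooth functions on the torus as the
    class. At integral frequencies the exponentials are periodic, so the boundary terms agree at the
    two ends. *)
Lemma fcoef_decay f p q : smooth_T2 f -> exists K, 0 <= K /\ forall m n,
  (1 + IZR m ^ 2) ^ p * (1 + IZR n ^ 2) ^ q * Cmod (fcoef f m n) <= K.
Proof.
  intros Hf.
  set (unc := fun (F : unit -> R -> R -> C) (x : R2) => F tt (fst x) (snd x)).
  destruct (FT_decay integral_T (Z := unit) (fun F => smooth_T2 (unc F))
    (fun F z u w => dir e1 (unc F) (u, w)) (fun F z u w => dir e2 (unc F) (u, w))
    (fun a => exists m, a = IZR m)) with (p := p) (q := q) (f := fun (_ : unit) u w => f (u, w)) as [K HK].
  - intros F HF. destruct (smooth_T2_bounded _ HF) as [K HK]. exists K. intros [].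
    apply (curry_dominated (unc F) K); auto. now apply smooth_T2_continuous.
  - intros F G HF HG. apply (smooth_T2_minus _ _ HF HG).
  - intros F HF. replace (unc _) with (dir e1 (unc F)).
    + apply smooth_T2_dir; auto. apply e1_basis.
    + apply functional_extensionality. now intros [].
  - intros F HF. replace (unc _) with (dir e2 (unc F)).
    + apply smooth_T2_dir; auto. apply e2_basis.
    + apply functional_extensionality. now intros [].
  - intros F HF [] u w. apply (cder_e1 (unc F)).
    apply (smooth_derivable basis2 everywhere); [apply HF|apply e1_basis|easy].
  - intros F HF [] u w. apply (cder_e2 (unc F)).
    apply (smooth_derivable basis2 everywhere); [apply HF|apply e2_basis|easy].
  - intros F [Hp _] [] a b [m ->]. apply bdry_T. cbv beta. f_equal.
    + apply (f_equal (II integral_T)). extensionality w. f_equal.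
      pose proof (proj1 (Hp 0 w)) as E. unfold unc in E. cbn in E. rewrite Rplus_0_l in E. now rewrite E.
    + rewrite <- (per_cis m 0). f_equal. ring.
  - intros F [Hp _] [] u b [m ->]. apply bdry_T. cbv beta. f_equal.
    + pose proof (proj2 (Hp u 0)) as E. unfold unc in E. cbn in E. rewrite Rplus_0_l in E. now rewrite E.
    + rewrite <- (per_cis m 0). f_equal. ring.
  - replace (unc _) with f; auto. apply functional_extensionality. now intros [].
  - destruct (smooth_T2_bounded f Hf) as [B HB].
    pose proof two_PI_pos.
    set (c := / (2 * PI) * / (2 * PI)).
    assert (c0 : 0 < c) by (apply Rmult_lt_0_compat; apply Rinv_0_lt_compat; lra).
    exists (c * Rabs K). split; [pose proof (Rabs_pos K); nra|]. intros m n.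
    rewrite (fcoef_FT f B) by (auto; now apply smooth_T2_continuous).
    rewrite !Cmod_mult, !Cmod_inv by apply RtoC_2PI_neq. rewrite Cmod_R, Rabs_pos_eq by lra. fold c.
    specialize (HK tt (IZR m) (IZR n) (ex_intro _ m eq_refl) (ex_intro _ n eq_refl)).
    pose proof (Rle_abs K). nra.
Qed.

(** Uniformity in x is the point: the series in y is inverted with x as a parameter. *)
Lemma coef_decay_inner f : smooth_T2 f -> exists K, 0 <= K /\ forall x n,
  Cmod (coef (fun y => f (x, y)) n) <= K * bump (IZR n).
Proof.
  intros Hf.
  assert (H1 : smooth_T2 (dir e2 f)) by (apply smooth_T2_dir; auto using e2_basis).
  assert (H2 : smooth_T2 (dir e2 (dir e2 f))) by (apply smooth_T2_dir; auto using e2_basis).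
  destruct (smooth_T2_bounded _ Hf) as [K0 B0], (smooth_T2_bounded _ H1) as [K1 B1],
    (smooth_T2_bounded _ H2) as [K2 B2].
  assert (S : forall g B x, smooth_T2 g -> (forall x, Cmod (g x) <= B) ->
     dominated (wt integral_T) B (fun y => g (x, y))).
  { intros g B x Hg HB. split.
    - intros t. apply (continuous_comp (fun y => (x, y)) g); [cts|now apply smooth_T2_continuous].
    - intros t. rewrite wt_T, Rmult_1_r. auto. }
  assert (Hd : forall g, smooth_T2 g -> forall x y, cder (fun y => g (x, y)) y (dir e2 g (x, y))).
  { intros g Hg x y. apply cder_e2. apply (smooth_derivable basis2 everywhere); [apply Hg|apply e2_basis|easy]. }
  assert (Hb : forall g, smooth_T2 g -> forall x n, bdry integral_T (fun y => (g (x, y) * cis (- (y * IZR n)))%C)).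
  { intros g [Hg _] x n. apply bdry_T. cbv beta. f_equal.
    - rewrite <- (proj2 (Hg x 0)). do 2 f_equal. ring.
    - rewrite <- (per_cis n 0). f_equal. ring. }
  exists (K0 + K2). split.
  { pose proof (B0 (0, 0)). pose proof (B2 (0, 0)). pose proof (Cmod_ge_0 (f (0, 0))).
    pose proof (Cmod_ge_0 (dir e2 (dir e2 f) (0, 0))). lra. }
  intros x n.
  pose proof (II_ibp2 integral_T (fun y => f (x, y)) (fun y => dir e2 f (x, y))
    (fun y => dir e2 (dir e2 f) (x, y)) K0 K1 K2 (IZR n)
    (S _ _ x Hf B0) (S _ _ x H1 B1) (S _ _ x H2 B2) (Hd _ Hf x) (Hd _ H1 x) (Hb _ Hf x n) (Hb _ H1 x n)) as E.
  rewrite !integral_T_E in E.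
  assert (E2 : (RtoC (1 + IZR n ^ 2)%R * coef (fun y => f (x, y)) n)%C =
     coef (fun y => (f (x, y) - dir e2 (dir e2 f) (x, y))%C) n).
  { unfold coef. rewrite E. ring. }
  assert (P : 0 < 1 + IZR n ^ 2) by nra.
  unfold bump. apply Rle_div_r; [lra|].
  rewrite <- (Rabs_pos_eq (1 + IZR n ^ 2)) by lra. rewrite <- Cmod_R, Rmult_comm, <- Cmod_mult, E2.
  apply coef_bound.
  - intros t. apply continuous_Cminus; [apply (S _ _ x Hf B0)|apply (S _ _ x H2 B2)].
  - intros t. unfold Cminus. eapply Rle_trans; [apply Cmod_triangle|]. rewrite Cmod_opp.
    specialize (B0 (x, t)). specialize (B2 (x, t)). lra.
Qed.

Lemma square_sum_symsum a N x : square_sum a N x =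
  symsum N (fun n => symsum N (fun m => a m n * cis (fst x * IZR m)) * cis (snd x * IZR n))%C.
Proof.
  transitivity (symsum N (fun n => symsum N (fun m => a m n * UV m n x)%C)).
  - rewrite symsum_exchange. reflexivity.
  - apply symsum_ext. intros n. rewrite Cmult_comm, <- symsum_scal. apply symsum_ext. intros m.
    rewrite UV_cis, cis_plus, (Rmult_comm (fst x)), (Rmult_comm (snd x)). ring.
Qed.

(** One-dimensional inversion in y at fixed x, then in x for each coefficient [c n]. The errors of
    the second step carry the factor [bump (IZR n)], so their sum over n is controlled by
    [symsum_bound]: this is the origin of 5 * (4 * K). *)
Lemma fourier_inversion2 f : smooth_T2 f -> exists K, 0 <= K /\ forall N x,
  Cmod (f x - square_sum (fcoef f) N x)%C <= K * inv_succ N.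
Proof.
  intros Hf. destruct (coef_decay_inner f Hf) as [K1 [HK1 B1]].
  destruct (fcoef_decay f 1 1 Hf) as [K [HK B]].
  exists (4 * K1 + 5 * (4 * K)). split; [lra|]. intros N [x y].
  rewrite square_sum_symsum. cbn [fst snd].
  set (c := fun n x => coef (fun y => f (x, y)) n).
  assert (Hcy : forall x y, continuous (fun y => f (x, y)) y).
  { intros x' y'. apply (continuous_comp (fun y => (x', y)) f); [cts|now apply smooth_T2_continuous]. }
  assert (Hy : Cmod (f (x, y) - symsum N (fun n => c n x * cis (y * IZR n)))%C <= 4 * K1 * inv_succ N).
  { apply (fourier_inversion (fun y => f (x, y)) K1); auto. intros t. apply Hf. }
  assert (Hcc : forall n x, continuous (c n) x).
  { intros n x'. unfold c, coef. apply continuous_Cmult; [apply continuous_const|].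
    destruct (smooth_T2_bounded f Hf) as [B0 HB0].
    apply (continuous_ext (fun x => integral_T (fun w => f (x, w) * cis (- (w * IZR n)))%C));
      [intros; apply integral_T_E|].
    apply (dom2_outer integral_T B0 (fun u w => f (u, w) * cis (- (w * IZR n)))%C).
    apply (dom2_mult integral_T B0 (fun u w => f (u, w)) (fun _ w => cis (- (w * IZR n)))).
    - apply curry_dominated; auto. now apply smooth_T2_continuous.
    - intros p. cts.
    - intros u w. rewrite Cmod_cis. lra. }
  assert (Hx : forall n, Cmod (c n x - symsum N (fun m => fcoef f m n * cis (x * IZR m)))%C <= 4 * (K * bump (IZR n)) * inv_succ N).
  { intros n. apply (fourier_inversion (c n) (K * bump (IZR n))); auto.
    - intros t. unfold c. f_equal. extensionality y'. apply Hf.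
    - apply Rmult_le_pos; auto. apply Rlt_le, bump_pos.
    - intros m. specialize (B m n). rewrite !pow_1 in B. unfold bump.
      assert (0 < 1 + IZR m ^ 2) by nra. assert (0 < 1 + IZR n ^ 2) by nra.
      change (Cmod (fcoef f m n) <= K * / (1 + IZR n ^ 2) * / (1 + IZR m ^ 2)).
      apply (Rmult_le_reg_l ((1 + IZR m ^ 2) * (1 + IZR n ^ 2))); [now apply Rmult_lt_0_compat|].
      eapply Rle_trans; [exact B|]. right. field. lra. }
  match goal with |- Cmod (?A - ?B)%C <= _ =>
    replace (A - B)%C with ((A - symsum N (fun n => c n x * cis (y * IZR n))) +
      (symsum N (fun n => c n x * cis (y * IZR n)) - B))%C by ring end.
  eapply Rle_trans; [apply Cmod_triangle|].
  rewrite <- symsum_minus.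
  assert (T : Cmod (symsum N (fun n => c n x * cis (y * IZR n) -
     symsum N (fun m => fcoef f m n * cis (x * IZR m)) * cis (y * IZR n))%C) <= 5 * (4 * K * inv_succ N)).
  { apply symsum_bound.
    - pose proof (inv_succ_pos N). nra.
    - intros n. match goal with |- Cmod (?A * ?e - ?B * ?e)%C <= _ =>
        replace (A * e - B * e)%C with ((A - B) * e)%C by ring end.
      rewrite Cmod_mult, Cmod_cis, Rmult_1_r. specialize (Hx n). lra. }
  lra.
Qed.

(** * The norm of A_0 *)

Lemma A0_norm_le a r : (forall x, Cmod (a x) <= r) -> Rbar_le (A0_norm a) r.
Proof.
  intros H. unfold A0_norm. destruct (Lub_Rbar_correct (fun r => exists x, r = Cmod (a x))) as [_ L].
  apply L. intros y [x ->]. apply H.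
Qed.

Lemma A0_norm_ub a x : Rbar_le (Cmod (a x)) (A0_norm a).
Proof.
  unfold A0_norm. destruct (Lub_Rbar_correct (fun r => exists x, r = Cmod (a x))) as [U _].
  apply U. now exists x.
Qed.

Lemma A0_norm_le_iff a r : Rbar_le (A0_norm a) (Finite r) <-> forall x, Cmod (a x) <= r.
Proof.
  split; [|apply A0_norm_le]. intros H x.
  exact (Rbar_le_trans (Cmod (a x)) (A0_norm a) r (A0_norm_ub a x) H).
Qed.

Lemma A0_lim_iff {T} (F : (T -> Prop) -> Prop) {FF : Filter F} a b :
  A0_lim F a b <-> forall e, 0 < e -> F (fun t => forall x, Cmod (a t x - b x)%C < e).
Proof.
  split.
  - intros H e He. generalize (H (mkposreal e He)). apply filter_imp. intros t Ht x.
    exact (Rbar_le_lt_trans (Cmod (a t x - b x)%C) _ (mkposreal e He) (A0_norm_ub _ x) Ht).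
  - intros H e. pose proof (cond_pos e).
    (* A supremum of values below e may equal e; half of it restores the strict inequality. *)
    generalize (H (e / 2) ltac:(lra)). apply filter_imp. intros t Ht.
    apply Rbar_le_lt_trans with (Finite (e / 2)).
    + apply A0_norm_le. intros x. apply Rlt_le, Ht.
    + cbn. lra.
Qed.

Lemma fcoef_square_sum a N : fcoef (square_sum a N) 0 0 = a 0%Z 0%Z.
Proof.
  unfold fcoef.
  transitivity (coef (fun x => symsum N (fun m => a m 0%Z * cis (x * IZR m))%C) 0).
  - f_equal. extensionality x.
    transitivity (coef (fun y => symsum N (fun n => symsum N (fun m => a m n * cis (x * IZR m)) * cis (y * IZR n))%C) 0).
    + f_equal. extensionality y. apply square_sum_symsum.
    + rewrite coef_symsum. destruct Z_le_dec as [|Hn]; auto. exfalso. apply Hn. lia.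
  - rewrite coef_symsum. destruct Z_le_dec as [|Hn]; auto. exfalso. apply Hn. lia.
Qed.

Lemma square_sum_continuous a N x : continuous (square_sum a N) x.
Proof.
  apply (continuous_ext (fun x => symsum N (fun n => symsum N (fun m => a m n * cis (fst x * IZR m)) * cis (snd x * IZR n))%C)).
  { intros; symmetry; apply square_sum_symsum. }
  apply (continuous_symsum N (fun n x => symsum N (fun m => a m n * cis (fst x * IZR m)) * cis (snd x * IZR n))%C).
  intros n. apply continuous_Cmult; [|cts].
  apply (continuous_symsum N (fun m x => a m n * cis (fst x * IZR m))%C). intros m. cts.
Qed.


(** The (0, 0) coefficient is bounded by the supremum norm, so any series converging to [f] in norm
    has that coefficient as its constant term; this makes the description in [trace] unique. The
    Fourier series itself shows that it is satisfied. *)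
Lemma trace_fcoef f : smooth_T2 f -> trace f = fcoef f 0 0.
Proof.
  intros Hf. destruct (smooth_T2_bounded f Hf) as [B HB].
  pose proof (smooth_T2_continuous f Hf) as Hc.
  destruct (fourier_inversion2 f Hf) as [K [HK HI]].
  unfold trace. apply (iota_unique (V := C_R_CompleteNormedModule)).
  - intros c [a [_ [Ha ->]]]. pose proof (proj1 (A0_lim_iff eventually (square_sum a) f) Ha) as Ha'.
    assert (E : (a 0%Z 0%Z - fcoef f 0 0)%C = 0%C).
    { apply Cmod_small. intros e He. destruct (Ha' e He) as [N HN]. specialize (HN N (le_n _)).
      rewrite <- (fcoef_square_sum a N).
      assert (Bs : forall x, Cmod (square_sum a N x) <= B + e).
      { intros x. pose proof (Cmod_minus_le (square_sum a N x) (f x)). specialize (HN x). specialize (HB x). lra. }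
      rewrite <- (fcoef_minus _ _ (B + e) B); auto using square_sum_continuous.
      apply fcoef_bound.
      - intros x. apply continuous_Cminus; auto using square_sum_continuous.
      - intros x. apply Rlt_le, HN. }
    transitivity (fcoef f 0 0 + (a 0%Z 0%Z - fcoef f 0 0))%C; [symmetry|rewrite E]; unfold Cminus.
    + rewrite Cplus_comm, <- Cplus_assoc, (Cplus_comm (- _)), Cplus_opp_r. apply Cplus_0_r.
    + apply Cplus_0_r.
  - exists (fcoef f). split; [|split]; auto.
    (* The factor 4^N comes from 1 + |m| + |n| <= 4 (1 + m^2) (1 + n^2). *)
    + intros N. destruct (fcoef_decay f N N Hf) as [D [_ HD]]. exists (4 ^ N * D). intros m n.
      eapply Rle_trans; [|apply Rmult_le_compat_l; [apply pow_le; lra|apply (HD m n)]].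
      rewrite <- !Rmult_assoc, <- !Rpow_mult_distr.
      apply Rmult_le_compat_r; [apply Cmod_ge_0|]. apply pow_incr.
      rewrite <- (pow2_abs (IZR m)), <- (pow2_abs (IZR n)).
      pose proof (Rabs_pos (IZR m)). pose proof (Rabs_pos (IZR n)).
      set (u := Rabs (IZR m)) in *. set (v := Rabs (IZR n)) in *. split; [lra|].
      assert (1 + u <= 2 * (1 + u ^ 2)) by nra. assert (1 + v <= 2 * (1 + v ^ 2)) by nra.
      assert ((1 + u) * (1 + v) <= 2 * (1 + u ^ 2) * (2 * (1 + v ^ 2))) by (apply Rmult_le_compat; lra).
      nra.
    + apply (A0_lim_iff eventually (square_sum (fcoef f)) f). intros e He.
      destruct (inv_succ_small (e / (K + 1))) as [N HN]; [apply Rdiv_lt_0_compat; lra|].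
      exists N. intros n Hn x. rewrite Cmod_minus_sym. eapply Rle_lt_trans; [apply HI|].
      specialize (HN n Hn). apply Rlt_div_r in HN; [|lra]. pose proof (inv_succ_pos n). nra.
Qed.

Lemma trace_int_T2 f : smooth_T2 f -> trace f = (/ RtoC (2 * PI) * / RtoC (2 * PI) * int_T2 f)%C.
Proof.
  intros Hf. rewrite trace_fcoef by auto. destruct (smooth_T2_bounded f Hf) as [B HB].
  rewrite (fcoef_FT f B) by (auto; now apply smooth_T2_continuous). f_equal.
  unfold FT. rewrite integral_T_E. change (int_T2 f) with (CInt (fun x => CInt (fun y => f (x, y)) 0 (2 * PI)) 0 (2 * PI)).
  apply (f_equal (fun F => CInt F 0 (2 * PI))). extensionality x.
  rewrite Rmult_0_r, Ropp_0, cis_0, Cmult_1_r, integral_T_E.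
  apply (f_equal (fun F => CInt F 0 (2 * PI))). extensionality y.
  now rewrite Rmult_0_r, Ropp_0, cis_0, Cmult_1_r.
Qed.

(** * Smooth maps into A_0^infinity and smooth functions on T^2 x R^2 *)

Definition i1 (v : R2) : R4 := (v, (0, 0)).
Definition i2 (v : R2) : R4 := ((0, 0), v).

Lemma plus_scal_0_R2 (x : R2) (t : R) : plus x (scal t ((0, 0) : R2)) = x.
Proof. destruct x as [a b]. apply injective_projections; cbn; unfold plus, scal; cbn; unfold mult; cbn; ring. Qed.

Lemma plus_scal0_R2 (xi v : R2) : plus xi (scal 0 v) = xi.
Proof. exact (plus_scal_0 (V := prod_NormedModule R_AbsRing R_NormedModule R_NormedModule) xi v). Qed.

Lemma line_i1 v (g : R4 -> C) x xi t : line g (i1 v) (x, xi) t = line (fun x => g (x, xi)) v x t.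
Proof.
  unfold line. f_equal. apply injective_projections; [reflexivity|apply plus_scal_0_R2].
Qed.

Lemma line_i2 v (g : R4 -> C) x xi t : line g (i2 v) (x, xi) t = line (fun xi => g (x, xi)) v xi t.
Proof.
  unfold line. f_equal. apply injective_projections; [apply plus_scal_0_R2|reflexivity].
Qed.

Lemma dir_i1 v (g : R4 -> C) x xi : dir (i1 v) g (x, xi) = dir v (fun x => g (x, xi)) x.
Proof. unfold dir. f_equal; apply Derive_ext; intros t; now rewrite line_i1. Qed.

Lemma dir_i2 v (g : R4 -> C) x xi : dir (i2 v) g (x, xi) = dir v (fun xi => g (x, xi)) xi.
Proof. unfold dir. f_equal; apply Derive_ext; intros t; now rewrite line_i2. Qed.

Lemma derivable_i1 v (g : R4 -> C) x xi :
  derivable_along (i1 v) g (x, xi) <-> derivable_along v (fun x => g (x, xi)) x.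
Proof.
  unfold derivable_along.
  replace (line g (i1 v) (x, xi)) with (line (fun x => g (x, xi)) v x); [reflexivity|].
  extensionality t. symmetry. apply line_i1.
Qed.

Lemma derivable_i2 v (g : R4 -> C) x xi :
  derivable_along (i2 v) g (x, xi) <-> derivable_along v (fun xi => g (x, xi)) xi.
Proof.
  unfold derivable_along.
  replace (line g (i2 v) (x, xi)) with (line (fun xi => g (x, xi)) v xi); [reflexivity|].
  extensionality t. symmetry. apply line_i2.
Qed.

Lemma dirs_i1 l (g : R4 -> C) x xi : dirs (map i1 l) g (x, xi) = dirs l (fun x => g (x, xi)) x.
Proof.
  revert x. induction l as [|v l IH]; intros x; [reflexivity|].
  change (dir (i1 v) (dirs (map i1 l) g) (x, xi) = dir v (dirs l (fun x => g (x, xi))) x).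
  rewrite dir_i1. f_equal. apply functional_extensionality. exact IH.
Qed.

Lemma dirs_i2 l (g : R4 -> C) x xi : dirs (map i2 l) g (x, xi) = dirs l (fun xi => g (x, xi)) xi.
Proof.
  revert xi. induction l as [|v l IH]; intros xi; [reflexivity|].
  change (dir (i2 v) (dirs (map i2 l) g) (x, xi) = dir v (dirs l (fun xi => g (x, xi))) xi).
  rewrite dir_i2. f_equal. apply functional_extensionality. exact IH.
Qed.

(** Symbols on the noncommutative side take xi first; the pair puts x first, as [basis4] does. *)
Definition unc (sigma : R2 -> R2 -> C) : R4 -> C := uncurry4 (fun x xi => sigma xi x).

Lemma dirs_i1_i2 l1 l2 sigma x xi :
  dirs (map i1 l1 ++ map i2 l2) (unc sigma) (x, xi) = dirs l1 (nc_dirs l2 sigma xi) x.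
Proof.
  rewrite dirs_app, dirs_i1.
  replace (fun x => dirs (map i2 l2) (unc sigma) (x, xi)) with (nc_dirs l2 sigma xi); auto.
  extensionality y. unfold nc_dirs. now rewrite dirs_i2.
Qed.

Lemma incl_i1 l : incl l basis2 -> incl (map i1 l) basis4.
Proof.
  intros H v Hv. apply in_map_iff in Hv. destruct Hv as [w [<- Hw]].
  destruct (H w Hw) as [<-|[<-|[]]]; [now left|right; now left].
Qed.

Lemma incl_i2 l : incl l basis2 -> incl (map i2 l) basis4.
Proof.
  intros H v Hv. apply in_map_iff in Hv. destruct Hv as [w [<- Hw]].
  destruct (H w Hw) as [<-|[<-|[]]]; [do 2 right; now left|do 3 right; now left].
Qed.

Lemma multi2_incl i j : incl (multi2 i j) basis2.
Proof.
  intros v Hv. unfold multi2 in Hv. apply in_app_or in Hv.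
  destruct Hv as [Hv|Hv]; apply repeat_spec in Hv; subst; [apply e1_basis|apply e2_basis].
Qed.

Lemma map_repeat_const {A B} (f : A -> B) a n : map f (repeat a n) = repeat (f a) n.
Proof. induction n; cbn; congruence. Qed.

Lemma multi4_split a1 a2 b1 b2 : multi4 a1 a2 b1 b2 = map i1 (multi2 a1 a2) ++ map i2 (multi2 b1 b2).
Proof. unfold multi4, multi2. rewrite !map_app, !map_repeat_const, <- app_assoc. reflexivity. Qed.

Definition negi_pow (n : nat) : C := Cpow (- Ci)%C n.

Lemma negi_pow_S n : negi_pow (S n) = (- Ci * negi_pow n)%C.
Proof. apply Cpow_S. Qed.

Lemma Cmod_negi_pow n : Cmod (negi_pow n) = 1.
Proof.
  unfold negi_pow. rewrite Cmod_pow, Cmod_opp.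
  replace (Cmod Ci) with 1; [apply pow1|]. unfold Cmod, Ci; cbn. rewrite <- sqrt_1 at 1. f_equal. ring.
Qed.

Lemma delta_dirs i j a : smooth_T2 a -> delta i j a = fun x => (negi_pow (i + j) * dirs (multi2 i j) a x)%C.
Proof.
  intros Ha.
  assert (Hj : Nat.iter j delta2 a = fun x => (negi_pow j * dirs (repeat e2 j) a x)%C).
  { induction j as [|j IH].
    - extensionality x. unfold negi_pow. cbn. ring.
    - cbn [Nat.iter nat_rect]. change (nat_rect _ _ _ j) with (Nat.iter j delta2 a). rewrite IH.
      extensionality x. unfold delta2.
      destruct (derivable_scal e2 (dirs (repeat e2 j) a) (negi_pow j) x) as [_ E].
      + apply Ha; [|easy|apply e2_basis]. apply (multi2_incl 0 j).
      + transitivity (- Ci * (negi_pow j * dir e2 (dirs (repeat e2 j) a) x))%C; [exact (f_equal (Cmult (- Ci)%C) E)|].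
        rewrite negi_pow_S, Cmult_assoc. reflexivity. }
  unfold delta. rewrite Hj. clear Hj.
  induction i as [|i IH].
  - reflexivity.
  - cbn [Nat.iter nat_rect]. match goal with |- delta1 ?X = _ => change X with
      (Nat.iter i delta1 (fun x => (negi_pow j * dirs (repeat e2 j) a x)%C)) end. rewrite IH.
    extensionality x. unfold delta1.
    destruct (derivable_scal e1 (dirs (multi2 i j) a) (negi_pow (i + j)) x) as [_ E].
    + apply Ha; [|easy|apply e1_basis]. apply multi2_incl.
    + transitivity (- Ci * (negi_pow (i + j) * dir e1 (dirs (multi2 i j) a) x))%C; [exact (f_equal (Cmult (- Ci)%C) E)|].
      rewrite Nat.add_succ_l, negi_pow_S, Cmult_assoc. reflexivity.
Qed.

(** Each derivation is -i times a partial derivative, so the seminorms of [A_0^infinity] are the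
    supremum norms of partial derivatives. The identification needs smooth arguments, whence the
    condition that [a t] be smooth eventually. *)
Lemma A0inf_lim_dirs {T} (F : (T -> Prop) -> Prop) {FF : Filter F} a b :
  F (fun t => smooth_T2 (a t)) -> smooth_T2 b ->
  A0inf_lim F a b <-> forall i j e, 0 < e ->
    F (fun t => forall x, Cmod (dirs (multi2 i j) (a t) x - dirs (multi2 i j) b x)%C < e).
Proof.
  intros Ha Hb.
  assert (E : forall i j t, smooth_T2 (a t) -> forall x,
     Cmod (delta i j (a t) x - delta i j b x)%C = Cmod (dirs (multi2 i j) (a t) x - dirs (multi2 i j) b x)%C).
  { intros i j t Ht x. rewrite !delta_dirs by auto.
    match goal with |- Cmod (?c * ?u - ?c * ?v)%C = _ => replace (c * u - c * v)%C with (c * (u - v))%C by ring end.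
    now rewrite Cmod_mult, Cmod_negi_pow, Rmult_1_l. }
  split.
  - intros H i j e He. specialize (H i j). apply (proj1 (A0_lim_iff F _ _)) with (e := e) in H; auto.
    generalize (filter_and _ _ Ha H). apply filter_imp. intros t [Ht H'] x.
    rewrite <- E by auto. apply H'.
  - intros H i j. apply (A0_lim_iff F). intros e He.
    generalize (filter_and _ _ Ha (H i j e He)). apply filter_imp. intros t [Ht H'] x.
    rewrite E by auto. apply H'.
Qed.

Section Families.
Variable Om : R2 -> Prop.
Hypothesis HOm : open Om.
Variable sigma : R2 -> R2 -> C.

Definition Om4 (p : R4) : Prop := Om (snd p).

Lemma open_Om4 : open Om4.
Proof.
  intros [x xi] H. unfold Om4 in *. cbn in H.
  assert (C : continuous (fun p : R4 => snd p) (x, xi)) by cts.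
  apply (C Om). apply HOm. exact H.
Qed.

Lemma line_in_Om v xi : Om xi -> locally 0 (fun h : R => Om (plus xi (scal h v))).
Proof.
  intros H.
  exact (locally_line (V := prod_NormedModule R_AbsRing R_NormedModule R_NormedModule) Om xi v (HOm xi H)).
Qed.

Lemma locally'_imp (P : R -> Prop) : locally 0 P -> locally' 0 P.
Proof. intros [d Hd]. exists d. intros y Hy _. auto. Qed.

Section FromEucl.
Hypothesis Hp : forall xi, Om xi -> periodic (sigma xi).
Hypothesis Hs : smooth_on basis4 Om4 (unc sigma).

Lemma slice_continuous (g : R4 -> C) x xi : continuous g (x, xi) -> continuous (fun x => g (x, xi)) x.
Proof. intros H. apply (continuous_comp (fun x => (x, xi)) g); [cts|exact H]. Qed.

Lemma nc_dirs_smooth_T2 l xi : incl l basis2 -> Om xi -> smooth_T2 (nc_dirs l sigma xi).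
Proof.
  intros Hl Hxi. split.
  - intros x y. unfold nc_dirs. split; apply (dirs_ext_on Om HOm); auto; intros eta Heta; now apply Hp.
  - intros l1 Hl1 x _.
    assert (E : dirs l1 (nc_dirs l sigma xi) = fun x => dirs (map i1 l1 ++ map i2 l) (unc sigma) (x, xi)).
    { extensionality y. symmetry. apply dirs_i1_i2. }
    rewrite E.
    destruct (Hs (map i1 l1 ++ map i2 l)) with (p := (x, xi)) as [H1 H2].
    + apply incl_app; [now apply incl_i1|now apply incl_i2].
    + exact Hxi.
    + split; [now apply slice_continuous|]. intros v Hv.
      apply (proj1 (derivable_i1 v (dirs (map i1 l1 ++ map i2 l) (unc sigma)) x xi)). apply H2.
      apply (incl_i1 [v]); [now apply incl_single|now left].
Qed.

Lemma dirs_joint_continuous l1 l2 x xi : incl l1 basis2 -> incl l2 basis2 -> Om xi ->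
  continuous (fun p : R2 * R2 => dirs l1 (nc_dirs l2 sigma (fst p)) (snd p)) (xi, x).
Proof.
  intros H1 H2 Hxi.
  apply (continuous_ext (fun p : R2 * R2 => dirs (map i1 l1 ++ map i2 l2) (unc sigma) (snd p, fst p))).
  - intros [eta y]. cbn. apply dirs_i1_i2.
  - apply (continuous_comp (fun p : R2 * R2 => (snd p, fst p)) (dirs (map i1 l1 ++ map i2 l2) (unc sigma))); [cts|].
    apply Hs; [|exact Hxi]. apply incl_app; [now apply incl_i1|now apply incl_i2].
Qed.

Lemma dirs_uniform l1 l2 xi : incl l1 basis2 -> incl l2 basis2 -> Om xi -> forall e, 0 < e ->
  locally xi (fun eta => forall x, Cmod (dirs l1 (nc_dirs l2 sigma eta) x - dirs l1 (nc_dirs l2 sigma xi) x)%C < e).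
Proof.
  intros H1 H2 Hxi. apply (torus_uniform (fun eta x => dirs l1 (nc_dirs l2 sigma eta) x)).
  - generalize (HOm xi Hxi). apply filter_imp. intros eta Heta.
    apply periodic_dirs. now apply nc_dirs_smooth_T2.
  - intros x. now apply dirs_joint_continuous.
Qed.

(** A xi-derivative is moved inwards past the x-derivatives by symmetry of mixed partials on T^2 x
    R^2. *)
Lemma nc_dirs_cons_comm l1 l2 v x xi : incl l1 basis2 -> incl l2 basis2 -> In v basis2 -> Om xi ->
  derivable_along v (fun eta => dirs l1 (nc_dirs l2 sigma eta) x) xi /\
  dir v (fun eta => dirs l1 (nc_dirs l2 sigma eta) x) xi = dirs l1 (nc_dirs (v :: l2) sigma xi) x.
Proof.
  intros H1 H2 Hv Hxi.
  assert (E : (fun eta => dirs l1 (nc_dirs l2 sigma eta) x) =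
     (fun eta => dirs (map i1 l1 ++ map i2 l2) (unc sigma) (x, eta))).
  { extensionality eta. symmetry. apply dirs_i1_i2. }
  split; [refine (eq_ind_r (fun F => derivable_along v F xi) _ E)|refine (eq_ind_r (fun F => dir v F xi = _) _ E)].
  - apply (proj1 (derivable_i2 v (dirs (map i1 l1 ++ map i2 l2) (unc sigma)) x xi)). apply Hs; [|exact Hxi|].
    + apply incl_app; [now apply incl_i1|now apply incl_i2].
    + apply (incl_i2 [v]); [now apply incl_single|now left].
  - transitivity (dir (i2 v) (dirs (map i1 l1 ++ map i2 l2) (unc sigma)) (x, xi)); [symmetry; apply dir_i2|].
    rewrite <- dirs_i1_i2.
    apply (dirs_perm basis4 Om4 open_Om4 (unc sigma) (i2 v :: map i1 l1 ++ map i2 l2)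
      (map i1 l1 ++ map i2 (v :: l2))); auto.
    + cbn. apply Permutation_middle.
    + intros w [<-|Hw].
      * apply (incl_i2 [v]); [now apply incl_single|now left].
      * revert w Hw. apply incl_app; [now apply incl_i1|now apply incl_i2].
Qed.

(** After subtracting its linear part, the function of h has as derivative the deviation of the
    xi-derivative along a short segment. This deviation is small uniformly in x by [dirs_uniform],
    and the mean value inequality transfers it to the quotient. The e / 3 leaves room for the factor
    2 of [cder_mvt]. *)
Lemma quotient_uniform l1 l2 v xi : incl l1 basis2 -> incl l2 basis2 -> In v basis2 -> Om xi ->
  forall e, 0 < e -> locally' 0 (fun h : R => forall x,
    Cmod ((dirs l1 (nc_dirs l2 sigma (plus xi (scal h v))) x - dirs l1 (nc_dirs l2 sigma xi) x) / h -
      dirs l1 (nc_dirs (v :: l2) sigma xi) x)%C < e).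
Proof.
  intros H1 H2 Hv Hxi e He.
  assert (H2' : incl (v :: l2) basis2) by (intros w [<-|Hw]; auto).
  pose proof (dirs_uniform l1 (v :: l2) xi H1 H2' Hxi (e / 3) ltac:(lra)) as L.
  pose proof (filter_and _ _ L (HOm xi Hxi)) as L'. apply (locally_line _ _ v) in L'.
  destruct L' as [d Hd]. exists d. intros h Hh Hh0 x.
  change (Rabs (h - 0) < d) in Hh. rewrite Rminus_0_r in Hh.
  set (G := fun s : R => dirs l1 (nc_dirs l2 sigma (plus xi (scal s v))) x).
  set (D := dirs l1 (nc_dirs (v :: l2) sigma xi) x).
  assert (Hz : forall z, Rmin 0 h <= z <= Rmax 0 h -> Rabs z < d).
  { intros z Hz. eapply Rle_lt_trans; [|exact Hh]. revert Hz. unfold Rmin, Rmax.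
    destruct (Rle_dec 0 h); intros Hz; unfold Rabs; repeat destruct Rcase_abs; lra. }
  assert (M : Cmod ((G h - h * D) - (G 0 - RtoC 0 * D))%C <= 2 * (e / 3) * Rabs (h - 0)).
  { apply (cder_mvt (fun s => (G s - s * D)%C)
      (fun s => (dirs l1 (nc_dirs (v :: l2) sigma (plus xi (scal s v))) x - D)%C)).
    - intros z Hz'. specialize (Hz z Hz').
      destruct (Hd z) as [_ Hzo]; [change (Rabs (z - 0) < d); now rewrite Rminus_0_r|].
      apply cder_minus.
      + destruct (nc_dirs_cons_comm l1 l2 v x (plus xi (scal z v)) H1 H2 Hv Hzo) as [Da E].
        rewrite <- E. exact (line_cder v _ xi z Da).
      + pose proof (cder_mult (fun s => RtoC s) (fun _ => D) z 1%C 0%C) as P. cbv beta in P.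
        replace (1 * D + z * 0)%C with D in P by ring. apply P; [|apply cder_const].
        split; cbn [fst snd RtoC]; auto_derive; auto.
    - intros z Hz'. specialize (Hz z Hz').
      destruct (Hd z) as [Hzo _]; [change (Rabs (z - 0) < d); now rewrite Rminus_0_r|].
      apply Rlt_le, Hzo. }
  assert (G0 : G 0 = dirs l1 (nc_dirs l2 sigma xi) x) by (unfold G; now rewrite plus_scal0_R2).
  rewrite <- G0. fold (G h).
  assert (Hc : RtoC h <> 0%C) by (intros E; apply RtoC_inj in E; auto).
  replace ((G h - G 0) / h - D)%C with (((G h - h * D) - (G 0 - RtoC 0 * D)) / h)%C by (field; auto).
  unfold Cdiv. rewrite Cmod_mult, Cmod_inv, Cmod_R by auto.
  assert (Hp0 : 0 < Rabs h) by now apply Rabs_pos_lt.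
  apply (Rmult_lt_reg_r (Rabs h)); auto. rewrite Rmult_assoc, Rinv_l, Rmult_1_r by lra.
  rewrite Rminus_0_r in M. nra.
Qed.

Lemma smooth_A0_of_eucl : smooth_A0_on Om sigma.
Proof.
  intros l Hl xi Hxi. split; [|split].
  - now apply nc_dirs_smooth_T2.
  - apply (A0inf_lim_dirs (locally xi)).
    + generalize (HOm xi Hxi). apply filter_imp. intros eta Heta. now apply nc_dirs_smooth_T2.
    + now apply nc_dirs_smooth_T2.
    + intros i j. apply dirs_uniform; auto. apply multi2_incl.
  - intros v Hv.
    assert (Hl' : incl (v :: l) basis2) by (intros w [<-|Hw]; auto).
    pose proof (locally'_imp _ (line_in_Om v xi Hxi)) as L.
    (* The quotient is brought into the shape of sums and scalar multiples to which linearity of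
       [dirs] applies. *)
    assert (Q : forall h : R, (fun x => ((nc_dirs l sigma (plus xi (scal h v)) x - nc_dirs l sigma xi x) / h)%C) =
       fun x => (/ h * (nc_dirs l sigma (plus xi (scal h v)) x + (-1) * nc_dirs l sigma xi x))%C).
    { intros h. extensionality x. unfold Cdiv. ring. }
    assert (S : forall h, Om (plus xi (scal h v)) -> smooth_T2 (nc_dirs l sigma (plus xi (scal h v))))
      by (intros; now apply nc_dirs_smooth_T2).
    assert (S0 : smooth_T2 (nc_dirs l sigma xi)) by now apply nc_dirs_smooth_T2.
    apply (A0inf_lim_dirs (locally' 0)).
    + generalize L. apply filter_imp. intros h Hh. rewrite Q.
      apply smooth_T2_scal, smooth_T2_plus; auto. now apply smooth_T2_scal.
    + now apply nc_dirs_smooth_T2.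
    + intros i j e He.
      generalize (filter_and _ _ L (quotient_uniform (multi2 i j) l v xi (multi2_incl i j) Hl Hv Hxi e He)).
      apply filter_imp. intros h [Hh H] x. rewrite Q.
      specialize (S h Hh). specialize (H x).
      rewrite (dirs_scal basis2 everywhere) by
        (auto using multi2_incl; try easy; try apply open_everywhere;
         apply smooth_T2_plus; auto; now apply smooth_T2_scal).
      rewrite (dirs_plus basis2 everywhere) by
        (auto using multi2_incl; try easy; try apply open_everywhere; first [apply S|now apply smooth_T2_scal]).
      rewrite (dirs_scal basis2 everywhere) by
        (auto using multi2_incl; try easy; try apply open_everywhere; apply S0).
      eapply Rle_lt_trans; [|exact H]. right. f_equal. unfold Cdiv. ring.
Qed.
End FromEucl.

Section ToEucl.
Hypothesis HA : smooth_A0_on Om sigma.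

Lemma nc_smooth l xi : incl l basis2 -> Om xi -> smooth_T2 (nc_dirs l sigma xi).
Proof. intros Hl Hxi. now apply HA. Qed.

(** Normal form of a mixed derivative: sorted x-derivatives outside, xi-derivatives inside.
    Smoothness into [A_0^infinity] speaks only about derivatives taken in this order. *)
Let N (i j : nat) (l : list R2) (p : R4) : C := dirs (multi2 i j) (nc_dirs l sigma (snd p)) (fst p).

Lemma N_f1 i j l p : incl l basis2 -> Om4 p ->
  derivable_along f1 (N i j l) p /\ dir f1 (N i j l) p = N (S i) j l p.
Proof.
  intros Hl Hp. destruct p as [x xi]. split.
  - apply (proj2 (derivable_i1 e1 (N i j l) x xi)). apply (nc_smooth l xi Hl Hp); [apply multi2_incl|easy|apply e1_basis].
  - unfold N at 1. rewrite (dir_i1 e1). reflexivity.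
Qed.

Lemma N_f2 i j l p : incl l basis2 -> Om4 p ->
  derivable_along f2 (N i j l) p /\ dir f2 (N i j l) p = N i (S j) l p.
Proof.
  intros Hl Hp. destruct p as [x xi]. split.
  - apply (proj2 (derivable_i1 e2 (N i j l) x xi)). apply (nc_smooth l xi Hl Hp); [apply multi2_incl|easy|apply e2_basis].
  - unfold N at 1. rewrite (dir_i1 e2). unfold N. cbn [fst snd].
    apply (dirs_perm basis2 everywhere (open_everywhere _) (nc_dirs l sigma xi) (e2 :: multi2 i j) (multi2 i (S j)));
      try easy.
    + now apply nc_smooth.
    + unfold multi2. cbn [repeat]. apply Permutation_middle.
    + intros w [<-|Hw]; [apply e2_basis|now apply (multi2_incl i j)].
Qed.

(** No symmetry of mixed partials is available yet. The exchange of the xi-derivative with the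
    x-derivatives is contained in the Frechet topology: the difference quotients converge together
    with all their x-derivatives. *)
Lemma N_i2 i j l v p : incl l basis2 -> In v basis2 -> Om4 p ->
  derivable_along (i2 v) (N i j l) p /\ dir (i2 v) (N i j l) p = N i j (v :: l) p.
Proof.
  intros Hl Hv Hp. destruct p as [x xi]. unfold Om4 in Hp. cbn in Hp.
  assert (Hl' : incl (v :: l) basis2) by (intros w [<-|Hw]; auto).
  rewrite derivable_i2, dir_i2. apply cder_derivable.
  set (G := line (fun xi => N i j l (x, xi)) v xi).
  pose proof (locally'_imp _ (line_in_Om v xi Hp)) as L.
  assert (Q : forall h : R, (fun x => ((nc_dirs l sigma (plus xi (scal h v)) x - nc_dirs l sigma xi x) / h)%C) =
       fun x => (/ h * (nc_dirs l sigma (plus xi (scal h v)) x + (-1) * nc_dirs l sigma xi x))%C).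
  { intros h. extensionality y. unfold Cdiv. ring. }
  assert (S : forall h, Om (plus xi (scal h v)) -> smooth_T2 (nc_dirs l sigma (plus xi (scal h v))))
    by (intros; now apply nc_smooth).
  assert (S0 : smooth_T2 (nc_dirs l sigma xi)) by now apply nc_smooth.
  assert (SQ : forall h : R, Om (plus xi (scal h v)) -> smooth_T2
    (fun x => ((nc_dirs l sigma (plus xi (scal h v)) x - nc_dirs l sigma xi x) / h)%C)).
  { intros h Hh. rewrite Q. apply smooth_T2_scal, smooth_T2_plus; auto. now apply smooth_T2_scal. }
  destruct (HA l Hl xi Hp) as [_ [_ H3]]. specialize (H3 v Hv).
  assert (K : forall i j e, 0 < e -> locally' 0 (fun h : R => forall x, Cmod (dirs (multi2 i j)
     (fun x => ((nc_dirs l sigma (plus xi (scal h v)) x - nc_dirs l sigma xi x) / h)%C) x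
     - dirs (multi2 i j) (nc_dirs (v :: l) sigma xi) x)%C < e)).
  { apply (A0inf_lim_dirs (locally' 0)); auto.
    - generalize L. apply filter_imp. intros h Hh. now apply SQ.
    - now apply nc_smooth. }
  assert (H : forall e, 0 < e -> locally' 0 (fun h : R => Cmod ((G h - G 0) / h - N i j (v :: l) (x, xi))%C < e)).
  { intros e He.
    specialize (K i j e He).
    generalize (filter_and _ _ L K). apply filter_imp. intros h [Hh Hx]. specialize (Hx x).
    rewrite Q in Hx. specialize (S h Hh).
    rewrite (dirs_scal basis2 everywhere) in Hx by
        (auto using multi2_incl; try easy; try apply open_everywhere;
         apply smooth_T2_plus; auto; now apply smooth_T2_scal).
    rewrite (dirs_plus basis2 everywhere) in Hx by
        (auto using multi2_incl; try easy; try apply open_everywhere; first [apply S|now apply smooth_T2_scal]).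
    rewrite (dirs_scal basis2 everywhere) in Hx by
        (auto using multi2_incl; try easy; try apply open_everywhere; apply S0).
    unfold G, line, N. cbn [fst snd]. rewrite plus_scal0_R2.
    eapply Rle_lt_trans; [|exact Hx]. right. f_equal. unfold Cdiv.
    match goal with |- ((?A - ?B) * ?c - ?D)%C = _ =>
      change (((A - B) * c - D)%C = (c * (A + (-1) * B) - D)%C); ring end. }
  assert (X : forall k : C -> R, (forall z w, k (z - w)%C = k z - k w) -> (forall z (h : R), h <> 0 -> k (z / h)%C = k z / h) ->
     (forall z, Rabs (k z) <= Cmod z) -> is_derive (fun h => k (G h)) 0 (k (N i j (v :: l) (x, xi)))).
  { intros k Hk1 Hk2 Hk3. apply is_derive_Reals. intros e He. destruct (H e He) as [d Hd].
    exists d. intros h Hh0 Hh. rewrite Rplus_0_l.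
    specialize (Hd h). assert (B : ball 0 d h) by (change (Rabs (h - 0) < d); now rewrite Rminus_0_r).
    specialize (Hd B Hh0). eapply Rle_lt_trans; [|exact Hd].
    eapply Rle_trans; [|apply Hk3]. rewrite Hk1, Hk2, Hk1 by auto. right. reflexivity. }
  split.
  - apply (X fst); auto using Rabs_fst_Cmod.
    intros z h Hh. unfold Cdiv. rewrite <- RtoC_inv by auto. cbn. unfold Rdiv. ring.
  - apply (X snd); auto using Rabs_snd_Cmod.
    intros z h Hh. unfold Cdiv. rewrite <- RtoC_inv by auto. cbn. unfold Rdiv. ring.
Qed.

(** Convergence in xi is uniform in x, and each slice is continuous in x; together they give joint
    continuity. *)
Lemma N_continuous i j l p : incl l basis2 -> Om4 p -> continuous (N i j l) p.
Proof.
  intros Hl Hp. destruct p as [x xi]. unfold Om4 in Hp. cbn in Hp.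
  destruct (HA l Hl xi Hp) as [HT [H2 _]].
  assert (K : forall e, 0 < e -> locally xi (fun eta => forall x,
     Cmod (dirs (multi2 i j) (nc_dirs l sigma eta) x - dirs (multi2 i j) (nc_dirs l sigma xi) x)%C < e)).
  { revert i j. apply (A0inf_lim_dirs (locally xi)); auto.
    generalize (HOm xi Hp). apply filter_imp. intros eta Heta. now apply nc_smooth. }
  apply C_continuous. intros e He.
  assert (C1 : continuous (dirs (multi2 i j) (nc_dirs l sigma xi)) x).
  { apply HT; [apply multi2_incl|easy]. }
  destruct (proj1 (C_continuous _ _) C1 (e / 2) ltac:(lra)) as [d1 Hd1].
  destruct (K (e / 2) ltac:(lra)) as [d2 Hd2].
  assert (Hd : 0 < Rmin d1 d2) by (apply Rmin_pos; apply cond_pos).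
  exists (mkposreal _ Hd). intros [y eta] [B1 B2]. cbn [fst snd] in *.
  assert (B1' : ball x d1 y) by (eapply ball_le; [|exact B1]; apply Rmin_l).
  assert (B2' : ball xi d2 eta) by (eapply ball_le; [|exact B2]; apply Rmin_r).
  unfold N. cbn [fst snd].
  specialize (Hd1 y B1'). specialize (Hd2 eta B2' y).
  match goal with |- Cmod (?A - ?B)%C < _ =>
    replace (A - B)%C with ((A - dirs (multi2 i j) (nc_dirs l sigma xi) y) +
      (dirs (multi2 i j) (nc_dirs l sigma xi) y - B))%C by ring end.
  eapply Rle_lt_trans; [apply Cmod_triangle|]. lra.
Qed.

(** Induction on the word: each new direction turns one normal form into another. The equality holds
    on an open set and therefore survives the next derivative. *)
Lemma dirs_normal L : incl L basis4 -> exists i j l, incl l basis2 /\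
  forall p, Om4 p -> dirs L (unc sigma) p = N i j l p.
Proof.
  induction L as [|v L IH]; intros HL.
  - exists 0%nat, 0%nat, []. split; [apply incl_nil_l|]. now intros [x xi] _.
  - destruct IH as [i [j [l [Hl E]]]]; [intros w Hw; apply HL; now right|].
    assert (E' : forall w p, Om4 p -> dir w (dirs L (unc sigma)) p = dir w (N i j l) p).
    { intros w p Hp. apply dir_ext_loc. generalize (open_Om4 p Hp). apply filter_imp. exact E. }
    destruct (HL v (or_introl eq_refl)) as [<-|[<-|[<-|[<-|[]]]]].
    + exists (S i), j, l. split; auto. intros p Hp. cbn. rewrite E' by auto. now apply N_f1.
    + exists i, (S j), l. split; auto. intros p Hp. cbn. rewrite E' by auto. now apply N_f2.
    + exists i, j, (e1 :: l). split; [intros w [<-|Hw]; auto using e1_basis|].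
      intros p Hp. cbn. rewrite E' by auto. apply (N_i2 i j l e1); auto using e1_basis.
    + exists i, j, (e2 :: l). split; [intros w [<-|Hw]; auto using e2_basis|].
      intros p Hp. cbn. rewrite E' by auto. apply (N_i2 i j l e2); auto using e2_basis.
Qed.

Lemma eucl_of_smooth_A0 : (forall xi, Om xi -> periodic (sigma xi)) /\ smooth_on basis4 Om4 (unc sigma).
Proof.
  split.
  - intros xi Hxi. apply (nc_smooth [] xi (incl_nil_l _) Hxi).
  - intros L HL p Hp. destruct (dirs_normal L HL) as [i [j [l [Hl E]]]].
    assert (E' : locally p (fun q => N i j l q = dirs L (unc sigma) q)).
    { generalize (open_Om4 p Hp). apply filter_imp. intros q Hq. symmetry. now apply E. }
    split.
    + eapply continuous_ext_loc; [exact E'|]. now apply N_continuous.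
    + intros v Hv. eapply derivable_ext_loc; [exact E'|].
      destruct Hv as [<-|[<-|[<-|[<-|[]]]]].
      * now apply N_f1. * now apply N_f2.
      * apply (N_i2 i j l e1); auto using e1_basis. * apply (N_i2 i j l e2); auto using e2_basis.
Qed.
End ToEucl.
End Families.

(** * Classical symbols of the two kinds *)

(** The power is increasing or decreasing according to the sign of z; the sum of the values at the
    end points covers both cases. *)
Lemma powerRZ_le_between a t b z : 0 < a -> a <= t <= b -> powerRZ t z <= powerRZ a z + powerRZ b z.
Proof.
  intros Ha Ht. assert (Hb : 0 < b) by lra.
  pose proof (powerRZ_lt a z Ha). pose proof (powerRZ_lt b z Hb).
  destruct z as [|p|p]; cbn in *; [lra| |].
  - assert (t ^ Pos.to_nat p <= b ^ Pos.to_nat p) by (apply pow_incr; lra). lra.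
  - assert (/ t ^ Pos.to_nat p <= / a ^ Pos.to_nat p); [|lra].
    apply Rinv_le_contravar; [now apply pow_lt|apply pow_incr; lra].
Qed.

Lemma enorm_pos xi : 0 <= enorm xi.
Proof. apply sqrt_pos. Qed.

Lemma dot_self_pos xi : 0 <= dot xi xi.
Proof. unfold dot. nra. Qed.

Lemma enorm_sqr xi : enorm xi ^ 2 = dot xi xi.
Proof. unfold enorm. simpl. rewrite Rmult_1_r. apply sqrt_sqrt, dot_self_pos. Qed.

Lemma japanese_sqr xi : japanese xi ^ 2 = 1 + dot xi xi.
Proof.
  unfold japanese. simpl. rewrite Rmult_1_r. apply sqrt_sqrt. pose proof (dot_self_pos xi). lra.
Qed.

Lemma japanese_ge1 xi : 1 <= japanese xi.
Proof.
  pose proof (japanese_sqr xi). pose proof (dot_self_pos xi).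
  assert (0 <= japanese xi) by apply sqrt_pos. nra.
Qed.

Lemma enorm_le_japanese xi : enorm xi <= japanese xi.
Proof.
  pose proof (japanese_sqr xi). pose proof (enorm_sqr xi). pose proof (enorm_pos xi).
  pose proof (japanese_ge1 xi). nra.
Qed.

Lemma japanese_le xi : japanese xi <= 1 + enorm xi.
Proof.
  pose proof (japanese_sqr xi). pose proof (enorm_sqr xi). pose proof (enorm_pos xi).
  pose proof (japanese_ge1 xi). nra.
Qed.

(** The two weights of the two symbol classes satisfy b <= a <= 2 b, so their ratio stays in
    [1/2, 2] and integral powers of either sign are comparable. *)
Lemma powerRZ_japanese_le z : exists K, 0 < K /\ forall xi,
  powerRZ (1 + enorm xi) z <= K * powerRZ (japanese xi) z /\
  powerRZ (japanese xi) z <= K * powerRZ (1 + enorm xi) z.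
Proof.
  set (K := powerRZ (/ 2) z + powerRZ 2 z + 1).
  assert (HK : 0 < K).
  { unfold K. pose proof (powerRZ_lt (/ 2) z ltac:(lra)). pose proof (powerRZ_lt 2 z ltac:(lra)). lra. }
  exists K. split; auto. intros xi.
  set (a := 1 + enorm xi). set (b := japanese xi).
  assert (Ha : 1 <= a) by (pose proof (enorm_pos xi); unfold a; lra).
  assert (Hb : 1 <= b) by apply japanese_ge1.
  assert (H1 : b <= a) by apply japanese_le.
  assert (H2 : a <= 2 * b) by (pose proof (enorm_le_japanese xi); unfold a, b in *; lra).
  assert (W : forall x y, 0 < x -> 0 < y -> x <= 2 * y -> y <= 2 * x -> powerRZ x z <= K * powerRZ y z).
  { intros x y Hx Hy Hxy Hyx.
    replace x with (x / y * y) at 1 by (field; lra). rewrite powerRZ_mult.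
    apply Rmult_le_compat_r; [apply powerRZ_le; lra|].
    pose proof (powerRZ_le_between (/ 2) (x / y) 2 z) as B. unfold K.
    assert (/ 2 <= x / y <= 2); [|specialize (B ltac:(lra) ltac:(lra)); lra].
    split; [apply Rle_div_r; lra|apply Rle_div_l; lra]. }
  split; apply W; lra.
Qed.

Lemma enorm_dilate l xi : 0 <= l -> enorm (dilate l xi) = l * enorm xi.
Proof.
  intros Hl. unfold enorm. replace (dot (dilate l xi) (dilate l xi)) with (l ^ 2 * dot xi xi)
    by (unfold dot, dilate; cbn; ring).
  rewrite sqrt_mult by (try apply dot_self_pos; nra). f_equal.
  replace (l ^ 2) with (Rsqr l) by (unfold Rsqr; ring). now apply sqrt_Rsqr.
Qed.

Lemma enorm_nonzero xi : nonzero xi -> 0 < enorm xi.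
Proof.
  intros H. pose proof (enorm_pos xi). pose proof (enorm_sqr xi).
  destruct (Req_dec (enorm xi) 0) as [E|E]; [|lra]. exfalso. apply H.
  rewrite E in H1. destruct xi as [a b]. unfold dot in H1. cbn in H1.
  assert (a = 0) by nra. assert (b = 0) by nra. congruence.
Qed.

Lemma open_nonzero : open nonzero.
Proof.
  intros [a b] H.
  assert (Hab : a <> 0 \/ b <> 0).
  { destruct (Req_dec a 0), (Req_dec b 0); auto. subst. exfalso. now apply H. }
  destruct Hab as [Hn|Hn]; apply Rabs_pos_lt in Hn; exists (mkposreal _ Hn); intros [x y] [H1 H2] E;
    injection E as -> ->.
  - change (Rabs (0 - a) < Rabs a) in H1. rewrite Rabs_minus_sym, Rminus_0_r in H1. lra.
  - change (Rabs (0 - b) < Rabs b) in H2. rewrite Rabs_minus_sym, Rminus_0_r in H2. lra.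
Qed.

Definition flip2 (sigma : R2 -> R2 -> C) : R2 -> R2 -> C := fun x xi => sigma xi x.

(** The estimates concern the same mixed derivatives: the derivations contribute unimodular factors,
    the norm of [A_0] is the supremum over x, and the weights in xi are comparable. *)
Lemma nc_symbol_eucl n sigma : nc_symbol n sigma -> eucl_symbol n (flip2 sigma).
Proof.
  intros [Hs [Hb _]].
  destruct (eucl_of_smooth_A0 everywhere (open_everywhere _) sigma Hs) as [H1 H2].
  split; [|split].
  - intros xi. now apply H1.
  - exact H2.
  - intros a1 a2 b1 b2. destruct (Hb a1 a2 b1 b2) as [K [HK B]].
    destruct (powerRZ_japanese_le (n - Z.of_nat (b1 + b2))) as [L [HL BL]].
    exists (K * L). split; [now apply Rmult_lt_0_compat|]. intros x xi.
    rewrite multi4_split.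
    change (uncurry4 (flip2 sigma)) with (unc sigma). rewrite dirs_i1_i2.
    assert (Sm : smooth_T2 (nc_dirs (multi2 b1 b2) sigma xi)) by (apply Hs; [apply multi2_incl|easy]).
    specialize (B xi). apply (proj1 (A0_norm_le_iff _ _)) with (x := x) in B.
    rewrite delta_dirs, Cmod_mult, Cmod_negi_pow, Rmult_1_l in B by auto.
    eapply Rle_trans; [exact B|]. rewrite Rmult_assoc. apply Rmult_le_compat_l; [lra|].
    replace (n - Z.of_nat b1 - Z.of_nat b2)%Z with (n - Z.of_nat (b1 + b2))%Z by lia.
    apply BL.
Qed.

Lemma eucl_symbol_smooth_A0 m s : eucl_symbol m s -> smooth_A0_on everywhere (flip2 s).
Proof.
  intros [H1 [H2 _]]. apply smooth_A0_of_eucl; [apply open_everywhere| |exact H2].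
  intros xi _. apply H1.
Qed.

Lemma eucl_symbol_nc_bound m s : eucl_symbol m s -> forall i1 i2 j1 j2 : nat, exists K : R, 0 < K /\ forall xi,
     Rbar_le (A0_norm (delta i1 i2 (nc_dirs (multi2 j1 j2) (flip2 s) xi)))
       (K * powerRZ (1 + enorm xi) (m - Z.of_nat j1 - Z.of_nat j2)).
Proof.
  intros Hs a1 a2 b1 b2. pose proof (eucl_symbol_smooth_A0 m s Hs) as HA.
  destruct Hs as [_ [_ Hb]]. destruct (Hb a1 a2 b1 b2) as [K [HK B]].
  destruct (powerRZ_japanese_le (m - Z.of_nat (b1 + b2))) as [L [HL BL]].
  exists (K * L). split; [now apply Rmult_lt_0_compat|]. intros xi.
  apply A0_norm_le. intros x.
  assert (Sm : smooth_T2 (nc_dirs (multi2 b1 b2) (flip2 s) xi)) by (apply HA; [apply multi2_incl|easy]).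
  rewrite delta_dirs, Cmod_mult, Cmod_negi_pow, Rmult_1_l by auto.
  specialize (B x xi). rewrite multi4_split in B.
  change (uncurry4 s) with (unc (flip2 s)) in B. rewrite dirs_i1_i2 in B.
  eapply Rle_trans; [exact B|]. rewrite Rmult_assoc. apply Rmult_le_compat_l; [lra|].
  replace (m - Z.of_nat b1 - Z.of_nat b2)%Z with (m - Z.of_nat (b1 + b2))%Z by lia.
  apply BL.
Qed.

Lemma nc_classical_eucl n sigma h : nc_classical n sigma h ->
  eucl_classical n (flip2 sigma) (fun j => flip2 (h j)).
Proof.
  intros [Hs [Hh [chi [Hchi HN]]]]. split; [|split].
  - now apply nc_symbol_eucl.
  - intros j. destruct (Hh j) as [Hj Hhom].
    destruct (eucl_of_smooth_A0 nonzero open_nonzero (h j) Hj) as [H1 H2].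
    split; [|split]; auto. intros l x xi Hl Hxi. now apply Hhom.
  - exists chi. split; auto. intros N. apply (nc_symbol_eucl _ _ (HN N)).
Qed.

Section Remainder.
Variables (m : Z) (s : R2 -> R2 -> C) (h : nat -> R2 -> R2 -> C) (chi : R2 -> R).
Hypothesis Hh : forall j : nat,
     (forall xi, nonzero xi -> periodic (fun x => h j x xi)) /\
     smooth_on basis4 (fun p => nonzero (snd p)) (uncurry4 (h j)) /\
     (forall l x xi, 0 < l -> nonzero xi ->
        h j x (dilate l xi) = (powerRZ l (m - Z.of_nat j) * h j x xi)%C).
Hypothesis Hchi : exists r, forall xi, r < enorm xi -> chi xi = 1.
Hypothesis HN : forall N : nat, eucl_symbol (m - Z.of_nat N)
      (fun x xi => (s x xi - chi xi * csum N (fun j => h j x xi))%C).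

Let rem (N : nat) : R2 -> R2 -> C := fun x xi => (s x xi - chi xi * csum N (fun j => h j x xi))%C.

Lemma h_smooth_A0 j : smooth_A0_on nonzero (flip2 (h j)).
Proof.
  destruct (Hh j) as [H1 [H2 _]]. apply smooth_A0_of_eucl; [apply open_nonzero| |exact H2].
  intros xi Hxi. now apply H1.
Qed.

(** Where [chi = 1], the remainder of order [N] is the one of order [N + 1] plus the
    homogeneous term, so the latter is the radial limit of the former. *)
Lemma remainder_limit N xi : nonzero xi ->
  A0inf_lim (Rbar_locally p_infty)
    (fun l x => (powerRZ l (- (m - Z.of_nat N)) * flip2 (rem N) (dilate l xi) x)%C) (flip2 (h N) xi).
Proof.
  intros Hxi. set (q := (m - Z.of_nat N)%Z).
  assert (Sr : forall k eta, smooth_T2 (flip2 (rem k) eta)).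
  { intros k eta. apply (eucl_symbol_smooth_A0 _ _ (HN k) []); [apply incl_nil_l|easy]. }
  assert (Sh : smooth_T2 (flip2 (h N) xi)).
  { apply (h_smooth_A0 N []); [apply incl_nil_l|auto]. }
  apply (A0inf_lim_dirs (Rbar_locally p_infty)); auto.
  { apply filter_forall. intros l. now apply smooth_T2_scal. }
  intros i j e He.
  destruct (HN (S N)) as [_ [_ HB]]. destruct (HB i j 0%nat 0%nat) as [K [HK B]]. clear HB.
  destruct Hchi as [r Hr].
  pose proof (enorm_nonzero xi Hxi) as Hpos.
  (* Bounds the (q - 1)-th power of the ratio of [japanese (dilate l xi)] to l, uniformly in l,
     since this ratio lies between |xi| and the weight of xi. *)
  set (Q := powerRZ (enorm xi) (q - 1) + powerRZ (japanese xi) (q - 1)).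
  assert (HQ : 0 < Q).
  { unfold Q. pose proof (powerRZ_lt (enorm xi) (q - 1) Hpos).
    pose proof (powerRZ_lt (japanese xi) (q - 1) ltac:(pose proof (japanese_ge1 xi); lra)). lra. }
  (* The first threshold puts l xi where [chi] is 1; the second makes K Q / l smaller than e and
     forces l > 1. *)
  exists (Rmax (1 + r / enorm xi) (1 + K * Q / e)). intros l Hl.
  assert (Hl1 : 1 + r / enorm xi < l) by (eapply Rle_lt_trans; [apply Rmax_l|exact Hl]).
  assert (Hl2 : 1 + K * Q / e < l) by (eapply Rle_lt_trans; [apply Rmax_r|exact Hl]).
  assert (P : 0 < K * Q / e) by (apply Rdiv_lt_0_compat; auto; now apply Rmult_lt_0_compat).
  assert (Hl3 : 1 < l) by lra.
  assert (C1 : chi (dilate l xi) = 1).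
  { apply Hr. rewrite enorm_dilate by lra. apply Rlt_div_l; auto. lra. }
  assert (Hlq : RtoC (powerRZ l q) <> 0%C).
  { intros E. apply RtoC_inj in E. pose proof (powerRZ_lt l q). lra. }
  assert (E : (fun x => (powerRZ l (- q) * flip2 (rem N) (dilate l xi) x)%C) =
     fun x => (powerRZ l (- q) * flip2 (rem (S N)) (dilate l xi) x + flip2 (h N) xi x)%C).
  { extensionality x. unfold flip2, rem. rewrite C1. cbn [csum].
    destruct (Hh N) as [_ [_ Hhom]]. rewrite (Hhom l x xi) by (auto; lra). fold q.
    rewrite powerRZ_neg', RtoC_inv by (apply powerRZ_NOR; lra). field. auto. }
  intros x. rewrite E.
  rewrite (dirs_plus basis2 everywhere) by
    (auto using multi2_incl; try easy; try apply open_everywhere; first [apply Sh|apply smooth_T2_scal, Sr]).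
  rewrite (dirs_scal basis2 everywhere) by
    (auto using multi2_incl; try easy; try apply open_everywhere; apply Sr).
  match goal with |- Cmod (?A + ?B - ?D)%C < _ => change (Cmod (A + B - B)%C < e);
    replace (A + B - B)%C with A by ring end.
  specialize (B x (dilate l xi)). rewrite multi4_split in B.
  assert (B' : Cmod (dirs (multi2 i j) (flip2 (rem (S N)) (dilate l xi)) x)
    <= K * powerRZ (japanese (dilate l xi)) (m - Z.of_nat (S N) - Z.of_nat (0 + 0))).
  { eapply Rle_trans; [|exact B]. right. apply (f_equal Cmod). symmetry.
    exact (dirs_i1_i2 (multi2 i j) (multi2 0 0) (flip2 (rem (S N))) x (dilate l xi)). }
  clear B.
  rewrite Cmod_mult, Cmod_R, Rabs_pos_eq by (apply powerRZ_le; lra).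
  replace (m - Z.of_nat (S N) - Z.of_nat (0 + 0))%Z with (q - 1)%Z in B' by (unfold q; lia).
  set (J := japanese (dilate l xi)) in *.
  assert (HJ : enorm xi <= J / l <= japanese xi).
  { unfold J. split.
    - apply Rle_div_r; [lra|]. rewrite Rmult_comm, <- enorm_dilate by lra. apply enorm_le_japanese.
    - apply Rle_div_l; [lra|].
      pose proof (japanese_sqr (dilate l xi)) as J1. pose proof (japanese_sqr xi) as J2.
      replace (dot (dilate l xi) (dilate l xi)) with (l ^ 2 * dot xi xi) in J1 by (unfold dot, dilate; cbn; ring).
      pose proof (japanese_ge1 xi). pose proof (japanese_ge1 (dilate l xi)).
      pose proof (dot_self_pos xi).
      assert (L2 : 1 <= l ^ 2) by nra.
      apply Rsqr_incr_0_var; [|nra]. rewrite !Rsqr_pow2, Rpow_mult_distr, J1, J2. nra. }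
  eapply Rle_lt_trans; [apply Rmult_le_compat_l; [apply powerRZ_le; lra|exact B']|].
  replace J with (J / l * l) by (field; lra). rewrite powerRZ_mult.
  pose proof (powerRZ_le_between _ _ _ (q - 1) Hpos HJ) as PB. fold Q in PB.
  (* The next remainder has order q - 1, so after rescaling by l^(-q) only 1 / l is left. *)
  assert (Ll : powerRZ l (- q) * powerRZ l (q - 1) = / l).
  { rewrite <- powerRZ_add by lra. replace (- q + (q - 1))%Z with (- 1)%Z by lia.
    simpl. field. lra. }
  replace (powerRZ l (- q) * (K * (powerRZ (J / l) (q - 1) * powerRZ l (q - 1))))
    with (K * powerRZ (J / l) (q - 1) * / l) by (rewrite <- Ll; ring).
  apply Rle_lt_trans with (K * Q * / l).
  - apply Rmult_le_compat_r; [apply Rlt_le, Rinv_0_lt_compat; lra|]. apply Rmult_le_compat_l; lra.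
  - apply Rlt_div_l; [lra|]. assert (H : K * Q / e < l) by lra. apply Rlt_div_l in H; lra.
Qed.

Lemma remainder_nc_symbol N : nc_symbol (m - Z.of_nat N) (flip2 (rem N)).
Proof.
  split; [|split].
  - apply (eucl_symbol_smooth_A0 _ _ (HN N)).
  - apply (eucl_symbol_nc_bound _ _ (HN N)).
  - exists (flip2 (h N)). split; [apply h_smooth_A0|apply remainder_limit].
Qed.
End Remainder.

Lemma eucl_classical_nc m s h : eucl_classical m s h -> nc_classical m (flip2 s) (fun j => flip2 (h j)).
Proof.
  intros [Hs [Hh [chi [Hchi HN]]]].
  pose proof (remainder_nc_symbol m s h chi Hh (proj2 (proj2 Hchi)) HN) as R.
  split; [|split].
  (* The symbol is the remainder with no term subtracted, so its radial limit is the leading term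
     [h 0]. *)
  - specialize (R 0%nat). cbn [csum] in R.
    replace (m - Z.of_nat 0)%Z with m in R by lia.
    replace (flip2 s) with (flip2 (fun x xi => s x xi - chi xi * 0)%C); auto.
    extensionality xi. extensionality x.
    unfold flip2. ring.
  - intros j. split; [exact (h_smooth_A0 m h Hh j)|].
    intros l xi x Hl Hxi. now apply (proj2 (proj2 (Hh j))).
  - exists chi. split; [exact Hchi|exact R].
Qed.

Lemma eucl_symbol_scal c m s : eucl_symbol m s -> eucl_symbol m (fun x xi => c * s x xi)%C.
Proof.
  intros [H1 [H2 H3]]. split; [|split].
  - intros xi x y. now rewrite (proj1 (H1 xi x y)), (proj2 (H1 xi x y)).
  - apply (smooth_scal basis4 everywhere (open_everywhere _) (uncurry4 s) c H2).
  - intros a1 a2 b1 b2. destruct (H3 a1 a2 b1 b2) as [K [HK B]].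
    exists ((Cmod c + 1) * K). pose proof (Cmod_ge_0 c). split; [apply Rmult_lt_0_compat; lra|]. intros x xi.
    assert (E : dirs (multi4 a1 a2 b1 b2) (uncurry4 (fun x xi => c * s x xi)%C) (x, xi) =
      (c * dirs (multi4 a1 a2 b1 b2) (uncurry4 s) (x, xi))%C).
    { apply (dirs_scal basis4 everywhere (open_everywhere _) (uncurry4 s) c); try easy.
      rewrite multi4_split. apply incl_app; [apply incl_i1|apply incl_i2]; apply multi2_incl. }
    rewrite E, Cmod_mult. specialize (B x xi).
    pose proof (powerRZ_lt (japanese xi) (m - Z.of_nat (b1 + b2)) ltac:(pose proof (japanese_ge1 xi); lra)).
    pose proof (Cmod_ge_0 (dirs (multi4 a1 a2 b1 b2) (uncurry4 s) (x, xi))). 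
    rewrite Rmult_assoc. apply Rmult_le_compat; auto; lra.
Qed.

Lemma eucl_classical_scal c m s h : eucl_classical m s h ->
  eucl_classical m (fun x xi => c * s x xi)%C (fun j x xi => c * h j x xi)%C.
Proof.
  intros [Hs [Hh [chi [Hchi HN]]]]. split; [|split].
  - now apply eucl_symbol_scal.
  - intros j. destruct (Hh j) as [H1 [H2 H3]]. split; [|split].
    + intros xi Hxi x y. now rewrite (proj1 (H1 xi Hxi x y)), (proj2 (H1 xi Hxi x y)).
    + apply (smooth_scal basis4 (fun p => nonzero (snd p)) (open_Om4 nonzero open_nonzero) (uncurry4 (h j)) c H2).
    + intros l x xi Hl Hxi. rewrite H3 by auto. ring.
  - exists chi. split; auto. intros N. specialize (HN N).
    apply (eucl_symbol_scal c) in HN.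
    match goal with |- eucl_symbol _ ?f => match type of HN with eucl_symbol _ ?g => replace f with g; [exact HN|] end end.
    extensionality x. extensionality xi.
    rewrite csum_scal. ring.
Qed.

(** * Regularized oscillatory integrals *)

Notation J := integral_R.

Lemma int_R2_II2 f : int_R2 f = II2 J (fun u w => f (u, w)).
Proof.
  unfold int_R2, II2. refine (eq_trans _ (eq_sym (integral_R_E _))). apply (f_equal int_R).
  extensionality u. symmetry. apply integral_R_E.
Qed.

Lemma int_R2_translate (f : R2 -> C) (b : R2) : int_R2 (fun y => f (plus y b)) = int_R2 f.
Proof.
  destruct b as [b1 b2]. unfold int_R2.
  transitivity (int_R (fun u => (fun u => int_R (fun w => f (u, w))) (u + b1))).
  - apply (f_equal int_R). extensionality u. cbv beta.
    exact (int_R_translate (fun w => f (u + b1, w)) b2).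
  - exact (int_R_translate (fun u => int_R (fun w => f (u, w))) b1).
Qed.

Definition affine (a : R) (b t : R2) : R2 := (a * fst t + fst b, a * snd t + snd b).

Lemma int_R2_affine (f : R2 -> C) a b K : 0 < a ->
  dominated2 (wt J) K (fun u w => f (affine a b (u, w))) ->
  int_R2 f = (RtoC (a ^ 2) * int_R2 (fun t => f (affine a b t)))%C.
Proof.
  intros Ha D. rewrite !int_R2_II2. destruct b as [b1 b2]. unfold affine in *. cbn [fst snd] in *.
  pose proof (dom2_outer J _ _ D) as D2.
  set (g := fun u => J (fun w => f (u, w))).
  assert (Eg : (fun u => g (a * u + b1)) = (fun u => a * J (fun w => f (a * u + b1, a * w + b2)%R))%C).
  { extensionality u.
    apply (integral_R_affine (fun w => f (a * u + b1, w)) a b2 K); auto.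
    exact (dom2_inner1 J K _ u D). }
  assert (D3 : dominated (wt J) (Cmod (RtoC a) * (mass J * K)) (fun u => g (a * u + b1))).
  { rewrite Eg. now apply dom_scal. }
  change (II2 J (fun u w => f (u, w))) with (II J g).
  rewrite (integral_R_affine g a b1 _ Ha D3), Eg, (II_scal J _ _ _ D2).
  rewrite Cmult_assoc, <- RtoC_mult. unfold II2. f_equal. f_equal. ring.
Qed.

Definition dominated4 (K : R) (G : R2 -> R2 -> C) : Prop :=
  (forall p : R2 * R2, continuous (fun p : R2 * R2 => G (fst p) (snd p)) p) /\
  forall eta t, Cmod (G eta t) <= K * bump (fst eta) * bump (snd eta) * bump (fst t) * bump (snd t).

Definition II4 (G : R2 -> R2 -> C) : C := int_R2 (fun eta => int_R2 (fun t => G eta t)).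

Lemma bump2_le1 a b : 0 < bump a * bump b <= 1.
Proof.
  pose proof (bump_pos a). pose proof (bump_pos b). pose proof (bump_le1 a). pose proof (bump_le1 b).
  split; nra.
Qed.

Lemma dom4_pos K G : dominated4 K G -> 0 <= K.
Proof.
  intros [_ H]. specialize (H (0, 0) (0, 0)). cbn in H. pose proof (Cmod_ge_0 (G (0, 0) (0, 0))).
  pose proof (bump_pos 0) as B. assert (0 < bump 0 * bump 0 * bump 0 * bump 0) by (repeat apply Rmult_lt_0_compat; auto).
  destruct (Rle_or_lt 0 K); auto. nra.
Qed.

Lemma dom4_inner K G eta : dominated4 K G ->
  dominated2 (wt J) (K * bump (fst eta) * bump (snd eta)) (fun u w => G eta (u, w)).
Proof.
  intros [H1 H2]. split.
  - intros p. apply (continuous_comp (fun p : R2 => (eta, (fst p, snd p))) (fun p : R2 * R2 => G (fst p) (snd p))); [|apply H1].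
    cts.
  - intros u w. rewrite !wt_R. exact (H2 eta (u, w)).
Qed.

Lemma dom4_inner1 K G eta : dominated4 K G -> dominated2 (wt J) K (fun u w => G eta (u, w)).
Proof.
  intros H. pose proof (dom4_pos _ _ H) as HK. destruct (dom4_inner K G eta H) as [H1 H2]. split; auto.
  intros u w. eapply Rle_trans; [apply H2|]. rewrite !wt_R.
  pose proof (bump2_le1 (fst eta) (snd eta)). pose proof (bump2_le1 u w).
  replace (K * bump (fst eta) * bump (snd eta) * bump u * bump w)
    with (K * (bump u * bump w) * (bump (fst eta) * bump (snd eta))) by ring.
  assert (0 <= K * (bump u * bump w)) by (apply Rmult_le_pos; lra). nra.
Qed.

Lemma dom4_outer K G : dominated4 K G ->
  dominated2 (wt J) (PI * PI * K) (fun a b => int_R2 (fun t => G (a, b) t)).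
Proof.
  intros H. split.
  - intros p.
    apply (continuous_ext (fun p : R2 => II2 J (fun u w => G (fst p, snd p) (u, w)))).
    { intros q. symmetry. apply int_R2_II2. }
    apply (II2_param J (prod_UniformSpace R_UniformSpace R_UniformSpace) (fun p u w => G (fst p, snd p) (u, w)) K).
    + intros t. now apply dom4_inner1.
    + intros [[q u] w].
      apply (continuous_comp (fun p : R2 * R * R => ((fst (fst (fst p)), snd (fst (fst p))), (snd (fst p), snd p)))
        (fun p : R2 * R2 => G (fst p) (snd p))); [|apply H]. cts.
  - intros a b. rewrite int_R2_II2. eapply Rle_trans; [apply II2_bound, (dom4_inner K G (a, b) H)|].
    rewrite mass_R, !wt_R. cbn [fst snd]. right. ring.
Qed.

Lemma II4_bound K G : dominated4 K G -> Cmod (II4 G) <= PI ^ 4 * K.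
Proof.
  intros H. unfold II4. rewrite int_R2_II2. eapply Rle_trans; [apply II2_bound, (dom4_outer K G H)|].
  rewrite mass_R. right. ring.
Qed.

Lemma II4_plus K L F G : dominated4 K F -> dominated4 L G ->
  II4 (fun eta t => F eta t + G eta t)%C = (II4 F + II4 G)%C.
Proof.
  intros HF HG. unfold II4. rewrite !int_R2_II2.
  rewrite <- (II2_plus J _ _ _ _ (dom4_outer _ _ HF) (dom4_outer _ _ HG)).
  f_equal. extensionality a. extensionality b.
  rewrite !int_R2_II2. exact (II2_plus J _ _ _ _ (dom4_inner1 _ _ (a, b) HF) (dom4_inner1 _ _ (a, b) HG)).
Qed.

Lemma II4_scal K c F : dominated4 K F -> II4 (fun eta t => c * F eta t)%C = (c * II4 F)%C.
Proof.
  intros HF. unfold II4. rewrite !int_R2_II2.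
  rewrite <- (II2_scal J _ c _ (dom4_outer _ _ HF)).
  f_equal. extensionality a. extensionality b.
  rewrite !int_R2_II2. exact (II2_scal J _ c _ (dom4_inner1 _ _ (a, b) HF)).
Qed.

(** ** Schwartz functions *)

(** The Schwartz condition for derivatives in every order instead of sorted ones: in this form the
    class is visibly closed under derivatives, as [FT_decay] requires. *)
Definition rapid (phi : R4 -> C) : Prop :=
  smooth_on basis4 everywhere phi /\
  forall l, incl l basis4 -> forall N : nat, exists K, forall p : R4,
    (1 + enorm (fst p) + enorm (snd p)) ^ N * Cmod (dirs l phi p) <= K.

Lemma basis4_perm l : incl l basis4 -> exists a b c d, Permutation l (multi4 a b c d).
Proof.
  induction l as [|v l IH]; intros Hl.
  - exists 0%nat, 0%nat, 0%nat, 0%nat. constructor.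
  - destruct IH as [a [b [c [d H]]]]; [intros w Hw; apply Hl; now right|].
    assert (H' : Permutation (v :: l) (v :: multi4 a b c d)) by now constructor.
    destruct (Hl v (or_introl eq_refl)) as [<-|[<-|[<-|[<-|[]]]]].
    + exists (S a), b, c, d. exact H'.
    + exists a, (S b), c, d. eapply Permutation_trans; [exact H'|]. unfold multi4. cbn [repeat].
      apply Permutation_middle.
    + exists a, b, (S c), d. eapply Permutation_trans; [exact H'|]. unfold multi4. cbn [repeat].
      pose proof (Permutation_middle (repeat f1 a ++ repeat f2 b) (repeat f3 c ++ repeat f4 d) f3) as P.
      rewrite <- !app_assoc in P. exact P.
    + exists a, b, c, (S d). eapply Permutation_trans; [exact H'|]. unfold multi4. cbn [repeat].
      pose proof (Permutation_middle (repeat f1 a ++ repeat f2 b ++ repeat f3 c) (repeat f4 d) f4) as P.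
      rewrite <- !app_assoc in P. exact P.
Qed.

Lemma schwartz_rapid phi : schwartz phi -> rapid phi.
Proof.
  intros [H1 H2]. split; auto. intros l Hl N.
  destruct (basis4_perm l Hl) as [a [b [c [d Hp]]]].
  destruct (H2 a b c d N) as [K HK]. exists K. intros p.
  rewrite (dirs_perm basis4 everywhere (open_everywhere _) phi l (multi4 a b c d) H1 Hp Hl p I). apply HK.
Qed.

Lemma rapid_dirs l phi : incl l basis4 -> rapid phi -> rapid (dirs l phi).
Proof.
  intros Hl [H1 H2]. split; [now apply smooth_on_dirs|]. intros l' Hl' N.
  destruct (H2 (l' ++ l)) with (N := N) as [K HK]; [now apply incl_app|].
  exists K. intros p. rewrite <- dirs_app. apply HK.
Qed.

Lemma rapid_minus phi psi : rapid phi -> rapid psi -> rapid (fun p => phi p - psi p)%C.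
Proof.
  intros [H1 H2] [H3 H4].
  assert (E : (fun p => phi p - psi p)%C = (fun p => phi p + (-1) * psi p)%C)
    by (apply functional_extensionality; intros; ring).
  rewrite E. 
  assert (H5 : smooth_on basis4 everywhere (fun p => (-1) * psi p)%C)
    by (apply smooth_scal; auto; apply open_everywhere).
  split.
  - apply smooth_plus; auto. apply open_everywhere.
  - intros l Hl N. destruct (H2 l Hl N) as [K HK], (H4 l Hl N) as [L HL]. exists (K + L). intros p.
    assert (E2 : dirs l (fun p => phi p + (-1) * psi p)%C p = (dirs l phi p + (-1) * dirs l psi p)%C).
    { refine (eq_trans (dirs_plus basis4 everywhere (open_everywhere _) phi _ l H1 H5 Hl p I) _).
      exact (f_equal (Cplus _) (dirs_scal basis4 everywhere (open_everywhere _) psi _ l H3 Hl p I)). }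
    specialize (HK p). specialize (HL p).
    assert (P : 0 <= (1 + enorm (fst p) + enorm (snd p)) ^ N).
    { apply pow_le. pose proof (enorm_pos (fst p)). pose proof (enorm_pos (snd p)). lra. }
    pose proof (Cmod_triangle (dirs l phi p) ((-1) * dirs l psi p)) as T. rewrite Cmod_mult in T.
    replace (Cmod (-1)) with 1 in T by (rewrite Cmod_R, Rabs_left; lra).
    eapply Rle_trans; [apply Rmult_le_compat_l; [exact P|right; exact (f_equal Cmod E2)]|]. nra.
Qed.

Lemma abs_fst_enorm x : fst x ^ 2 <= enorm x ^ 2.
Proof. rewrite enorm_sqr. unfold dot. nra. Qed.
Lemma abs_snd_enorm x : snd x ^ 2 <= enorm x ^ 2.
Proof. rewrite enorm_sqr. unfold dot. nra. Qed.

(** A product weight instead of a power of the Euclidean norm: its inverse at exponent 1 is the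
    product of two bumps, and it is the factor that [FT_decay] produces. *)
Definition weight (M : nat) (xi : R2) : R := ((1 + fst xi ^ 2) * (1 + snd xi ^ 2)) ^ M.

Lemma weight_ge1 M xi : 1 <= weight M xi.
Proof. apply pow_R1_Rle. assert (0 <= fst xi ^ 2) by nra. assert (0 <= snd xi ^ 2) by nra. nra. Qed.

Lemma weight_inv xi : / weight 1 xi = bump (fst xi) * bump (snd xi).
Proof. unfold weight, bump. rewrite pow_1, Rinv_mult. reflexivity. Qed.

Lemma weight_add M N xi : weight (M + N) xi = weight M xi * weight N xi.
Proof. apply pow_add. Qed.

Lemma rapid_weight phi M : rapid phi -> exists K, 0 <= K /\ forall t z,
  weight 1 t * weight M z * Cmod (phi (t, z)) <= K.
Proof.
  (* Each product (1 + a^2) (1 + b^2) of two coordinates is at most the fourth power of 1 + |t| +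
     |z|, hence exponent 4 for t and 4 M for z. *)
  intros [_ H]. destruct (H [] (incl_nil_l _) (4 + 4 * M)%nat) as [K HK]. exists K.
  assert (W : forall t z, weight 1 t * weight M z <= (1 + enorm t + enorm z) ^ (4 + 4 * M)).
  { intros t z. rewrite pow_add, (pow_mult _ 4 M). unfold weight. rewrite pow_1.
    pose proof (enorm_pos t). pose proof (enorm_pos z).
    pose proof (abs_fst_enorm t). pose proof (abs_snd_enorm t).
    pose proof (abs_fst_enorm z). pose proof (abs_snd_enorm z).
    set (X := 1 + enorm t + enorm z) in *.
    assert (X2 : 1 + enorm t ^ 2 + enorm z ^ 2 <= X ^ 2) by (unfold X; nra).
    assert (0 <= fst t ^ 2) by nra. assert (0 <= snd t ^ 2) by nra.
    assert (0 <= fst z ^ 2) by nra. assert (0 <= snd z ^ 2) by nra.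
    assert (A : forall a b, 0 <= a -> 0 <= b -> 1 + a <= X ^ 2 -> 1 + b <= X ^ 2 -> (1 + a) * (1 + b) <= X ^ 4).
    { intros a b Ha Hb Ha' Hb'. replace (X ^ 4) with (X ^ 2 * X ^ 2) by ring. apply Rmult_le_compat; lra. }
    apply Rmult_le_compat.
    - nra.
    - apply pow_le. nra.
    - apply A; nra.
    - apply pow_incr. split; [nra|]. apply A; nra. }
  split.
  - eapply Rle_trans; [|apply (HK ((0, 0), (0, 0)))]. apply Rmult_le_pos; [|apply Cmod_ge_0].
    apply pow_le. pose proof (enorm_pos (0, 0)). cbn [fst snd]. lra.
  - intros t z. eapply Rle_trans; [|apply (HK (t, z))]. apply Rmult_le_compat_r; [apply Cmod_ge_0|].
    apply W.
Qed.

Definition amplitude (M : nat) (B : R) (A : R2 -> R2 -> C) : Prop :=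
  (forall p : R2 * R2, continuous (fun p : R2 * R2 => A (fst p) (snd p)) p) /\
  forall s xi, Cmod (A s xi) <= B * weight M xi.

(** The substitution y = s0 + t / eps, xi = k + eps eta. *)
Definition rescaled (phi : R4 -> C) (p0 : R4) (eps : R) (k : R2) (A : R2 -> R2 -> C) : R2 -> R2 -> C :=
  fun eta t => (phi (t, affine (eps * eps) (eps * (fst k - fst (snd p0)), eps * (snd k - snd (snd p0)))%R eta)
    * A (affine (/ eps) (fst p0) t) (affine eps k eta))%C.

Lemma affine_square_le a b z : 1 + (a * z + b) ^ 2 <= 2 * (1 + a ^ 2) * (1 + b ^ 2) * (1 + z ^ 2).
Proof.
  assert (H : (a * z + b) ^ 2 <= 2 * (a * z) ^ 2 + 2 * b ^ 2).
  { pose proof (pow2_ge_0 (a * z - b)). nra. }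
  assert (0 <= a ^ 2) by apply pow2_ge_0. assert (0 <= b ^ 2) by apply pow2_ge_0.
  assert (0 <= z ^ 2) by apply pow2_ge_0. rewrite Rpow_mult_distr in H.
  assert (0 <= a ^ 2 * b ^ 2) by now apply Rmult_le_pos.
  assert (0 <= z ^ 2 * b ^ 2) by now apply Rmult_le_pos.
  assert (0 <= a ^ 2 * z ^ 2) by now apply Rmult_le_pos.
  assert (0 <= a ^ 2 * b ^ 2 * z ^ 2) by now apply Rmult_le_pos. nra.
Qed.

Lemma weight_affine a b M : exists K, 0 < K /\ forall z, weight M (affine a b z) <= K * weight M z.
Proof.
  destruct b as [b1 b2].
  set (c := (2 * (1 + a ^ 2) * (1 + b1 ^ 2)) * (2 * (1 + a ^ 2) * (1 + b2 ^ 2))).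
  assert (Hc : 0 < c).
  { unfold c. pose proof (pow2_ge_0 a). pose proof (pow2_ge_0 b1). pose proof (pow2_ge_0 b2).
    repeat apply Rmult_lt_0_compat; lra. }
  exists (c ^ M). split; [now apply pow_lt|]. intros [z1 z2]. unfold weight, affine. cbn [fst snd].
  rewrite <- Rpow_mult_distr. apply pow_incr.
  pose proof (pow2_ge_0 (a * z1 + b1)). pose proof (pow2_ge_0 (a * z2 + b2)).
  split; [nra|]. unfold c.
  replace (2 * (1 + a ^ 2) * (1 + b1 ^ 2) * (2 * (1 + a ^ 2) * (1 + b2 ^ 2)) * ((1 + z1 ^ 2) * (1 + z2 ^ 2)))
    with ((2 * (1 + a ^ 2) * (1 + b1 ^ 2) * (1 + z1 ^ 2)) * (2 * (1 + a ^ 2) * (1 + b2 ^ 2) * (1 + z2 ^ 2))) by ring.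
  apply Rmult_le_compat; try lra; apply affine_square_le.
Qed.

Lemma affine_inv a b z : a <> 0 -> affine (/ a) (- fst b / a, - snd b / a) (affine a b z) = z.
Proof. intros Ha. destruct z. unfold affine; cbn. f_equal; field; auto. Qed.

(** [phi] decays in z = eps (xi - xi0), and both eta and xi are affine functions of z: M powers of
    the decay pay for the growth of the amplitude in xi, one more gives integrability in eta. The
    constant depends on eps and k but not on the amplitude. *)
Lemma rescaled_dominated phi p0 eps k M : rapid phi -> 0 < eps -> exists K, 0 <= K /\
  forall A B, amplitude M B A -> dominated4 (K * B) (rescaled phi p0 eps k A).
Proof.
  intros Hphi He.
  set (z0 := (eps * (fst k - fst (snd p0)), eps * (snd k - snd (snd p0))) : R2).
  assert (Ha : eps * eps <> 0) by nra.
  destruct (rapid_weight phi (S M) Hphi) as [K [HK HB]].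
  destruct (weight_affine (/ (eps * eps)) (- fst z0 / (eps * eps), - snd z0 / (eps * eps)) 1) as [K1 [HK1 H1]].
  destruct (weight_affine (/ eps) (snd p0) M) as [K2 [HK2 H2]].
  exists (K * K1 * K2). split; [apply Rmult_le_pos; [apply Rmult_le_pos|]; lra|].
  intros A B [Ac Ab]. split.
  - intros [eta t]. unfold rescaled. apply continuous_Cmult.
    + apply (continuous_comp (fun p : R2 * R2 => (snd p, affine (eps * eps) z0 (fst p))) phi).
      * unfold affine. cts.
      * apply (smooth_continuous basis4 everywhere); [apply Hphi|easy].
    + apply (continuous_comp (fun p : R2 * R2 => (affine (/ eps) (fst p0) (snd p), affine eps k (fst p)))
        (fun p : R2 * R2 => A (fst p) (snd p))); [|apply Ac]. unfold affine. cts.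
  - intros eta t. unfold rescaled. fold z0. set (z := affine (eps * eps) z0 eta).
    rewrite Cmod_mult.
    assert (B0 : 0 <= B).
    { specialize (Ab (0, 0) (0, 0)). pose proof (Cmod_ge_0 (A (0, 0) (0, 0))).
      pose proof (weight_ge1 M (0, 0)). nra. }
    assert (W1 : weight 1 eta <= K1 * weight 1 z).
    { rewrite <- (affine_inv (eps * eps) z0 eta Ha) at 1. apply H1. }
    assert (W2 : weight M (affine eps k eta) <= K2 * weight M z).
    { replace (affine eps k eta) with (affine (/ eps) (snd p0) z); [apply H2|].
      unfold z, affine, z0. cbn [fst snd]. f_equal; field; lra. }
    specialize (HB t z). specialize (Ab (affine (/ eps) (fst p0) t) (affine eps k eta)).
    pose proof (weight_ge1 1 t). pose proof (weight_ge1 1 eta). pose proof (weight_ge1 M z).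
    pose proof (weight_ge1 1 z). pose proof (weight_ge1 M (affine eps k eta)).
    pose proof (Cmod_ge_0 (phi (t, z))).
    replace (K * K1 * K2 * B * bump (fst eta) * bump (snd eta) * bump (fst t) * bump (snd t))
      with (K * K1 * K2 * B * / weight 1 eta * / weight 1 t) by (rewrite !weight_inv; ring).
    apply (Rmult_le_reg_r (weight 1 eta * weight 1 t)); [nra|].
    replace (K * K1 * K2 * B * / weight 1 eta * / weight 1 t * (weight 1 eta * weight 1 t))
      with (K * K1 * K2 * B) by (field; split; lra).
    change (S M) with (1 + M)%nat in HB. rewrite weight_add in HB.
    apply Rle_trans with (Cmod (phi (t, z)) * (B * (K2 * weight M z)) * (K1 * weight 1 z * weight 1 t)).
    + apply Rmult_le_compat.
      * apply Rmult_le_pos; apply Cmod_ge_0.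
      * nra.
      * apply Rmult_le_compat_l; auto. eapply Rle_trans; [exact Ab|]. now apply Rmult_le_compat_l.
      * apply Rmult_le_compat_r; lra.
    + replace (Cmod (phi (t, z)) * (B * (K2 * weight M z)) * (K1 * weight 1 z * weight 1 t))
        with ((weight 1 t * (weight 1 z * weight M z) * Cmod (phi (t, z))) * (K1 * K2 * B)) by ring.
      replace (K * K1 * K2 * B) with (K * (K1 * K2 * B)) by ring.
      apply Rmult_le_compat_r; auto. apply Rmult_le_pos; [apply Rmult_le_pos|]; lra.
Qed.

Lemma scal_minus_R4 (eps : R) (y xi : R2) (p0 : R4) : scal eps (minus ((y, xi) : R4) p0) =
  ((eps * (fst y - fst (fst p0)), eps * (snd y - snd (fst p0))),
   (eps * (fst xi - fst (snd p0)), eps * (snd xi - snd (snd p0)))).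
Proof. destruct y, xi, p0 as [[] []]. reflexivity. Qed.

(** The Jacobians eps^(-2) in y and eps^2 in xi cancel. The centre k is free: it is the frequency in
    [regularized_exp_bound] and the origin when only linearity matters. *)
Lemma regularized_rescaled phi p0 eps k M A B : rapid phi -> 0 < eps -> amplitude M B A ->
  regularized phi p0 eps A = II4 (rescaled phi p0 eps k A).
Proof.
  intros Hphi He HA.
  destruct (rescaled_dominated phi p0 eps k M Hphi He) as [K [HK D]]. specialize (D A B HA).
  assert (He' : 0 < / eps) by now apply Rinv_0_lt_compat.
  unfold regularized.
  assert (Ein : forall eta, int_R2 (fun y => phi (scal eps (minus ((y, affine eps k eta) : R4) p0)) * A y (affine eps k eta))%C =
    (RtoC ((/ eps) ^ 2) * int_R2 (fun t => rescaled phi p0 eps k A eta t))%C).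
  { intros eta.
    set (f := fun y => (phi (scal eps (minus ((y, affine eps k eta) : R4) p0)) * A y (affine eps k eta))%C).
    assert (Ef : forall t, f (affine (/ eps) (fst p0) t) = rescaled phi p0 eps k A eta t).
    { intros t. unfold f, rescaled. f_equal. apply (f_equal phi).
      refine (eq_trans (scal_minus_R4 eps _ _ p0) _).
      destruct p0 as [[a1 a2] [c1 c2]], t as [t1 t2], eta as [n1 n2], k as [k1 k2].
      unfold affine. cbn [fst snd].
      f_equal; f_equal; field; lra. }
    refine (eq_trans (int_R2_affine f (/ eps) (fst p0) (K * B) He' _) _).
    - replace (fun u w => f (affine (/ eps) (fst p0) (u, w))) with (fun u w => rescaled phi p0 eps k A eta (u, w)).
      + now apply dom4_inner1.
      + extensionality u. extensionality w. symmetry. apply Ef.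
    - apply (f_equal (Cmult _)), (f_equal int_R2). apply functional_extensionality. exact Ef. }
  assert (Dout : dominated2 (wt J) (Cmod (RtoC ((/ eps) ^ 2)) * (PI * PI * (K * B)))
    (fun a b => RtoC ((/ eps) ^ 2) * int_R2 (fun t => rescaled phi p0 eps k A (a, b) t))%C).
  { apply dom2_scal. exact (dom4_outer _ _ D). }
  refine (eq_trans (int_R2_affine (fun xi => int_R2 (fun y => phi (scal eps (minus ((y, xi) : R4) p0)) * A y xi)%C)
    eps k (Cmod (RtoC ((/ eps) ^ 2)) * (PI * PI * (K * B))) He _) _).
  - match goal with |- dominated2 _ _ ?f => replace f with
      (fun a b => RtoC ((/ eps) ^ 2) * int_R2 (fun t => rescaled phi p0 eps k A (a, b) t))%C; [exact Dout|] end.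
    extensionality a. extensionality b. symmetry. apply Ein.
  - unfold II4.
    transitivity (RtoC (eps ^ 2) * int_R2 (fun eta => RtoC ((/ eps) ^ 2) * int_R2 (fun t => rescaled phi p0 eps k A eta t)))%C.
    + apply (f_equal (Cmult _)), (f_equal int_R2). apply functional_extensionality. exact Ein.
    + rewrite !int_R2_II2. rewrite (II2_scal J _ _ _ (dom4_outer _ _ D)).
      rewrite Cmult_assoc, <- RtoC_mult. replace (eps ^ 2 * (/ eps) ^ 2) with 1 by (field; lra). apply Cmult_1_l.
Qed.

Lemma regularized_plus phi p0 eps M A1 A2 B1 B2 : rapid phi -> 0 < eps -> amplitude M B1 A1 -> amplitude M B2 A2 ->
  amplitude M (B1 + B2) (fun s xi => A1 s xi + A2 s xi)%C /\
  regularized phi p0 eps (fun s xi => A1 s xi + A2 s xi)%C =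
  (regularized phi p0 eps A1 + regularized phi p0 eps A2)%C.
Proof.
  intros Hphi He H1 H2.
  assert (H : amplitude M (B1 + B2) (fun s xi => A1 s xi + A2 s xi)%C).
  { destruct H1 as [C1 D1], H2 as [C2 D2]. split.
    - intros p. apply (continuous_Cplus (fun p : R2 * R2 => A1 (fst p) (snd p)) (fun p : R2 * R2 => A2 (fst p) (snd p))); auto.
    - intros s xi. eapply Rle_trans; [apply Cmod_triangle|]. specialize (D1 s xi). specialize (D2 s xi). lra. }
  split; auto.
  destruct (rescaled_dominated phi p0 eps (0, 0) M Hphi He) as [K [HK D]].
  rewrite (regularized_rescaled phi p0 eps (0, 0) M _ _ Hphi He H),
    (regularized_rescaled phi p0 eps (0, 0) M _ _ Hphi He H1),
    (regularized_rescaled phi p0 eps (0, 0) M _ _ Hphi He H2).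
  rewrite <- (II4_plus _ _ _ _ (D _ _ H1) (D _ _ H2)). f_equal.
  extensionality eta. extensionality t.
  unfold rescaled. ring.
Qed.

Lemma regularized_scal phi p0 eps M c A B : rapid phi -> 0 < eps -> amplitude M B A ->
  amplitude M (Cmod c * B) (fun s xi => c * A s xi)%C /\
  regularized phi p0 eps (fun s xi => c * A s xi)%C = (c * regularized phi p0 eps A)%C.
Proof.
  intros Hphi He H1.
  assert (H : amplitude M (Cmod c * B) (fun s xi => c * A s xi)%C).
  { destruct H1 as [C1 D1]. split.
    - intros p. apply (continuous_Cmult (fun _ => c) (fun p : R2 * R2 => A (fst p) (snd p))); auto. apply continuous_const.
    - intros s xi. rewrite Cmod_mult, Rmult_assoc. apply Rmult_le_compat_l; auto using Cmod_ge_0. }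
  split; auto.
  destruct (rescaled_dominated phi p0 eps (0, 0) M Hphi He) as [K [HK D]].
  rewrite (regularized_rescaled phi p0 eps (0, 0) M _ _ Hphi He H),
    (regularized_rescaled phi p0 eps (0, 0) M _ _ Hphi He H1).
  rewrite <- (II4_scal _ _ _ (D _ _ H1)). f_equal.
  extensionality eta. extensionality t.
  unfold rescaled. ring.
Qed.

Lemma regularized_minus phi p0 eps M A1 A2 B1 B2 : rapid phi -> 0 < eps -> amplitude M B1 A1 -> amplitude M B2 A2 ->
  amplitude M (B1 + B2) (fun s xi => A1 s xi - A2 s xi)%C /\
  regularized phi p0 eps (fun s xi => A1 s xi - A2 s xi)%C =
  (regularized phi p0 eps A1 - regularized phi p0 eps A2)%C.
Proof.
  intros Hphi He H1 H2.
  destruct (regularized_scal phi p0 eps M (-1)%C A2 B2 Hphi He H2) as [H3 E3].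
  destruct (regularized_plus phi p0 eps M A1 _ B1 _ Hphi He H1 H3) as [H4 E4].
  replace (Cmod (-1) * B2) with B2 in H4 by (rewrite Cmod_R, Rabs_left; lra).
  replace (fun s xi => A1 s xi - A2 s xi)%C with (fun s xi => A1 s xi + (-1) * A2 s xi)%C
    by (apply functional_extensionality; intros s; apply functional_extensionality; intros xi; ring).
  split; auto. rewrite E4, E3. ring.
Qed.

(** The crude bound, with a constant depending on eps; it is applied only while eps is fixed. *)
Lemma regularized_bound phi p0 eps M : rapid phi -> 0 < eps -> exists K, 0 <= K /\
  forall A B, amplitude M B A -> Cmod (regularized phi p0 eps A) <= K * B.
Proof.
  intros Hphi He. destruct (rescaled_dominated phi p0 eps (0, 0) M Hphi He) as [K [HK D]].
  exists (PI ^ 4 * K). pose proof PI_RGT_0. split; [apply Rmult_le_pos; auto; apply pow_le; lra|].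
  intros A B HA. rewrite (regularized_rescaled phi p0 eps (0, 0) M _ _ Hphi He HA), Rmult_assoc.
  apply II4_bound. now apply D.
Qed.

Lemma rapid_dominated phi : rapid phi -> exists K, 0 <= K /\
  forall z, dominated2 (wt J) K (fun u w => phi ((u, w), z)).
Proof.
  intros H. destruct (rapid_weight phi 0 H) as [K [HK B]]. exists K. split; auto. intros z. split.
  - intros p. apply (continuous_comp (fun p : R2 => ((fst p, snd p), z)) phi); [cts|].
    apply (smooth_continuous basis4 everywhere); [apply H|easy].
  - intros u w. specialize (B (u, w) z). unfold weight at 2 in B. rewrite pow_O, Rmult_1_r in B.
    rewrite (wt_R u), (wt_R w), Rmult_assoc. change (bump u * bump w) with (bump (fst (u, w)) * bump (snd (u, w))).
    rewrite <- weight_inv. pose proof (weight_ge1 1 (u, w)).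
    apply Rle_div_r; lra.
Qed.

(** [FT_decay] over the line in the first variable of [phi], with the second variable as index: the
    decay is uniform in z, which moves with eps. *)
Lemma rapid_FT phi P : rapid phi -> exists D, 0 <= D /\ forall z a b,
  weight P (a, b) * Cmod (FT J (fun u w => phi ((u, w), z)) a b) <= D.
Proof.
  intros Hphi.
  set (unc3 := fun (F : R2 -> R -> R -> C) (p : R4) => F (snd p) (fst (fst p)) (snd (fst p))).
  destruct (FT_decay J (Z := R2) (fun F => rapid (unc3 F))
    (fun F z u w => dir f1 (unc3 F) ((u, w), z)) (fun F z u w => dir f2 (unc3 F) ((u, w), z))
    (fun _ => True)) with (p := P) (q := P) (f := fun (z : R2) u w => phi ((u, w), z)) as [K HK].
  - intros F HF. destruct (rapid_dominated _ HF) as [K [_ HK]]. exists K. exact HK.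
  - intros F G HF HG. exact (rapid_minus _ _ HF HG).
  - intros F HF. replace (unc3 _) with (dir f1 (unc3 F)).
    + apply (rapid_dirs [f1]); auto. intros v [<-|[]]. now left.
    + apply functional_extensionality. now intros [[] ].
  - intros F HF. replace (unc3 _) with (dir f2 (unc3 F)).
    + apply (rapid_dirs [f2]); auto. intros v [<-|[]]. right; now left.
    + apply functional_extensionality. now intros [[] ].
  - intros F HF z u w.
    refine (eq_ind_r (fun d => cder (fun u => F z u w) u d) _ (dir_i1 e1 (unc3 F) (u, w) z)).
    apply (cder_e1 (fun x => unc3 F (x, z)) u w).
    apply (proj1 (derivable_i1 e1 (unc3 F) (u, w) z)).
    apply (smooth_derivable basis4 everywhere); [apply HF|now left|easy].
  - intros F HF z u w.
    refine (eq_ind_r (fun d => cder (fun w => F z u w) w d) _ (dir_i1 e2 (unc3 F) (u, w) z)).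
    apply (cder_e2 (fun x => unc3 F (x, z)) u w).
    apply (proj1 (derivable_i1 e2 (unc3 F) (u, w) z)).
    apply (smooth_derivable basis4 everywhere); [apply HF|right; now left|easy].
  - intros. apply bdry_R.
  - intros. apply bdry_R.
  - replace (unc3 _) with phi; auto. apply functional_extensionality. now intros [[] ].
  - exists (Rabs K). split; [apply Rabs_pos|]. intros z a b.
    unfold weight. cbn [fst snd]. rewrite Rpow_mult_distr.
    eapply Rle_trans; [apply (HK z a b I I)|apply Rle_abs].
Qed.

(** The exponent of e^{-i s.xi} multiplied by the character e^{i s.k}. *)
Definition phase (s xi k : R2) : R := - (fst s * (fst xi - fst k) + snd s * (snd xi - snd k)).

Lemma phase_amplitude k (tau : R2 -> C) B M : (forall xi, continuous tau xi) ->
  (forall xi, Cmod (tau xi) <= B * weight M xi) ->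
  amplitude M B (fun s xi => cis (phase s xi k) * tau xi)%C.
Proof.
  intros Hc HB. split.
  - intros p. apply continuous_Cmult.
    + unfold phase. cts.
    + apply (continuous_comp (fun p : R2 * R2 => snd p) tau); [cts|apply Hc].
  - intros s xi. rewrite Cmod_mult, Cmod_cis, Rmult_1_l. apply HB.
Qed.

(** An inequality of Peetre type: each coordinate costs a factor 2, and eps <= 1 makes the constant
    independent of eps. *)
Lemma weight_shift eps k eta M : 0 < eps <= 1 ->
  weight M (affine eps k eta) <= 4 ^ M * weight M k * weight M eta.
Proof.
  intros He. unfold weight. rewrite <- !Rpow_mult_distr. apply pow_incr.
  assert (W : forall a b, 1 + (eps * a + b) ^ 2 <= 2 * ((1 + b ^ 2) * (1 + a ^ 2))).
  { intros a b.
    assert (H : (eps * a + b) ^ 2 <= 2 * (eps * a) ^ 2 + 2 * b ^ 2).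
    { pose proof (pow2_ge_0 (eps * a - b)). nra. }
    assert (eps ^ 2 <= 1) by nra.
    pose proof (pow2_ge_0 a). pose proof (pow2_ge_0 b). rewrite Rpow_mult_distr in H.
    assert (0 <= a ^ 2 * b ^ 2) by now apply Rmult_le_pos. nra. }
  unfold affine. cbn [fst snd].
  pose proof (W (fst eta) (fst k)). pose proof (W (snd eta) (snd k)).
  pose proof (pow2_ge_0 (eps * fst eta + fst k)). pose proof (pow2_ge_0 (eps * snd eta + snd k)).
  split; [nra|].
  replace (4 * ((1 + fst k ^ 2) * (1 + snd k ^ 2)) * ((1 + fst eta ^ 2) * (1 + snd eta ^ 2)))
    with ((2 * ((1 + fst k ^ 2) * (1 + fst eta ^ 2))) * (2 * ((1 + snd k ^ 2) * (1 + snd eta ^ 2)))) by ring.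
  apply Rmult_le_compat; lra.
Qed.

(** For a single frequency [k], the inner integral is the Fourier transform of the
    regularization in its first variable, which concentrates at [xi = k] at scale [eps]. *)
Lemma regularized_exp_bound phi p0 M : rapid phi -> exists K, 0 <= K /\
  forall eps k tau B, 0 < eps <= 1 -> (forall xi, continuous tau xi) ->
  (forall xi, Cmod (tau xi) <= B * weight M xi) ->
  Cmod (regularized phi p0 eps (fun s xi => cis (phase s xi k) * tau xi)%C) <= K * (B * weight M k).
Proof.
  (* M powers of the decay in eta absorb the growth of [tau] at k + eps eta; the last one gives
     integrability in eta. *)
  intros Hphi. destruct (rapid_FT phi (M + 1) Hphi) as [D [HD BD]].
  destruct (rapid_dominated phi Hphi) as [K0 [HK0 D0]].
  exists (PI * PI * (D * 4 ^ M)). pose proof PI_RGT_0 as HPI.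
  split. { apply Rmult_le_pos; [nra|]. apply Rmult_le_pos; auto. apply pow_le; lra. }
  intros eps k tau B He Hc HB.
  pose proof (phase_amplitude k tau B M Hc HB) as HA.
  rewrite (regularized_rescaled phi p0 eps k M _ B Hphi (proj1 He) HA).
  destruct (rescaled_dominated phi p0 eps k M Hphi (proj1 He)) as [K1 [HK1 D1]].
  specialize (D1 _ B HA).
  set (G := rescaled phi p0 eps k (fun s xi => cis (phase s xi k) * tau xi)%C) in *.
  set (zeta := fun eta => affine (eps * eps) (eps * (fst k - fst (snd p0)), eps * (snd k - snd (snd p0))) eta).
  assert (E : forall eta, int_R2 (fun t => G eta t) =
    (cis (- (eps * (fst (fst p0) * fst eta + snd (fst p0) * snd eta))) * tau (affine eps k eta) *
      FT J (fun u w => phi ((u, w), zeta eta)) (fst eta) (snd eta))%C).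
  { intros eta. rewrite int_R2_II2, (FT_II2 J K0) by apply D0.
    assert (D2 : dominated2 (wt J) K0 (fun u w => phi ((u, w), zeta eta) * cis (- (u * fst eta + w * snd eta)))%C).
    { apply (dom2_mult J K0 (fun u w => phi ((u, w), zeta eta)) (fun u w => cis (- (u * fst eta + w * snd eta)))); auto.
      - intros p. cts.
      - intros u w. rewrite Cmod_cis. lra. }
    rewrite <- (II2_scal J _ _ _ D2). apply (f_equal (II2 J)).
    extensionality u. extensionality w.
    unfold G, rescaled. fold (zeta eta).
    (* The scales 1 / eps and eps cancel in the product of s and xi - k. The base point leaves only
       a unimodular factor that does not depend on t. *)
    assert (Ep : phase (affine (/ eps) (fst p0) (u, w)) (affine eps k eta) k =
      - (eps * (fst (fst p0) * fst eta + snd (fst p0) * snd eta)) + - (u * fst eta + w * snd eta)).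
    { unfold phase, affine. cbn [fst snd]. field. lra. }
    rewrite Ep, cis_plus. ring. }
  unfold II4. rewrite int_R2_II2.
  replace (PI * PI * (D * 4 ^ M) * (B * weight M k)) with (mass J * mass J * (D * 4 ^ M * (B * weight M k)))
    by (rewrite mass_R; ring).
  apply II2_bound. split; [apply (dom4_outer _ _ D1)|].
  intros a b. rewrite E. cbn [fst snd].
  rewrite !Cmod_mult, Cmod_cis, Rmult_1_l, (wt_R a), (wt_R b).
  specialize (BD (zeta (a, b)) a b). specialize (HB (affine eps k (a, b))).
  pose proof (weight_shift eps k (a, b) M He) as W.
  rewrite weight_add in BD. 
  replace (D * 4 ^ M * (B * weight M k) * bump a * bump b)
    with (D * 4 ^ M * (B * weight M k) * / weight 1 (a, b)) by (rewrite weight_inv; cbn [fst snd]; ring).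
  pose proof (weight_ge1 1 (a, b)). pose proof (weight_ge1 M (a, b)). pose proof (weight_ge1 M k).
  pose proof (weight_ge1 M (affine eps k (a, b))).
  set (X := Cmod (FT J (fun u w => phi (u, w, zeta (a, b))) a b)) in *.
  assert (X0 : 0 <= X) by apply Cmod_ge_0.
  assert (B0 : 0 <= B).
  { pose proof (Cmod_ge_0 (tau (affine eps k (a, b)))). nra. }
  apply (Rmult_le_reg_r (weight 1 (a, b))); [lra|].
  rewrite (Rmult_assoc _ (/ weight 1 (a, b))), Rinv_l, Rmult_1_r by lra.
  apply Rle_trans with (B * (4 ^ M * weight M k * weight M (a, b)) * X * weight 1 (a, b)).
  - apply Rmult_le_compat_r; [lra|]. apply Rmult_le_compat_r; auto.
    eapply Rle_trans; [exact HB|]. apply Rmult_le_compat_l; auto.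
  - replace (B * (4 ^ M * weight M k * weight M (a, b)) * X * weight 1 (a, b))
      with ((weight M (a, b) * weight 1 (a, b) * X) * (4 ^ M * (B * weight M k))) by ring.
    replace (D * 4 ^ M * (B * weight M k)) with (D * (4 ^ M * (B * weight M k))) by ring.
    apply Rmult_le_compat_r; auto. apply Rmult_le_pos; [apply pow_le; lra|].
    apply Rmult_le_pos; lra.
Qed.

Lemma regularized_csum phi p0 eps M n (A : nat -> R2 -> R2 -> C) (B : nat -> R) : rapid phi -> 0 < eps ->
  (forall k, amplitude M (B k) (A k)) ->
  (exists L, amplitude M L (fun s xi => csum n (fun k => A k s xi))) /\
  regularized phi p0 eps (fun s xi => csum n (fun k => A k s xi)) = csum n (fun k => regularized phi p0 eps (A k)).
Proof.
  intros Hphi He HA. induction n as [|n [[L HL] E]]; cbn [csum].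
  - assert (H0 : amplitude M 0 (fun _ _ => 0%C)).
    { split; [intros; apply continuous_const|]. intros. rewrite Cmod_0. lra. }
    split; [now exists 0|].
    destruct (regularized_scal phi p0 eps M 0%C _ 0 Hphi He H0) as [_ E].
    replace (fun _ _ : R2 => RtoC 0) with (fun (_ _ : R2) => (0 * 0)%C).
    + rewrite E. ring.
    + extensionality s. extensionality xi. ring.
  - destruct (regularized_plus phi p0 eps M _ _ _ _ Hphi He HL (HA n)) as [H1 H2].
    split; [now exists (L + B n)|]. rewrite H2, E. reflexivity.
Qed.

Lemma regularized_symsum phi p0 eps M N (A : Z -> R2 -> R2 -> C) (B : Z -> R) : rapid phi -> 0 < eps ->
  (forall k, amplitude M (B k) (A k)) ->
  (exists L, amplitude M L (fun s xi => symsum N (fun k => A k s xi))) /\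
  regularized phi p0 eps (fun s xi => symsum N (fun k => A k s xi)) = symsum N (fun k => regularized phi p0 eps (A k)).
Proof.
  intros Hphi He HA. unfold symsum.
  apply (regularized_csum phi p0 eps M _ (fun k => A (Z.of_nat k - Z.of_nat N)%Z) (fun k => B (Z.of_nat k - Z.of_nat N)%Z)); auto.
Qed.

(** * Lipschitz bounds in the point of the torus and uniform convergence *)

Lemma cis_lipschitz a b : Cmod (cis a - cis b)%C <= 2 * Rabs (a - b).
Proof.
  rewrite <- (Rmult_1_r 2).
  apply (cder_mvt cis (fun t => Ci * RtoC 1 * cis (1 * t + 0))%C b a 1).
  - intros z _. eapply cder_ext; [|apply (cder_cis 1 0 z)]. intros s. cbv beta. f_equal. ring.
  - intros z _. rewrite !Cmod_mult, Cmod_cis, Cmod_R, Rabs_R1, !Rmult_1_r.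
    right. unfold Cmod, Ci; cbn. rewrite <- sqrt_1. f_equal. rewrite sqrt_1. ring.
Qed.

(** Only polynomial growth matters for the oscillatory integrals, so an order of either sign is
    replaced by its absolute value. *)
Lemma powerRZ_japanese_weight m xi : powerRZ (japanese xi) m <= weight (Z.abs_nat m) xi.
Proof.
  pose proof (japanese_ge1 xi) as J1.
  assert (J2 : japanese xi <= (1 + fst xi ^ 2) * (1 + snd xi ^ 2)).
  { pose proof (japanese_sqr xi) as E. unfold dot in E.
    pose proof (pow2_ge_0 (fst xi)). pose proof (pow2_ge_0 (snd xi)).
    assert (0 <= fst xi ^ 2 * snd xi ^ 2) by now apply Rmult_le_pos. nra. }
  unfold weight. destruct m as [|p|p]; cbn [powerRZ Z.abs_nat].
  - cbn. lra.
  - apply pow_incr. lra.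
  - apply Rle_trans with 1.
    + rewrite <- Rinv_1. apply Rinv_le_contravar; [lra|]. now apply pow_R1_Rle.
    + apply pow_R1_Rle. lra.
Qed.

Definition dist1 (x y : R2) : R := Rabs (fst x - fst y) + Rabs (snd x - snd y).

(** The Lipschitz estimate follows a path along the two coordinate directions, using the bounds on
    the two first x-derivatives; one constant is taken for everything. *)
Lemma eucl_symbol_weight m s : eucl_symbol m s -> exists K, 0 < K /\
  (forall x xi, Cmod (s x xi) <= K * weight (Z.abs_nat m) xi) /\
  forall x y xi, Cmod (s x xi - s y xi)%C <= K * dist1 x y * weight (Z.abs_nat m) xi.
Proof.
  intros [_ [Hs Hb]].
  destruct (Hb 0%nat 0%nat 0%nat 0%nat) as [K0 [HK0 B0]].
  destruct (Hb 1%nat 0%nat 0%nat 0%nat) as [K1 [HK1 B1]].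
  destruct (Hb 0%nat 1%nat 0%nat 0%nat) as [K2 [HK2 B2]].
  exists (K0 + 2 * (K1 + K2)).
  assert (P : forall K xi, 0 < K -> K * powerRZ (japanese xi) (m - Z.of_nat (0 + 0)) <= K * weight (Z.abs_nat m) xi).
  { intros K xi HK. apply Rmult_le_compat_l; [lra|].
    replace (m - Z.of_nat (0 + 0))%Z with m by lia. apply powerRZ_japanese_weight. }
  pose proof (fun xi => weight_ge1 (Z.abs_nat m) xi) as W1.
  split; [lra|]. split.
  - intros x xi. eapply Rle_trans; [apply (B0 x xi)|]. eapply Rle_trans; [now apply P|].
    specialize (W1 xi). nra.
  - intros [x1 x2] [y1 y2] xi. unfold dist1. cbn [fst snd].
    set (w := weight (Z.abs_nat m) xi) in *.
    assert (S1 : Cmod (s (x1, x2) xi - s (y1, x2) xi)%C <= 2 * (K1 * w) * Rabs (x1 - y1)).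
    { apply (cder_mvt (fun u => s (u, x2) xi) (fun u => dir f1 (uncurry4 s) ((u, x2), xi)) y1 x1).
      - intros z _. refine (eq_ind_r (fun d => cder (fun u => s (u, x2) xi) z d) _ (dir_i1 e1 (uncurry4 s) (z, x2) xi)).
        apply (cder_e1 (fun x => s x xi) z x2).
        apply (proj1 (derivable_i1 e1 (uncurry4 s) (z, x2) xi)).
        apply (smooth_derivable basis4 everywhere); [exact Hs|now left|easy].
      - intros z _. eapply Rle_trans; [apply (B1 (z, x2) xi)|now apply P]. }
    assert (S2 : Cmod (s (y1, x2) xi - s (y1, y2) xi)%C <= 2 * (K2 * w) * Rabs (x2 - y2)).
    { apply (cder_mvt (fun u => s (y1, u) xi) (fun u => dir f2 (uncurry4 s) ((y1, u), xi)) y2 x2).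
      - intros z _. refine (eq_ind_r (fun d => cder (fun u => s (y1, u) xi) z d) _ (dir_i1 e2 (uncurry4 s) (y1, z) xi)).
        apply (cder_e2 (fun x => s x xi) y1 z).
        apply (proj1 (derivable_i1 e2 (uncurry4 s) (y1, z) xi)).
        apply (smooth_derivable basis4 everywhere); [exact Hs|right; now left|easy].
      - intros z _. eapply Rle_trans; [apply (B2 (y1, z) xi)|now apply P]. }
    replace (s (x1, x2) xi - s (y1, y2) xi)%C with
      ((s (x1, x2) xi - s (y1, x2) xi) + (s (y1, x2) xi - s (y1, y2) xi))%C by ring.
    eapply Rle_trans; [apply Cmod_triangle|].
    assert (0 < w) by (specialize (W1 xi); unfold w; lra).
    pose proof (Rabs_pos (x1 - y1)). pose proof (Rabs_pos (x2 - y2)).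
    set (u := Rabs (x1 - y1)) in *. set (v := Rabs (x2 - y2)) in *.
    assert (0 <= K1 * w * v) by (repeat apply Rmult_le_pos; lra).
    assert (0 <= K2 * w * u) by (repeat apply Rmult_le_pos; lra).
    assert (0 <= K0 * w * u) by (repeat apply Rmult_le_pos; lra).
    assert (0 <= K0 * w * v) by (repeat apply Rmult_le_pos; lra). nra.
Qed.

Definition nc_integrand (s : R2 -> R2 -> C) (g : R2 -> C) (x : R2) : R2 -> R2 -> C :=
  fun t xi => (cis (- dot t xi) * (s x xi * alpha t g x))%C.

Lemma nc_integrand_amplitude m s K g B x : eucl_symbol m s ->
  (forall x xi, Cmod (s x xi) <= K * weight (Z.abs_nat m) xi) ->
  (forall x, continuous g x) -> (forall x, Cmod (g x) <= B) ->
  amplitude (Z.abs_nat m) (K * B) (nc_integrand s g x).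
Proof.
  intros [_ [Hs _]] HK Hg HB. split.
  - intros p. unfold nc_integrand, dot, alpha. apply continuous_Cmult; [cts|]. apply continuous_Cmult.
    + apply (continuous_comp (fun p : R2 * R2 => (x, snd p)) (uncurry4 s)); [cts|].
      apply (smooth_continuous basis4 everywhere); [exact Hs|easy].
    + apply (continuous_comp (fun p : R2 * R2 => plus x (fst p)) g); [|apply Hg].
      apply (continuous_plus (V := prod_NormedModule R_AbsRing R_NormedModule R_NormedModule)); cts.
  - intros t xi. unfold nc_integrand, alpha. rewrite !Cmod_mult, Cmod_cis, Rmult_1_l.
    specialize (HK x xi). specialize (HB (plus x t)).
    replace (K * B * weight (Z.abs_nat m) xi) with (K * weight (Z.abs_nat m) xi * B) by ring.
    apply Rmult_le_compat; auto using Cmod_ge_0.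
Qed.

Lemma dist1_pos x y : 0 <= dist1 x y.
Proof. unfold dist1. pose proof (Rabs_pos (fst x - fst y)). pose proof (Rabs_pos (snd x - snd y)). lra. Qed.

Definition freq (m n : Z) : R2 := (IZR m, IZR n).

(** The character at x + t splits: its factor in t joins the oscillating exponential and shifts xi
    by the frequency, its factor in x joins the symbol. *)
Lemma nc_integrand_square_sum s c N x t xi : nc_integrand s (square_sum c N) x t xi =
  symsum N (fun n => symsum N (fun m =>
    cis (phase t xi (freq m n)) * (c m n * (s x xi * cis (dot x (freq m n)))))%C).
Proof.
  unfold nc_integrand, alpha. destruct x as [x1 x2], t as [t1 t2].
  change (square_sum c N (plus (x1, x2) (t1, t2))) with (square_sum c N (x1 + t1, x2 + t2)).
  rewrite square_sum_symsum. cbn [fst snd].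
  rewrite Cmult_assoc, <- symsum_scal. apply symsum_ext. intros n.
  rewrite (Cmult_comm (symsum N _)), Cmult_assoc, <- symsum_scal. apply symsum_ext. intros m.
  assert (E : (cis (phase (t1, t2) xi (freq m n)) * cis (dot (x1, x2) (freq m n)))%C =
    (cis (- dot (t1, t2) xi) * (cis ((x2 + t2) * IZR n)%R * cis ((x1 + t1) * IZR m)%R))%C).
  { rewrite <- !cis_plus. f_equal. unfold phase, dot, freq. cbn [fst snd]. ring. }
  transitivity (cis (phase (t1, t2) xi (freq m n)) * cis (dot (x1, x2) (freq m n)) * (c m n * s (x1, x2) xi))%C;
    [rewrite E|]; ring.
Qed.

Lemma freq_weight m n : 1 + Rabs (IZR m) + Rabs (IZR n) <= 4 * weight 1 (freq m n).
Proof.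
  unfold weight, freq. cbn [fst snd]. rewrite pow_1, <- (pow2_abs (IZR m)), <- (pow2_abs (IZR n)).
  set (u := Rabs (IZR m)). set (v := Rabs (IZR n)).
  assert (0 <= u) by apply Rabs_pos. assert (0 <= v) by apply Rabs_pos.
  pose proof (pow2_ge_0 (u - 1)). pose proof (pow2_ge_0 (v - 1)).
  assert (0 <= u ^ 2 * v ^ 2) by (apply Rmult_le_pos; apply pow2_ge_0). nra.
Qed.

(** The product rule for differences; the character has a Lipschitz constant proportional to its
    frequency. *)
Lemma symbol_exp_lipschitz m s K x y k xi : 0 < K ->
  (forall x xi, Cmod (s x xi) <= K * weight (Z.abs_nat m) xi) ->
  (forall x y xi, Cmod (s x xi - s y xi)%C <= K * dist1 x y * weight (Z.abs_nat m) xi) ->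
  Cmod (s x xi * cis (dot x k) - s y xi * cis (dot y k))%C <=
    2 * K * (1 + Rabs (fst k) + Rabs (snd k)) * dist1 x y * weight (Z.abs_nat m) xi.
Proof.
  intros HK H1 H2. set (w := weight (Z.abs_nat m) xi).
  replace (s x xi * cis (dot x k) - s y xi * cis (dot y k))%C with
    ((s x xi - s y xi) * cis (dot x k) + s y xi * (cis (dot x k) - cis (dot y k)))%C by ring.
  eapply Rle_trans; [apply Cmod_triangle|]. rewrite !Cmod_mult, Cmod_cis, Rmult_1_r.
  specialize (H2 x y xi). specialize (H1 y xi). fold w in H1, H2.
  pose proof (cis_lipschitz (dot x k) (dot y k)) as L.
  assert (Dd : Rabs (dot x k - dot y k) <= (Rabs (fst k) + Rabs (snd k)) * dist1 x y).
  { unfold dot, dist1.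
    replace (fst x * fst k + snd x * snd k - (fst y * fst k + snd y * snd k))
      with ((fst x - fst y) * fst k + (snd x - snd y) * snd k) by ring.
    eapply Rle_trans; [apply Rabs_triang|]. rewrite !Rabs_mult.
    pose proof (Rabs_pos (fst x - fst y)). pose proof (Rabs_pos (snd x - snd y)).
    pose proof (Rabs_pos (fst k)). pose proof (Rabs_pos (snd k)). nra. }
  pose proof (dist1_pos x y) as D0. pose proof (Rabs_pos (fst k)). pose proof (Rabs_pos (snd k)).
  assert (W : 0 < w) by (pose proof (weight_ge1 (Z.abs_nat m) xi); unfold w; lra).
  set (d := dist1 x y) in *. set (a := Rabs (fst k) + Rabs (snd k)) in *.
  assert (T : Cmod (s y xi) * Cmod (cis (dot x k) - cis (dot y k))%C <= K * w * (2 * (a * d))).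
  { apply Rmult_le_compat; auto using Cmod_ge_0. lra. }
  assert (0 <= K * d * w) by (repeat apply Rmult_le_pos; lra). 
  replace (2 * K * (1 + Rabs (fst k) + Rabs (snd k)) * d * w) with (2 * K * (1 + a) * d * w) by (unfold a; ring).
  nra.
Qed.

(** The regularized integrals are Lipschitz in the point of the torus, uniformly in
    the regularization parameter: expand [f] in its Fourier series. *)
Lemma regularized_lipschitz m s f phi p0 : eucl_symbol m s -> smooth_T2 f -> rapid phi -> exists L, 0 <= L /\
  forall eps, 0 < eps <= 1 -> forall x y,
  Cmod (regularized phi p0 eps (nc_integrand s f x) - regularized phi p0 eps (nc_integrand s f y))%C <= L * dist1 x y.
Proof.
  intros Hs Hf Hphi. set (M := Z.abs_nat m).
  destruct (eucl_symbol_weight m s Hs) as [K [HK [HK1 HK2]]].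
  destruct (regularized_exp_bound phi p0 M Hphi) as [B [HB HBe]].
  (* Of the M + 2 powers, M absorb the weight at the frequency, one the factor 1 + |m| + |n|, and
     one makes the double series summable. *)
  destruct (fcoef_decay f (M + 2) (M + 2) Hf) as [D [HD HDc]].
  destruct (fourier_inversion2 f Hf) as [Kf [HKf HI]].
  destruct (smooth_T2_bounded f Hf) as [Bf HBf].
  assert (Hsc : forall x xi, continuous (s x) xi).
  { intros x xi. apply (continuous_comp (fun xi => (x, xi)) (uncurry4 s)); [cts|].
    apply (smooth_continuous basis4 everywhere); [apply Hs|easy]. }
  set (c := fcoef f) in *.
  assert (Hc : forall m n, Cmod (c m n) * (1 + Rabs (IZR m) + Rabs (IZR n)) * weight M (freq m n)
    <= 4 * D * bump (IZR m) * bump (IZR n)).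
  { intros m' n. specialize (HDc m' n). rewrite <- Rpow_mult_distr in HDc.
    change (((1 + IZR m' ^ 2) * (1 + IZR n ^ 2)) ^ (M + 2)) with (weight (M + 2) (freq m' n)) in HDc.
    pose proof (freq_weight m' n) as Fw. pose proof (weight_inv (freq m' n)) as Wi. cbn [fst snd freq] in Wi.
    replace (4 * D * bump (IZR m') * bump (IZR n)) with (4 * D * (bump (IZR m') * bump (IZR n))) by ring.
    rewrite <- Wi.
    rewrite weight_add in HDc. change 2%nat with (1 + 1)%nat in HDc. rewrite weight_add in HDc.
    pose proof (weight_ge1 1 (freq m' n)). pose proof (weight_ge1 M (freq m' n)).
    pose proof (Cmod_ge_0 (c m' n)).
    set (W := weight M (freq m' n)) in *. set (w := weight 1 (freq m' n)) in *. set (X := Cmod (c m' n)) in *.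
    apply (Rmult_le_reg_r w); [lra|]. rewrite (Rmult_assoc _ (/ w)), Rinv_l, Rmult_1_r by lra.
    apply Rle_trans with (X * (4 * w) * W * w).
    - apply Rmult_le_compat_r; [lra|]. apply Rmult_le_compat_r; [lra|]. now apply Rmult_le_compat_l.
    - replace (X * (4 * w) * W * w) with (4 * (W * (w * w) * X)) by ring. lra. }
  (* 25 comes from [symsum_bound] used twice, 2 K from [symbol_exp_lipschitz], 4 from
     [freq_weight]. *)
  exists (25 * (B * (2 * K * (4 * D)))).
  split. { repeat apply Rmult_le_pos; lra. }
  intros eps He x y. set (d := dist1 x y).
  assert (d0 : 0 <= d) by apply dist1_pos.
  (* [Ke] depends on eps. It only enters the error of replacing [f] by a partial sum, and N is
     chosen after eps. *)
  destruct (regularized_bound phi p0 eps M Hphi (proj1 He)) as [Ke [HKe Be]].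
  assert (Afx : forall x, amplitude M (K * Bf) (nc_integrand s f x)).
  { intros z. apply nc_integrand_amplitude; auto. now apply smooth_T2_continuous. }
  assert (Happ : forall N z, exists L, amplitude M L (nc_integrand s (square_sum c N) z) /\
    Cmod (regularized phi p0 eps (nc_integrand s f z) - regularized phi p0 eps (nc_integrand s (square_sum c N) z))%C
      <= Ke * (K * (Kf * inv_succ N))).
  { intros N z. 
    assert (BS : forall x, Cmod (square_sum c N x) <= Bf + Kf * inv_succ N).
    { intros u. pose proof (Cmod_minus_le (square_sum c N u) (f u)) as T.
      rewrite Cmod_minus_sym in T. specialize (HI N u). specialize (HBf u). lra. }
    pose proof (nc_integrand_amplitude m s K (square_sum c N) _ z Hs HK1 (square_sum_continuous c N) BS) as A1.
    eexists. split; [exact A1|].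
    rewrite <- (proj2 (regularized_minus phi p0 eps M _ _ _ _ Hphi (proj1 He) (Afx z) A1)).
    apply Be.
    replace (fun t xi => nc_integrand s f z t xi - nc_integrand s (square_sum c N) z t xi)%C
      with (nc_integrand s (fun u => f u - square_sum c N u)%C z).
    - apply nc_integrand_amplitude; auto. intros u. apply continuous_Cminus; auto using square_sum_continuous.
      now apply smooth_T2_continuous.
    - extensionality t. extensionality xi.
      unfold nc_integrand, alpha. ring. }
  assert (Hdiff : forall N, Cmod (regularized phi p0 eps (nc_integrand s (square_sum c N) x) -
      regularized phi p0 eps (nc_integrand s (square_sum c N) y))%C <= 25 * (B * (2 * K * (4 * D))) * d).
  { intros N.
    destruct (Happ N x) as [L1 [A1 _]], (Happ N y) as [L2 [A2 _]].
    rewrite <- (proj2 (regularized_minus phi p0 eps M _ _ _ _ Hphi (proj1 He) A1 A2)).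
    set (tau := fun m n xi => (c m n * (s x xi * cis (dot x (freq m n)) - s y xi * cis (dot y (freq m n))))%C).
    assert (tauc : forall m n xi, continuous (tau m n) xi).
    { intros m' n xi. unfold tau. apply continuous_Cmult; [apply continuous_const|].
      apply continuous_Cminus; apply continuous_Cmult; auto; apply continuous_const. }
    assert (taub : forall m n xi, Cmod (tau m n xi) <=
      Cmod (c m n) * (2 * K * (1 + Rabs (IZR m) + Rabs (IZR n)) * d) * weight M xi).
    { intros m' n xi. unfold tau. rewrite Cmod_mult, Rmult_assoc. apply Rmult_le_compat_l; [apply Cmod_ge_0|].
      apply (symbol_exp_lipschitz m s K x y (freq m' n) xi); auto. }
    replace (fun t xi => nc_integrand s (square_sum c N) x t xi - nc_integrand s (square_sum c N) y t xi)%C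
      with (fun t xi => symsum N (fun n => symsum N (fun m => cis (phase t xi (freq m n)) * tau m n xi)))%C.
    2:{ extensionality t. extensionality xi.
        rewrite !nc_integrand_square_sum, <- symsum_minus. apply symsum_ext. intros n.
        rewrite <- symsum_minus. apply symsum_ext. intros m'. unfold tau. ring. }
    pose proof (fun m n => phase_amplitude (freq m n) (tau m n) _ M (tauc m n) (taub m n)) as PA.
    pose proof (fun n => regularized_symsum phi p0 eps M N (fun m t xi => cis (phase t xi (freq m n)) * tau m n xi)%C _
      Hphi (proj1 He) (fun m => PA m n)) as R1.
    (* A bound for the inner sum is only known to exist; a choice for each n lets the outer sum be
       treated by the same lemma. *)
    set (bd := fun n => proj1_sig (constructive_indefinite_description _ (proj1 (R1 n)))).
    assert (Hbd : forall n, amplitude M (bd n) (fun t xi => symsum N (fun m => cis (phase t xi (freq m n)) * tau m n xi))%C).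
    { intros n. unfold bd. now destruct (constructive_indefinite_description _ (proj1 (R1 n))). }
    rewrite (proj2 (regularized_symsum phi p0 eps M N _ bd Hphi (proj1 He) Hbd)).
    rewrite (symsum_ext N _ (fun n => symsum N (fun m => regularized phi p0 eps
      (fun t xi => cis (phase t xi (freq m n)) * tau m n xi)%C))) by (intros n; apply (R1 n)).
    replace (25 * (B * (2 * K * (4 * D))) * d) with (5 * (5 * (B * (2 * K * (4 * D)) * d))) by ring.
    assert (P0 : 0 <= B * (2 * K * (4 * D)) * d) by (repeat apply Rmult_le_pos; lra).
    apply symsum_bound; [lra|]. intros n.
    rewrite (Rmult_assoc 5). apply symsum_bound; [pose proof (bump_pos (IZR n)); nra|]. intros m'.
    eapply Rle_trans; [apply HBe; [exact He|apply tauc|apply taub]|].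
    specialize (Hc m' n).
    replace (B * (Cmod (c m' n) * (2 * K * (1 + Rabs (IZR m') + Rabs (IZR n)) * d) * weight M (freq m' n)))
      with (B * 2 * K * d * (Cmod (c m' n) * (1 + Rabs (IZR m') + Rabs (IZR n)) * weight M (freq m' n))) by ring.
    replace (B * (2 * K * (4 * D)) * d * bump (IZR n) * bump (IZR m'))
      with (B * 2 * K * d * (4 * D * bump (IZR m') * bump (IZR n))) by ring.
    apply Rmult_le_compat_l; auto. repeat apply Rmult_le_pos; lra. }
  apply le_epsilon. intros e He'.
  set (Q := Ke * (K * Kf)).
  assert (HQ : 0 <= Q) by (unfold Q; repeat apply Rmult_le_pos; lra).
  destruct (inv_succ_small (e / (2 * (Q + 1)))) as [N HN]; [apply Rdiv_lt_0_compat; lra|].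
  specialize (HN N (le_n _)).
  assert (HN' : Ke * (K * (Kf * inv_succ N)) <= e / 2).
  { replace (Ke * (K * (Kf * inv_succ N))) with (Q * inv_succ N) by (unfold Q; ring).
    apply Rlt_div_r in HN; [|lra]. pose proof (inv_succ_pos N). nra. }
  destruct (Happ N x) as [_ [_ A1]], (Happ N y) as [_ [_ A2]]. specialize (Hdiff N).
  rewrite (Cmod_minus_sym (regularized phi p0 eps (nc_integrand s f y))) in A2.
  match goal with |- Cmod (?X - ?Y)%C <= _ =>
    match type of Hdiff with Cmod (?U - ?V)%C <= _ =>
      replace (X - Y)%C with ((X - U) + ((U - V) + (V - Y)))%C by ring;
      eapply Rle_trans; [apply Cmod_triangle|];
      pose proof (Cmod_triangle (U - V) (V - Y))%C end end.
  lra.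
Qed.

(** Equicontinuity in x: the limit inherits the Lipschitz constant, so closeness at x for small eps
    spreads to a neighbourhood of x, and compactness of the torus finishes. *)
Lemma regularized_uniform m s f phi p0 (v : R2 -> C) : eucl_symbol m s -> smooth_T2 f -> rapid phi -> periodic v ->
  (forall x, filterlim (fun eps => regularized phi p0 eps (nc_integrand s f x)) (at_right 0) (locally (v x))) ->
  A0_lim (at_right 0) (fun eps x => regularized phi p0 eps (nc_integrand s f x)) v.
Proof.
  intros Hs Hf Hphi Hv Hlim.
  destruct (regularized_lipschitz m s f phi p0 Hs Hf Hphi) as [L [HL HLip]].
  set (r := fun eps x => regularized phi p0 eps (nc_integrand s f x)) in *.
  assert (Hper : forall eps, periodic (r eps)).
  { intros eps x y.
    assert (E : forall x x', (forall xi, s x xi = s x' xi) -> (forall t, f (plus x t) = f (plus x' t)) -> r eps x = r eps x').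
    { intros z z' E1 E2. unfold r. f_equal. extensionality t.
      extensionality xi. unfold nc_integrand, alpha. now rewrite E1, E2. }
    destruct Hs as [Hs _]. destruct Hf as [Hf _].
    split; apply E; try (intros xi; apply Hs); intros [t1 t2].
    - change (f (x + 2 * PI + t1, y + t2) = f (x + t1, y + t2)).
      replace (x + 2 * PI + t1) with (x + t1 + 2 * PI) by ring. apply Hf.
    - change (f (x + t1, y + 2 * PI + t2) = f (x + t1, y + t2)).
      replace (y + 2 * PI + t2) with (y + t2 + 2 * PI) by ring. apply Hf. }
  assert (Hlim' : forall x e, 0 < e -> at_right 0 (fun eps => Cmod (r eps x - v x)%C < e)).
  { intros x. apply (C_filterlim (at_right 0) (fun eps => r eps x)). apply Hlim. }
  (* One eps close to the limit at both x and y is enough. *)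
  assert (vLip : forall x y, Cmod (v x - v y)%C <= L * dist1 x y).
  { intros x y. apply le_epsilon. intros e He.
    pose proof (filter_and (F := at_right 0) _ _ (Hlim' x (e / 2) ltac:(lra)) (Hlim' y (e / 2) ltac:(lra))) as [d Hd].
    set (eps := Rmin (d / 2) 1).
    assert (Heps : 0 < eps <= 1 /\ eps < d).
    { pose proof (cond_pos d). unfold eps. repeat split.
      - apply Rmin_pos; lra. - apply Rmin_r. - pose proof (Rmin_l (d / 2) 1). lra. }
    destruct (Hd eps) as [H1 H2]; [change (Rabs (eps - 0) < d); rewrite Rminus_0_r, Rabs_pos_eq; lra|lra|].
    specialize (HLip eps (proj1 Heps) x y). fold (r eps x) (r eps y) in HLip.
    rewrite Cmod_minus_sym in H1.
    replace (v x - v y)%C with ((v x - r eps x) + ((r eps x - r eps y) + (r eps y - v y)))%C by ring.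
    eapply Rle_trans; [apply Cmod_triangle|].
    pose proof (Cmod_triangle (r eps x - r eps y) (r eps y - v y))%C. lra. }
  apply (A0_lim_iff (at_right 0) r v). intros e He.
  (* The tube lemma works with full neighbourhoods of 0, so the restriction to eps > 0 is moved into
     the property. *)
  assert (T : locally (0 : R) (fun eps => forall x, in_box x -> 0 < eps -> Cmod (r eps x - v x)%C < e)).
  { apply (tube2 (fun eps x => 0 < eps -> Cmod (r eps x - v x)%C < e)). intros x.
    destruct (Hlim' x (e / 2) ltac:(lra)) as [d Hd].
    (* The two coordinates give distance below e / (4 (L + 1)), so the two Lipschitz errors are
       below e / 4 each; the bound 1 keeps eps in the range of the Lipschitz estimate. *)
    set (d' := Rmin (Rmin d 1) (e / (8 * (L + 1)))).
    assert (Hd' : 0 < d').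
    { unfold d'. repeat apply Rmin_pos; try lra; [apply cond_pos|]. apply Rdiv_lt_0_compat; lra. }
    exists (mkposreal _ Hd'). intros [eps y] [B1 [B2 B3]] Heps. cbn [fst snd] in *.
    change (Rabs (eps - 0) < d') in B1. rewrite Rminus_0_r, Rabs_pos_eq in B1 by lra.
    change (Rabs (fst y - fst x) < d') in B2. change (Rabs (snd y - snd x) < d') in B3.
    assert (D1 : d' <= d /\ d' <= 1 /\ d' <= e / (8 * (L + 1))).
    { unfold d'. pose proof (Rmin_l (Rmin d 1) (e / (8 * (L + 1)))). pose proof (Rmin_r (Rmin d 1) (e / (8 * (L + 1)))).
      pose proof (Rmin_l d 1). pose proof (Rmin_r d 1). lra. }
    assert (H1 : Cmod (r eps x - v x)%C < e / 2).
    { apply Hd; [change (Rabs (eps - 0) < d); rewrite Rminus_0_r, Rabs_pos_eq; lra|lra]. }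
    assert (Dist : dist1 y x < e / (4 * (L + 1))).
    { apply Rlt_le_trans with (d' + d'); [exact (Rplus_lt_compat _ _ _ _ B2 B3)|].
      replace (e / (4 * (L + 1))) with (e / (8 * (L + 1)) + e / (8 * (L + 1))) by (field; lra). lra. }
    assert (LD : L * dist1 y x < e / 4).
    { apply Rlt_div_r in Dist; [|lra]. pose proof (dist1_pos y x). nra. }
    pose proof (HLip eps ltac:(lra) y x) as H2. fold (r eps y) (r eps x) in H2.
    pose proof (vLip y x) as H3. rewrite Cmod_minus_sym in H3.
    replace (r eps y - v y)%C with ((r eps y - r eps x) + ((r eps x - v x) + (v x - v y)))%C by ring.
    eapply Rle_lt_trans; [apply Cmod_triangle|].
    pose proof (Cmod_triangle (r eps x - v x) (v x - v y))%C. lra. }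
  destruct T as [d Hd]. exists d. intros eps Heps Hpos x.
  destruct (periodic_reduce x) as [q [Hq Eq]]. rewrite (Eq _ (Hper eps)), (Eq _ Hv). now apply Hd.
Qed.

(** * Comparison of the two quantizations *)

(** The substitution y = x + t moves the base point of the regularization by x; the quantification
    over base points in [is_osc] and [is_osc_A0] absorbs this. *)
Definition base_shift (p0 : R4) (x : R2) : R4 := (plus (fst p0) x, snd p0).

(** The substitution [y = x + t]. *)
Lemma regularized_translate phi p0 eps s f x :
  regularized phi (base_shift p0 x) eps (fun y xi => cis (dot (minus x y) xi) * s x xi * f y)%C =
  regularized phi p0 eps (nc_integrand s f x).
Proof.
  unfold regularized. apply (f_equal int_R2). extensionality xi.
  rewrite <- (int_R2_translate _ x). apply (f_equal int_R2). extensionality t.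
  unfold nc_integrand, alpha.
  replace (dot (minus x (plus t x)) xi) with (- dot t xi).
  - replace (plus t x) with (plus x t) by apply plus_comm.
    rewrite (Cmult_assoc (cis _)). f_equal. apply (f_equal phi).
    refine (eq_trans (scal_minus_R4 eps _ _ _) (eq_sym (eq_trans (scal_minus_R4 eps _ _ _) _))).
    unfold base_shift. cbn [fst snd].
    change (fst (plus x t)) with (fst x + fst t). change (snd (plus x t)) with (snd x + snd t).
    change (fst (plus (fst p0) x)) with (fst (fst p0) + fst x). change (snd (plus (fst p0) x)) with (snd (fst p0) + snd x).
    f_equal; f_equal; ring.
  - destruct x as [x1 x2], t as [t1 t2]. 
    change (minus (x1, x2) (plus (t1, t2) (x1, x2))) with (x1 + - (t1 + x1), x2 + - (t2 + x2)).
    unfold dot. cbn [fst snd]. ring.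
Qed.

Lemma base_shift_inv p0 x : base_shift (base_shift p0 (opp x)) x = p0.
Proof.
  destruct p0 as [[a b] c], x as [x1 x2]. unfold base_shift. cbn [fst snd].
  apply injective_projections; [|reflexivity].
  change ((a + - x1 + x1, b + - x2 + x2) = (a, b)). f_equal; ring.
Qed.

Definition fourpi2 : C := RtoC ((2 * PI) ^ 2).

Lemma fourpi2_neq : fourpi2 <> 0%C.
Proof. unfold fourpi2. intros E. apply RtoC_inj in E. pose proof two_PI_pos. nra. Qed.

Lemma fourpi2_E : fourpi2 = (RtoC (2 * PI) * RtoC (2 * PI))%C.
Proof. unfold fourpi2. rewrite <- RtoC_mult. f_equal. ring. Qed.

Lemma regularized_nc_scal m s c f x phi p0 eps : eucl_symbol m s -> smooth_T2 f -> rapid phi -> 0 < eps ->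
  regularized phi p0 eps (nc_integrand (fun x xi => c * s x xi)%C f x) =
  (c * regularized phi p0 eps (nc_integrand s f x))%C.
Proof.
  intros Hs Hf Hphi He.
  destruct (eucl_symbol_weight m s Hs) as [K [HK [HK1 _]]].
  destruct (smooth_T2_bounded f Hf) as [B HB].
  pose proof (nc_integrand_amplitude m s K f B x Hs HK1 (smooth_T2_continuous f Hf) HB) as A.
  rewrite <- (proj2 (regularized_scal phi p0 eps _ c _ _ Hphi He A)). f_equal.
  extensionality t. extensionality xi.
  unfold nc_integrand. ring.
Qed.

Lemma at_right_pos : at_right 0 (fun eps => 0 < eps).
Proof. exists (mkposreal 1 Rlt_0_1). auto. Qed.

Lemma inv_fourpi2 : (/ (2 * PI) ^ 2)%C = (/ fourpi2)%C.
Proof. unfold fourpi2. now rewrite <- RtoC_mult, RtoC_pow. Qed.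

(** Norm convergence implies convergence at x. The base point is shifted by -x beforehand, so that
    the translation returns it to [p0]. *)
Lemma nc_op_eucl m s P : eucl_symbol m s -> is_nc_op (flip2 s) P ->
  is_eucl_op (fun x xi => / fourpi2 * s x xi)%C P.
Proof.
  intros Hs HP f x phi p0 Hphi H1. destruct (HP f) as [v [Hv E]].
  specialize (Hv phi (base_shift p0 (opp x)) Hphi H1).
  pose proof (schwartz_rapid phi Hphi) as Hr.
  assert (Hlim : forall e, 0 < e -> at_right 0 (fun eps =>
    Cmod (regularized phi (base_shift p0 (opp x)) eps (nc_integrand s f x) - v x)%C < e)).
  { intros e He.
    pose proof (proj1 (A0_lim_iff (at_right 0) (fun eps y => regularized phi (base_shift p0 (opp x)) eps (nc_integrand s f y)) v) Hv e He) as L.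
    revert L. apply filter_imp. intros eps Heps. apply Heps. }
  rewrite E, inv_fourpi2.
  apply (C_filterlim (at_right 0)). intros e He.
  assert (Hc : 0 < Cmod (/ fourpi2)).
  { apply Cmod_gt_0. intros Z. apply (f_equal (Cmult fourpi2)) in Z.
    rewrite Cinv_r, Cmult_0_r in Z by apply fourpi2_neq. apply RtoC_inj in Z. lra. }
  assert (He' : 0 < e / Cmod (/ fourpi2)) by now apply Rdiv_lt_0_compat.
  pose proof (filter_and (F := at_right 0) _ _ (Hlim _ He') at_right_pos) as L. revert L.
  apply filter_imp. intros eps [Heps Hpos].
  pose proof (regularized_translate phi (base_shift p0 (opp x)) eps (fun x xi => / fourpi2 * s x xi)%C f x) as T.
  rewrite base_shift_inv in T. rewrite T.
  rewrite (regularized_nc_scal m s _ f x phi _ eps Hs (Cinf_smooth f) Hr Hpos).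
  match goal with |- Cmod (?c * ?a - ?c * ?b)%C < _ => replace (c * a - c * b)%C with (c * (a - b))%C by ring end.
  rewrite Cmod_mult. apply Rlt_div_r in Heps; [|exact Hc]. lra.
Qed.

(** The Euclidean limits at different x come with different base points and carry no uniformity;
    [regularized_uniform] supplies it, with [4 pi^2 P f] as the periodic limit. *)
Lemma eucl_op_nc m s P : eucl_symbol m s -> is_eucl_op s P ->
  is_nc_op (flip2 (fun x xi => fourpi2 * s x xi)%C) P.
Proof.
  intros Hs HP f. exists (fun x => fourpi2 * P f x)%C. split.
  - intros phi p0 Hphi H1. pose proof (schwartz_rapid phi Hphi) as Hr.
    apply (regularized_uniform m (fun x xi => fourpi2 * s x xi)%C f phi p0); auto.
    + now apply eucl_symbol_scal.
    + apply Cinf_smooth.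
    + destruct (Cinf_smooth (P f)) as [Hp _]. intros x y. now rewrite (proj1 (Hp x y)), (proj2 (Hp x y)).
    + intros x. specialize (HP f x phi (base_shift p0 x) Hphi H1).
      pose proof (proj1 (C_filterlim (at_right 0) _ _) HP) as L. cbv beta in L.
      apply (C_filterlim (at_right 0)). intros e He.
      assert (Hc : 0 < Cmod fourpi2) by (apply Cmod_gt_0, fourpi2_neq).
      assert (He' : 0 < e / Cmod fourpi2) by now apply Rdiv_lt_0_compat.
      pose proof (filter_and (F := at_right 0) _ _ (L _ He') at_right_pos) as L'. revert L'.
      apply filter_imp. intros eps [Heps Hpos].
      rewrite regularized_translate in Heps.
      rewrite (regularized_nc_scal m s _ f x phi _ eps Hs (Cinf_smooth f) Hr Hpos).
      match goal with |- Cmod (?c * ?a - ?c * ?b)%C < _ => replace (c * a - c * b)%C with (c * (a - b))%C by ring end.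
      rewrite Cmod_mult. apply Rlt_div_r in Heps; [|exact Hc]. lra.
  - intros x. rewrite inv_fourpi2, Cmult_assoc, Cinv_l by apply fourpi2_neq. ring.
Qed.

(** * Comparison of the residue integrals *)

Lemma int_T2_II2 f : int_T2 f = II2 integral_T (fun u w => f (u, w)).
Proof.
  unfold II2. rewrite integral_T_E.
  change (int_T2 f) with (CInt (fun x => CInt (fun y => f (x, y)) 0 (2 * PI)) 0 (2 * PI)).
  apply (f_equal (fun F => CInt F 0 (2 * PI))). extensionality x.
  symmetry. apply integral_T_E.
Qed.

Lemma int_T2_scal c f : smooth_T2 f -> int_T2 (fun x => c * f x)%C = (c * int_T2 f)%C.
Proof.
  intros Hf. destruct (smooth_T2_bounded f Hf) as [B HB].
  pose proof (curry_dominated f B (smooth_T2_continuous f Hf) HB) as D.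
  rewrite !int_T2_II2. exact (II2_scal integral_T _ c _ D).
Qed.

Lemma smooth_T2_0 : smooth_T2 (fun _ => RtoC 0).
Proof.
  split; [now split|].
  assert (D : forall l, dirs l (fun _ : R2 => RtoC 0) = fun _ => RtoC 0).
  { induction l as [|v l IH]; [reflexivity|]. refine (eq_trans (f_equal (dir v) IH) _).
    extensionality p. unfold dir, line. now rewrite !Derive_const. }
  intros l _ p _. refine (eq_ind_r (fun F => continuous F p /\ forall v, In v basis2 -> derivable_along v F p) _ (D l)).
  split; [apply continuous_const|]. intros v _.
  split; exact (ex_derive_const (V := R_NormedModule) (0 : R) (0 : R)).
Qed.

(** Normalization of the trace on one side, division of the symbol by 4 pi^2 on the other. *)
Lemma trace_hom_term n k g xi : (forall j, smooth_A0_on nonzero (g j)) -> nonzero xi ->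
  trace (hom_term (fun _ _ => RtoC 0) n g k xi) =
  int_T2 (fun x => hom_term (fun _ _ => RtoC 0) n (fun j x xi => / fourpi2 * g j xi x)%C k x xi).
Proof.
  intros Hg Hxi. unfold hom_term. destruct (k <=? n)%Z.
  - set (j := Z.to_nat (n - k)).
    assert (S : smooth_T2 (g j xi)) by (apply (Hg j []); [apply incl_nil_l|exact Hxi]).
    rewrite (trace_int_T2 _ S). refine (eq_trans _ (eq_sym (int_T2_scal (/ fourpi2)%C (g j xi) S))).
    apply (f_equal (fun z => z * int_T2 (g j xi))%C).
    rewrite fourpi2_E. field. apply RtoC_2PI_neq.
  (* No term of this order: both sides come from the zero function. *)
  - rewrite (trace_int_T2 _ smooth_T2_0).
    refine (eq_trans (eq_sym (int_T2_scal _ _ smooth_T2_0)) _). apply (f_equal int_T2).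
    extensionality x. ring.
Qed.

Lemma nonzero_circle t : nonzero (cos t, sin t).
Proof.
  intros E. injection E as E1 E2. pose proof (sin2_cos2 t) as H. rewrite E1, E2 in H. unfold Rsqr in H. lra.
Qed.

Lemma residue_integrals n k g : (forall j, smooth_A0_on nonzero (g j)) ->
  int_S1 (fun xi => trace (hom_term (fun _ _ => RtoC 0) n g k xi)) =
  int_S1 (fun xi => int_T2 (fun x =>
    hom_term (fun _ _ => RtoC 0) n (fun j x xi => / fourpi2 * g j xi x)%C k x xi)).
Proof.
  intros Hg. unfold int_S1. apply (f_equal int_0_2PI). extensionality t.
  apply trace_hom_term; auto. apply nonzero_circle.
Qed.

Theorem theorem4p1 (P : Cinf -> Cinf) : nc_classical_op P -> Res_A0 P = Res_T2 P.
Proof.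
  (* Both residues apply [iota] to a predicate in r, so it suffices that the predicates agree. *)
  intros _. unfold Res_A0, Res_T2. f_equal. extensionality r.
  apply propositional_extensionality. split.
  - intros [n [sigma [h [Hc [Hop ->]]]]].
    pose proof (nc_classical_eucl n sigma h Hc) as He.
    exists n, (fun x xi => / fourpi2 * flip2 sigma x xi)%C, (fun j x xi => / fourpi2 * flip2 (h j) x xi)%C.
    split; [now apply eucl_classical_scal|]. split.
    + apply (nc_op_eucl n (flip2 sigma)); [apply He|exact Hop].
    + apply residue_integrals. intros j. apply Hc.
  - intros [m [s [h [Hc [Hop ->]]]]].
    pose proof (eucl_classical_nc _ _ _ (eucl_classical_scal fourpi2 m s h Hc)) as Hn.
    exists m, (flip2 (fun x xi => fourpi2 * s x xi)%C), (fun j => flip2 (fun x xi => fourpi2 * h j x xi)%C).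
    split; [exact Hn|]. split.
    + apply (eucl_op_nc m); [apply Hc|exact Hop].
    + rewrite residue_integrals by (intros j; apply Hn).
      (* The expansion was multiplied by 4 pi^2 to reach the other side, and [residue_integrals]
         divides by it again, so the original expansion returns. *)
      replace (fun j x xi => / fourpi2 * flip2 (fun x xi => fourpi2 * h j x xi) xi x)%C with h; auto.
      extensionality j. extensionality x.
      extensionality xi. unfold flip2.
      rewrite Cmult_assoc, Cinv_l by apply fourpi2_neq. ring.
Qed.
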